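(* Let $\ell\in\mathbb{Z}_{\ge 0}$ and $a\in\mathbb{R}$, let $f:\mathbb{C}_+\to\mathbb{C}$ and $g:\mathbb{C}_+\to\mathbb{C}_+$ be analytic functions, and let $W_{f,g}$ be a (not necessarily maximal) weighted composition operator, i.e. $W_{f,g}\preceq W_{f,g,\max}$. Then $W_{f,g}$ is $\mathcal{C}_a$-selfadjoint on $\mathbb{B}_\ell(\mathbb{C}_+)$ if and only if both of the following conditions hold. (1) The operator $W_{f,g}$ is maximal, that is, $W_{f,g}=W_{f,g,\max}$. (2) One of the following three cases holds (for all $w\in\mathbb{C}_+$): (i) $g(w)=\mu$ and $f(w)=\dfrac{\delta}{(w+\mu-ia)^{\ell+2}}$, where $\mu\in\mathbb{C}_+$ and $\delta\in\mathbb{C}$; (ii) $g(w)=w+\gamma$ and $f(w)=\lambda$, where $\gamma\in\mathbb{C}$ with $\operatorname{Re}\gamma\ge 0$ and $\lambda\in\mathbb{C}$; (iii) $g(w)=-\dfrac{\beta}{\alpha}-\dfrac{2}{\alpha(w-ia)-\beta}$ and $f(w)=\dfrac{\delta}{(\alpha(w-ia)-\beta)^{\ell+2}}$, where $\alpha\in\mathbb{C}\setminus\{0\}$, $\beta,\delta\in\mathbb{C}$, and either $\operatorname{Re}\frac{\beta}{\alpha}=\operatorname{Im}\frac1\alpha=0$ and $\operatorname{Re}\frac1\alpha<0$, or $\operatorname{Re}\frac{\beta}{\alpha}<0$ and $\left(\operatorname{Re}\frac{\beta}{\alpha}\right)^2\ge\operatorname{Re}\frac1\alpha+\frac1{|\alpha|}$.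 In this case, the operator $W_{f,g}$ is bounded.
   Context: $\mathbb{C}_+=\{z\in\mathbb{C}:\operatorname{Re}z>0\}$. For $\ell\in\mathbb{Z}_{\ge0}$, the weighted Bergman space $\mathbb{B}_\ell(\mathbb{C}_+)$ is the Hilbert space of analytic functions $h:\mathbb{C}_+\to\mathbb{C}$ with $\|h\|^2=\frac1\pi\int_{-\infty}^{\infty}\int_0^\infty x^\ell|h(x+iy)|^2\,dx\,dy<\infty$. For analytic $f:\mathbb{C}_+\to\mathbb{C}$ and $g:\mathbb{C}_+\to\mathbb{C}_+$, the maximal weighted composition operator $W_{f,g,\max}$ has domain $\{h\in\mathbb{B}_\ell(\mathbb{C}_+): f\cdot(h\circ g)\in\mathbb{B}_\ell(\mathbb{C}_+)\}$ and acts by $W_{f,g,\max}h=f\cdot(h\circ g)$. For linear operators, $A\preceq B$ means $\operatorname{dom}(A)\subseteq\operatorname{dom}(B)$ and $Ax=Bx$ for $x\in\operatorname{dom}(A)$; $W_{f,g}$ denotes an operator with $W_{f,g}\preceq W_{f,g,\max}$. It is called bounded if its domain is all of $\mathbb{B}_\ell(\mathbb{C}_+)$ and there is $L>0$ with $\|W_{f,g}h\|\le L\|h\|$ for every $h$. A conjugation is an anti-linear isometric involution. For a conjugation $\mathcal{C}$, a (densely defined, not necessarily bounded) linear operator $B$ is called $\mathcal{C}$-selfadjoint if $B=\mathcal{C}B^*\mathcal{C}$ (equality including domains). For $a\in\mathbb{R}$, $\mathcal{C}_a$ is the conjugation on $\mathbb{B}_\ell(\mathbb{C}_+)$ given by $\mathcal{C}_a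 h(z)=\overline{h(\overline{z}+ia)}$.
   Formalization: Condition (2) is required only when f is not identically zero: for f ≡ 0 the maximal operator is the zero operator on the whole space, which is C_a-selfadjoint for every analytic g (e.g. g(w)=2w), so the literal ''only if'' fails there. *)

(* Defs.v *)
From HB Require Import structures.
From mathcomp Require Import all_boot all_order all_algebra.
From mathcomp Require Import all_classical all_reals all_analysis.
From mathcomp.real_closed Require Import complex.

Set Implicit Arguments.
Unset Strict Implicit.
Unset Printing Implicit Defensive.

Import Order.TTheory GRing.Theory Num.Theory.
Import numFieldNormedType.Exports.

Local Open Scope classical_set_scope.
Local Open Scope ring_scope.
Local Open Scope complex_scope.

Section HalfPlane.
Context {R : realType}.

Definition rhp : Type := {z : R[i] | 0 < complex.Re z}.

(* Only the values on the half-plane matter: it is open, so differentiability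
   at a point of it, and integrals over it, ignore the value 0 used outside. *)
Definition extend (h : rhp -> R[i]) (z : R[i]) : R[i] := oapp h 0 (insub z).

(* [R[i]^o] is the field of complex numbers as a normed space over itself, so
   that [derivable _ z 1] is complex differentiability at [z]. *)
Definition analytic (h : rhp -> R[i]) : Prop :=
  forall z : rhp, derivable (extend h : R[i]^o -> R[i]^o) (val z) 1.

Definition analytic_map (g : rhp -> rhp) : Prop :=
  analytic (fun z => val (g z)).

Lemma reflect_subproof (a : R) (z : rhp) :
  0 < complex.Re (conjc (val z) + (0 +i* a)).
Proof. by case: z => -[x y] /= x0; rewrite addr0. Qed.

Definition reflect_rhp (a : R) (z : rhp) : rhp :=
  exist _ (conjc (val z) + (0 +i* a)) (reflect_subproof a z).

Definition conj_a (a : R) (h : rhp -> R[i]) : rhp -> R[i] :=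
  fun z => conjc (h (reflect_rhp a z)).

End HalfPlane.
Arguments rhp : clear implicits.

Section Bergman.
Context {R : realType} (l : nat).

Local Notation H := (rhp R -> R[i]).
Local Notation mu := (@lebesgue_measure R).
Local Notation area := (mu \x mu)%E.

Definition half_plane : set (R * R) := [set p | 0 < p.1].

Definition bergman_sqnorm (h : H) : \bar R :=
  ((pi^-1)%:E * \int[area]_(p in half_plane)
     (p.1 ^+ l * Normc.normc (extend h (p.1 +i* p.2)) ^+ 2)%:E)%E.

Definition bergman : set H :=
  [set h | analytic h /\ (bergman_sqnorm h < +oo)%E].

Definition bergman_norm (h : H) : R := Num.sqrt (fine (bergman_sqnorm h)).

(* The inner product inducing the norm; the complex-valued integral is taken
   through its real and imaginary parts. *)
Definition bergman_inner (u v : H) : R[i] :=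
  let F (p : R * R) : R[i] :=
    (p.1 ^+ l)%:C * (extend u (p.1 +i* p.2) * conjc (extend v (p.1 +i* p.2))) in
  (pi^-1)%:C *
  ((\int[area]_(p in half_plane) complex.Re (F p)) +i*
   (\int[area]_(p in half_plane) complex.Im (F p))).

(* Partial operators: [op_app] is only meaningful on [op_dom], and operators
   are compared with [op_le] and [op_eq] below, never with Leibniz equality. *)
Record operator := Operator {
  op_dom : set H;
  op_app : H -> H
}.

Definition linear_operator (A : operator) : Prop :=
  [/\ op_dom A `<=` bergman,
      forall h, op_dom A h -> bergman (op_app A h),
      op_dom A (fun=> 0) &
      forall (c : R[i]) (u v : H), op_dom A u -> op_dom A v ->
        op_dom A (fun z => c * u z + v z) /\
        op_app A (fun z => c * u z + v z) =
          (fun z => c * op_app A u z + op_app A v z)].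

Definition op_le (A B : operator) : Prop :=
  op_dom A `<=` op_dom B /\
  forall h, op_dom A h -> op_app A h = op_app B h.

Definition op_eq (A B : operator) : Prop := op_le A B /\ op_le B A.

Definition densely_defined (A : operator) : Prop :=
  forall h, bergman h -> forall e : R, 0 < e ->
    exists2 u, op_dom A u & bergman_norm (fun z => h z - u z) < e.

Definition bounded_operator (A : operator) : Prop :=
  op_dom A = bergman /\
  exists2 L : R, 0 < L &
    forall h, bergman h -> bergman_norm (op_app A h) <= L * bergman_norm h.

Definition adjoint_rel (A : operator) (v : H) : set H :=
  [set u | bergman u /\ forall h, op_dom A h ->
     bergman_inner (op_app A h) v = bergman_inner h u].

(* When [A] is densely defined, [adjoint_rel A v] has at most one element, and
   [xget] picks it if it exists. *)
Definition adjoint (A : operator) : operator := {|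
  op_dom := [set v | bergman v /\ exists u, adjoint_rel A v u];
  op_app := fun v => xget (fun=> 0) (adjoint_rel A v) |}.

Definition sandwich (C : H -> H) (A : operator) : operator := {|
  op_dom := [set h | bergman h /\ op_dom A (C h)];
  op_app := fun h => C (op_app A (C h)) |}.

Definition C_selfadjoint (C : H -> H) (A : operator) : Prop :=
  densely_defined A /\ op_eq A (sandwich C (adjoint A)).

Definition wcomp_max (f : H) (g : rhp R -> rhp R) : operator := {|
  op_dom := [set h | bergman h /\ bergman (fun z => f z * h (g z))];
  op_app := fun h z => f z * h (g z) |}.

End Bergman.
Arguments operator : clear implicits.

Section Cases.
Context {R : realType} (l : nat) (a : R).
Variables (f : rhp R -> R[i]) (g : rhp R -> rhp R).

Definition case_constant : Prop :=
  exists mu delta : R[i], 0 < complex.Re mu /\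
  forall w : rhp R,
    val (g w) = mu /\
    f w = delta / (val w + mu - (0 +i* a)) ^+ (l + 2).

Definition case_translation : Prop :=
  exists gamma lambda : R[i], 0 <= complex.Re gamma /\
  forall w : rhp R, val (g w) = val w + gamma /\ f w = lambda.

Definition case_fractional : Prop :=
  exists alpha beta delta : R[i],
  [/\ alpha != 0,
      [/\ complex.Re (beta / alpha) = 0, complex.Im (1 / alpha) = 0 &
          complex.Re (1 / alpha) < 0] \/
      (complex.Re (beta / alpha) < 0 /\
       complex.Re (1 / alpha) + 1 / Normc.normc alpha <=
         complex.Re (beta / alpha) ^+ 2) &
      forall w : rhp R,
        val (g w) =
          - (beta / alpha) - 2 / (alpha * (val w - (0 +i* a)) - beta) /\
        f w = delta / (alpha * (val w - (0 +i* a)) - beta) ^+ (l + 2)].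

End Cases.

(* Main.v *)
Require Import Defs.
From HB Require Import structures.
From mathcomp Require Import all_boot all_order all_algebra.
From mathcomp Require Import all_classical all_reals all_analysis.
From mathcomp.real_closed Require Import complex.
From mathcomp Require Import measurable_realfun ring lra.

Set Implicit Arguments.
Unset Strict Implicit.
Unset Printing Implicit Defensive.

Import Order.TTheory GRing.Theory Num.Theory.
Local Open Scope ring_scope.

(** Write k_w for [kern l w], the function z |-> (z + conj w)^-(l+2). Everything rests on the
    reproducing property ([reproducing]): there is kappa > 0 such that the inner product of h with
    k_w is kappa h(w), for every h in the Bergman space.

    Necessity. By the reproducing property the adjoint of W sends k_w to conj(f(w)) k_{g(w)}, while
    C_a sends k_w to k_{conj w + ia}. Tested on kernels, C_a-selfadjointness becomes f(z) (z - ia +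
    g(w))^(l+2) = f(w) (w - ia + g(z))^(l+2) ([symbol_equation]). If f is nonzero somewhere, it is
    then nonzero everywhere. Multiplying the equation around three points cancels f and leaves an
    equality of (l+2)-th powers; the quotient of the bases is a continuous root of unity on a
    connected set, equal to 1 at one point, so the bases agree ([three_point]). This makes g a
    Moebius map of a special form: a translation, a constant, or the fractional case
    ([symbol_cases]). In the last case the inequalities on the parameters express that g maps the
    half-plane into itself ([halfplane_inversion_bound]). The symbol equation then gives f from g.

    Sufficiency. In each case h |-> f (h o g) is an everywhere defined bounded operator V whose
    adjoint is C V C ([symmetric_bounded]). For constant g it has rank one. For translations, the
    adjoint of the shift by c is the shift by conj c ([transl_inner]): vertical shifts are
    isometries, horizontal ones are handled by Cauchy's theorem on strips. In the fractional case V
    is a multiple of shift, inversion, shift, inversion, shift, where inversion is the unitary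
    involution h |-> z^-(l+2) h(1/z), and the inequalities say that the shifts preserve the
    half-plane ([moebius]). Given such a V, a C_a-selfadjoint W below it must be defined everywhere,
    which yields maximality and boundedness ([symmetric_bounded_C_selfadjoint]).

    Reproducing property. It suffices that h(w) = 0 makes h orthogonal to k_w ([inner_kern_eq0]). On
    the line Re z = x one has conj z = 2 x - z, so for fixed x the integrand is analytic in z and
    the line can be moved to a fixed Re z = t < Re w. Integrating in x over ]0, T] is then
    elementary and leaves h(z) / (w - z) times a bounded factor; as h(w) = 0, the line can cross w
    and go to Re z = T, where the integral is small for suitable large T. Cauchy's theorem itself
    comes from Goursat's bisection on rectangles. *)

Section Background.
Import numFieldNormedType.Exports.
Local Open Scope classical_set_scope.
Local Open Scope complex_scope.
Local Notation normc := Normc.normc.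
Local Notation Re := complex.Re.
Local Notation Im := complex.Im.

(** * Bisection of rectangles *)

Section Bisection.
Context {R : realType}.
Variables (a0 b0 c0 d0 : R) (Phi : R -> R -> R -> R -> R).

Definition subrect (a b c d : R) :=
  [&& a0 <= a, a <= b, b <= b0, c0 <= c, c <= d & d <= d0].

Hypothesis splitx : forall a m b c d, subrect a b c d -> a <= m <= b ->
  Phi a b c d = Phi a m c d + Phi m b c d.
Hypothesis splity : forall a b c m d, subrect a b c d -> c <= m <= d ->
  Phi a b c d = Phi a b c m + Phi a b m d.
Hypothesis local_small : forall x y e, a0 <= x <= b0 -> c0 <= y <= d0 ->
  0 < e -> exists2 r, 0 < r & forall a b c d, subrect a b c d ->
    a <= x <= b -> c <= y <= d -> b - a < r -> d - c < r ->
    `|Phi a b c d| <= e * ((b - a) + (d - c)) ^+ 2.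

Let rect := ((R * R) * (R * R))%type.
Let PhiR (r : rect) := Phi r.1.1 r.1.2 r.2.1 r.2.2.
Let subR (r : rect) := subrect r.1.1 r.1.2 r.2.1 r.2.2.

(** If each quarter carried less than a quarter of the value of [r], additivity and the triangle
    inequality would conflict. The hypothesis on [r] stands inside the existential so that [choice]
    yields a total step function. *)
Lemma quarter_step (r : rect) : exists s : rect, subR r ->
  [/\ subR s, r.1.1 <= s.1.1, s.1.2 <= r.1.2, r.2.1 <= s.2.1 & s.2.2 <= r.2.2] /\
  [/\ s.1.2 - s.1.1 = (r.1.2 - r.1.1) / 2, s.2.2 - s.2.1 = (r.2.2 - r.2.1) / 2 &
    `|PhiR r| <= 4 * `|PhiR s|].
Proof.
case: r => [[a b] [c d]]; rewrite /subR /PhiR /=.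
case: (boolP (subrect a b c d)) => [sub|]; last by exists ((a, b), (c, d)).
have /and5P[h1 h2 h3 h4 /andP[h5 h6]] := sub.
have [m [am mb mE]] : exists m, [/\ a <= m, m <= b & m = (a + b) / 2].
  by exists ((a + b) / 2); split => //; lra.
have [n [cn nd nE]] : exists n, [/\ c <= n, n <= d & n = (c + d) / 2].
  by exists ((c + d) / 2); split => //; lra.
have amb : a <= m <= b by apply/andP.
have cnd : c <= n <= d by apply/andP.
have s1 : subrect a m c d by apply/and5P; split => //; lra.
have s2 : subrect m b c d by apply/and5P; split => //; lra.
have E : Phi a b c d = (Phi a m c n + Phi a m n d) + (Phi m b c n + Phi m b n d).
  by rewrite (splitx sub amb) (splity s1 cnd) (splity s2 cnd).
have [H|H1] := lerP `|Phi a b c d| (4 * `|Phi a m c n|).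
  exists ((a, m), (c, n)) => _ /=; split; last by split; [rewrite mE; lra|rewrite nE; lra|].
  by split; rewrite ?lexx // /subrect; apply/and5P; split; rewrite ?(le_trans am mb) //; try (apply/andP; split); lra.
have [H|H2] := lerP `|Phi a b c d| (4 * `|Phi a m n d|).
  exists ((a, m), (n, d)) => _ /=; split; last by split; [rewrite mE; lra|rewrite nE; lra|].
  by split; rewrite ?lexx // /subrect; apply/and5P; split; rewrite ?(le_trans am mb) //; try (apply/andP; split); lra.
have [H|H3] := lerP `|Phi a b c d| (4 * `|Phi m b c n|).
  exists ((m, b), (c, n)) => _ /=; split; last by split; [rewrite mE; lra|rewrite nE; lra|].
  by split; rewrite ?lexx // /subrect; apply/and5P; split; rewrite ?(le_trans am mb) //; try (apply/andP; split); lra.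
have [H|H4] := lerP `|Phi a b c d| (4 * `|Phi m b n d|).
  exists ((m, b), (n, d)) => _ /=; split; last by split; [rewrite mE; lra|rewrite nE; lra|].
  by split; rewrite ?lexx // /subrect; apply/and5P; split; rewrite ?(le_trans am mb) //; try (apply/andP; split); lra.
exfalso.
have : `|Phi a b c d| <= `|Phi a m c n| + `|Phi a m n d| + (`|Phi m b c n| + `|Phi m b n d|).
  rewrite E; apply: le_trans (ler_normD _ _) _.
  by apply: lerD; exact: ler_normD.
lra.
Qed.

(** A nonzero value is inherited by nested quarters with a loss of at most a factor 4 per step,
    whereas near the common point of these rectangles [local_small] bounds it by an arbitrarily
    small multiple of 4^-n. *)
Lemma bisection_eq0 : subrect a0 b0 c0 d0 -> Phi a0 b0 c0 d0 = 0.
Proof.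
move=> sub0; apply/eqP; apply: contraT => Phi_neq0.
have K0 : 0 < `|Phi a0 b0 c0 d0| by rewrite normr_gt0.
have [s sP] := choice quarter_step.
pose r n := iter n s ((a0, b0), (c0, d0)).
have rsub n : subR (r n) by elim: n => //= n /sP[[]].
have {}sP n := sP _ (rsub n).
have side1 n : (r n).1.2 - (r n).1.1 = (b0 - a0) / 2 ^+ n.
  elim: n => [|n IH]; first by rewrite expr0 divr1.
  by have [_ [-> _ _]] := sP n; rewrite IH exprS invfM; field.
have side2 n : (r n).2.2 - (r n).2.1 = (d0 - c0) / 2 ^+ n.
  elim: n => [|n IH]; first by rewrite expr0 divr1.
  by have [_ [_ -> _]] := sP n; rewrite IH exprS invfM; field.
have big n : `|Phi a0 b0 c0 d0| <= 4 ^+ n * `|PhiR (r n)|.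
  elim: n => [|n IH]; first by rewrite expr0 mul1r.
  apply: le_trans IH _; rewrite exprSr -mulrA; apply: ler_wpM2l; first exact: exprn_ge0.
  by have [_ []] := sP n.
have mono n k : [/\ (r n).1.1 <= (r (k + n)%N).1.1, (r (k + n)%N).1.2 <= (r n).1.2,
    (r n).2.1 <= (r (k + n)%N).2.1 & (r (k + n)%N).2.2 <= (r n).2.2].
  elim: k => [|k [h1 h2 h3 h4]]; first by split.
  have [[_ g1 g2 g3 g4] _] := sP (k + n)%N.
  by rewrite addSn; split;
    [exact: le_trans g1|exact: le_trans h2|exact: le_trans g3|exact: le_trans h4].
(* Every lower end is below every upper end, so the suprema of the lower ends give a point of all
   the rectangles. *)
have ab n k : (r n).1.1 <= (r k).1.2 /\ (r n).2.1 <= (r k).2.2.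
  have [h1 _ h3 _] := mono n k; have [_ g2 _ g4] := mono k n.
  have /and5P[_ e1 _ _ /andP[e2 _]] := rsub (k + n)%N.
  rewrite addnC in g2 g4.
  by split; [apply: le_trans h1 _|apply: le_trans h3 _];
    [apply: le_trans e1 _|apply: le_trans e2 _].
pose x := sup (range (fun n => (r n).1.1)).
pose y := sup (range (fun n => (r n).2.1)).
have xP n : (r n).1.1 <= x <= (r n).1.2.
  apply/andP; split.
    apply: sup_upper_bound; last by exists n.
    by split; [exists (r 0%N).1.1; exists 0%N|exists (r 0%N).1.2 => _ [k _ <-]; apply: (ab _ _).1].
  apply: ge_sup; first by exists (r 0%N).1.1; exists 0%N.
  by move=> _ [k _ <-]; apply: (ab _ _).1.
have yP n : (r n).2.1 <= y <= (r n).2.2.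
  apply/andP; split.
    apply: sup_upper_bound; last by exists n.
    by split; [exists (r 0%N).2.1; exists 0%N|exists (r 0%N).2.2 => _ [k _ <-]; apply: (ab _ _).2].
  apply: ge_sup; first by exists (r 0%N).2.1; exists 0%N.
  by move=> _ [k _ <-]; apply: (ab _ _).2.
pose L := (b0 - a0) + (d0 - c0).
have /and5P[_ ab0 _ _ /andP[cd0 _]] := sub0.
have L0 : 0 <= L by rewrite /L; lra.
(* With this tolerance the bound at depth n reads |Phi| <= |Phi| L^2 / (L^2 + 1), impossible for
   nonzero Phi; the 1 also covers L = 0. *)
have e0 : 0 < `|Phi a0 b0 c0 d0| / (L ^+ 2 + 1).
  by apply: divr_gt0 => //; apply: ltr_wpDl => //; exact: exprn_ge0.
have [rho rho0 rhoP] := local_small (xP 0%N) (yP 0%N) e0.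
have [n nP] : exists n, L / 2 ^+ n < rho.
  exists (Num.truncn (L / rho)).+1.
  rewrite ltr_pdivrMr ?exprn_gt0// mulrC -ltr_pdivrMr //.
  apply: (@lt_le_trans _ _ (Num.truncn (L / rho)).+1%:R); first exact: truncnS_gt.
  by rewrite -natrX ler_nat ltnW // ltn_expl.
have p2 : 0 < (2 : R) ^+ n by exact: exprn_gt0.
have := rhoP _ _ _ _ (rsub n) (xP n) (yP n).
rewrite side1 side2 -mulrDl -/L => /(_ _ _)/wrap[].
  by apply: le_lt_trans nP; apply: ler_wpM2r; [rewrite invr_ge0 ltW|rewrite /L; lra].
  by apply: le_lt_trans nP; apply: ler_wpM2r; [rewrite invr_ge0 ltW|rewrite /L; lra].
move=> H; have := big n; rewrite /PhiR; move: H; set X := `|Phi (r n).1.1 _ _ _|.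
set K := `|Phi a0 b0 c0 d0| in K0 *.
rewrite expr_div_n exprAC (_ : 2 ^+ 2 = 4 :> R); last by rewrite -natrX.
move=> H1 H2.
have : K <= K / (L ^+ 2 + 1) * L ^+ 2.
  apply: le_trans H2 _.
  apply: le_trans (ler_wpM2l _ H1) _; first exact: exprn_ge0.
  have q0 : (4 : R) ^+ n != 0 by rewrite lt0r_neq0 // exprn_gt0.
  by rewrite mulrCA [4 ^+ n * _]mulrC divfK.
rewrite mulrAC ler_pdivlMr; last by apply: ltr_wpDl => //; exact: exprn_ge0.
by rewrite ler_pM2l // gerDl ler10.
Qed.
End Bisection.

(** * Integrals over a segment *)

Section Segment.
Context {R : realType}.
Local Notation mu := (@lebesgue_measure R).
Implicit Types f g : R -> R.

Definition seg (a b : R) f : R := \int[mu]_(x in `[a, b]) f x.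
Definition segint (a b : R) f := mu.-integrable `[a, b] (EFin \o f).

Lemma segint_continuous a b f :
  (forall x, a <= x <= b -> {for x, continuous f}) -> segint a b f.
Proof.
move=> cf; apply: continuous_compact_integrable; first exact: segment_compact.
apply: continuous_in_subspaceT => x; rewrite inE /= in_itv /= => xab.
exact: cf.
Qed.

Lemma seg_split a m b f : a <= m <= b -> segint a b f ->
  seg a b f = seg a m f + seg m b f.
Proof.
move=> /andP[am mb] fi; apply/eqP; rewrite addrC -subr_eq; apply/eqP.
rewrite /seg Rintegral_itvB ?bnd_simp //.
by rewrite Rintegral_itv_obnd_cbnd //; apply: integrableS fi => //; apply: subset_itv; rewrite bnd_simp.
Qed.

Lemma seg_cst a b k : a <= b -> seg a b (fun=> k) = k * (b - a).
Proof.
move=> ab; rewrite /seg Rintegral_cst //= lebesgue_measure_itv /= lte_fin.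
by move: ab; rewrite le_eqVlt => /predU1P[->|->] //; rewrite ltxx subrr mulr0.
Qed.

Lemma segint_cst a b k : segint a b (fun=> k).
Proof. by apply: segint_continuous => x _; exact: cst_continuous. Qed.

Lemma seg_le a b f e : a <= b -> segint a b f ->
  (forall x, a <= x <= b -> `|f x| <= e) -> `|seg a b f| <= e * (b - a).
Proof.
move=> ab fi fe; apply: le_trans (le_normr_Rintegral _ fi) _ => //.
rewrite -seg_cst //; apply: le_Rintegral => //.
  exact: (integrable_abse fi).
exact: segint_cst.
Qed.

Lemma segB a b f g : segint a b f -> segint a b g ->
  seg a b (fun x => f x - g x) = seg a b f - seg a b g.
Proof. by move=> fi gi; exact: RintegralB. Qed.

(** Meant for opposite sides of a small rectangle, where the two integrands differ by nearly the
    constant [k]. *)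
Lemma seg_near a b f g k e : a <= b -> segint a b f -> segint a b g ->
  (forall x, a <= x <= b -> `|f x - g x - k| <= e) ->
  `|seg a b f - seg a b g - k * (b - a)| <= e * (b - a).
Proof.
move=> ab fi gi fge.
have fgi : segint a b (fun x => f x - g x) by exact: integrableB fi gi.
rewrite -(seg_cst k ab) -segB // -segB //; last exact: segint_cst.
by apply: seg_le => //; apply: integrableB fgi (segint_cst _ _ _).
Qed.

Lemma seg_id a f : seg a a f = 0.
Proof. by rewrite /seg set_itv1 Rintegral_set1. Qed.
End Segment.

Lemma norm_sub_itv (R : realType) (a b x y : R) :
  a <= x <= b -> a <= y <= b -> `|x - y| <= b - a.
Proof.
by move=> /andP[? ?] /andP[? ?]; rewrite ler_norml; apply/andP; split; lra.
Qed.

(** * Goursat's theorem for real differential forms on rectangles *)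

Section Goursat.
Context {R : realType}.
Variables P Q : R -> R -> R.

Definition cont_at2 (F : R -> R -> R) x0 y0 := forall e, 0 < e ->
  exists2 r, 0 < r & forall x y, `|x - x0| < r -> `|y - y0| < r ->
    `|F x y - F x0 y0| <= e.

Definition expansion_at2 (F : R -> R -> R) x0 y0 (p q : R) := forall e, 0 < e ->
  exists2 r, 0 < r & forall x y, `|x - x0| < r -> `|y - y0| < r ->
    `|F x y - F x0 y0 - (p * (x - x0) + q * (y - y0))|
      <= e * (`|x - x0| + `|y - y0|).

(* [P dx + Q dy] is differentiable at the point and closed there *)
Definition closed_at x0 y0 := exists p q s : R,
  expansion_at2 P x0 y0 p q /\ expansion_at2 Q x0 y0 q s.

Lemma cont_at2_fix1 F x0 y0 : cont_at2 F x0 y0 -> {for y0, continuous (F x0)}.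
Proof.
move=> c; apply/cvgrPdist_le => /= e /c[r r0 H].
apply/nbhs_ballP; exists r => //= y; rewrite /ball /= => yr.
by rewrite distrC; apply: H; rewrite ?subrr ?normr0 // distrC.
Qed.

Lemma cont_at2_fix2 F x0 y0 : cont_at2 F x0 y0 -> {for x0, continuous (F^~ y0)}.
Proof.
move=> c; apply/cvgrPdist_le => /= e /c[r r0 H].
apply/nbhs_ballP; exists r => //= y; rewrite /ball /= => yr.
by rewrite distrC; apply: H; rewrite ?subrr ?normr0 // distrC.
Qed.

(** The circulation of P dx + Q dy around [a, b] x [c, d], counterclockwise from the bottom side. *)
Definition circ a b c d :=
  seg a b (P ^~ c) + seg c d (Q b) - seg a b (P ^~ d) - seg c d (Q a).

Section rectangle.
Variables a0 b0 c0 d0 : R.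
Hypothesis cP : forall x y, a0 <= x <= b0 -> c0 <= y <= d0 -> cont_at2 P x y.
Hypothesis cQ : forall x y, a0 <= x <= b0 -> c0 <= y <= d0 -> cont_at2 Q x y.

Lemma subrectP a b c d : subrect a0 b0 c0 d0 a b c d ->
  [/\ a0 <= a, a <= b & b <= b0] /\ [/\ c0 <= c, c <= d & d <= d0].
Proof. by move=> /and5P[? ? ? ? /andP[]]. Qed.

Lemma segP a b y : a0 <= a -> b <= b0 -> c0 <= y <= d0 -> segint a b (P ^~ y).
Proof.
move=> a0a bb0 yi; apply: segint_continuous => x /andP[ax xb].
by apply: cont_at2_fix2; apply: cP => //; rewrite (le_trans a0a ax) (le_trans xb).
Qed.

Lemma segQ c d x : c0 <= c -> d <= d0 -> a0 <= x <= b0 -> segint c d (Q x).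
Proof.
move=> a0a bb0 yi; apply: segint_continuous => y /andP[ax xb].
by apply: cont_at2_fix1; apply: cQ => //; rewrite (le_trans a0a ax) (le_trans xb).
Qed.

Lemma circ_splitx a m b c d : subrect a0 b0 c0 d0 a b c d -> a <= m <= b ->
  circ a b c d = circ a m c d + circ m b c d.
Proof.
move=> /subrectP[[a0a ab bb0] [c0c cd dd0]] amb.
rewrite /circ (seg_split amb) ?(@seg_split _ a m b (P ^~ d)) //; first ring.
  by apply: segP => //; rewrite dd0 (le_trans c0c cd).
by apply: segP => //; rewrite c0c (le_trans cd dd0).
Qed.

Lemma circ_splity a b c m d : subrect a0 b0 c0 d0 a b c d -> c <= m <= d ->
  circ a b c d = circ a b c m + circ a b m d.
Proof.
move=> /subrectP[[a0a ab bb0] [c0c cd dd0]] amb.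
rewrite /circ (@seg_split _ c m d (Q b)) ?(@seg_split _ c m d (Q a)) //; first ring.
  by apply: segQ => //; rewrite a0a (le_trans ab bb0).
by apply: segQ => //; rewrite bb0 (le_trans a0a ab).
Qed.

(** The linear parts of P and Q contribute - q (d - c) (b - a) and q (b - a) (d - c), with the same
    q because the form is closed at the point. They cancel, and only errors of second order in the
    sides remain. *)
Lemma circ_local x y e : a0 <= x <= b0 -> c0 <= y <= d0 -> closed_at x y ->
  0 < e -> exists2 r, 0 < r & forall a b c d, subrect a0 b0 c0 d0 a b c d ->
    a <= x <= b -> c <= y <= d -> b - a < r -> d - c < r ->
    `|circ a b c d| <= e * ((b - a) + (d - c)) ^+ 2.
Proof.
move=> xi yi [p [q [s [eP eQ]]]] e0.
have e2 : 0 < e / 2 by rewrite divr_gt0.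
have [r1 r10 {}eP] := eP _ e2; have [r2 r20 {}eQ] := eQ _ e2.
exists (Num.min r1 r2) => [|a b c d sub /andP[ax xb] /andP[cy yd]].
  by rewrite lt_min r10.
rewrite !lt_min => /andP[ab1 ab2] /andP[cd1 cd2].
have [[a0a ab bb0] [c0c cd dd0]] := subrectP sub.
pose L := (b - a) + (d - c).
have near1 t : a <= t <= b -> `|t - x| <= b - a.
  by move=> ti; apply: norm_sub_itv => //; apply/andP.
have near2 t : c <= t <= d -> `|t - y| <= d - c.
  by move=> ti; apply: norm_sub_itv => //; apply/andP.
have ac : c <= c <= d by rewrite lexx.
have ad : c <= d <= d by rewrite lexx andbT.
have aa : a <= a <= b by rewrite lexx.
have bb : a <= b <= b by rewrite lexx andbT.
(* Bottom minus top; [H2] treats right minus left in the same way. The tolerance e / 2 is spent once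
   on each of the two sides. *)
have H1 : `|seg a b (P ^~ c) - seg a b (P ^~ d) - (- q * (d - c)) * (b - a)| <= e * L * (b - a).
  apply: seg_near => //.
  - by apply: segP => //; rewrite c0c (le_trans cd dd0).
  - by apply: segP => //; rewrite dd0 (le_trans c0c cd).
  move=> t ti.
  have n1 := near1 _ ti; have n2 := near2 _ ac; have n3 := near2 _ ad.
  have h1 := eP t c (le_lt_trans n1 ab1) (le_lt_trans n2 cd1).
  have h2 := eP t d (le_lt_trans n1 ab1) (le_lt_trans n3 cd1).
  have g1 : e / 2 * (`|t - x| + `|c - y|) <= e / 2 * L by rewrite ler_pM2l // lerD.
  have g2 : e / 2 * (`|t - x| + `|d - y|) <= e / 2 * L by rewrite ler_pM2l // lerD.
  have := ler_normB (P t c - P x y - (p * (t - x) + q * (c - y)))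
     (P t d - P x y - (p * (t - x) + q * (d - y))).
  rewrite [X in `|X| <= _ -> _](_ : _ = P t c - P t d - - q * (d - c)); last ring.
  move/le_trans; apply; rewrite [e]splitr (mulrDl _ _ L).
  by apply: lerD; [exact: le_trans h1 g1|exact: le_trans h2 g2].
have H2 : `|seg c d (Q b) - seg c d (Q a) - (q * (b - a)) * (d - c)| <= e * L * (d - c).
  apply: seg_near => //.
  - by apply: segQ => //; rewrite bb0 (le_trans a0a ab).
  - by apply: segQ => //; rewrite a0a (le_trans ab bb0).
  move=> t ti.
  have n1 := near2 _ ti; have n2 := near1 _ aa; have n3 := near1 _ bb.
  have h1 := eQ b t (le_lt_trans n3 ab2) (le_lt_trans n1 cd2).
  have h2 := eQ a t (le_lt_trans n2 ab2) (le_lt_trans n1 cd2).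
  have g1 : e / 2 * (`|b - x| + `|t - y|) <= e / 2 * L by rewrite ler_pM2l // lerD.
  have g2 : e / 2 * (`|a - x| + `|t - y|) <= e / 2 * L by rewrite ler_pM2l // lerD.
  have := ler_normB (Q b t - Q x y - (q * (b - x) + s * (t - y)))
     (Q a t - Q x y - (q * (a - x) + s * (t - y))).
  rewrite [X in `|X| <= _ -> _](_ : _ = Q b t - Q a t - q * (b - a)); last ring.
  move/le_trans; apply; rewrite [e]splitr (mulrDl _ _ L).
  by apply: lerD; [exact: le_trans h1 g1|exact: le_trans h2 g2].
have E : circ a b c d = (seg a b (P ^~ c) - seg a b (P ^~ d) - (- q * (d - c)) * (b - a))
   + (seg c d (Q b) - seg c d (Q a) - (q * (b - a)) * (d - c)) by rewrite /circ; ring.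
rewrite E; apply: le_trans (ler_normD _ _) _; apply: le_trans (lerD H1 H2) _.
by rewrite -mulrDr expr2 mulrA lexx.
Qed.

(** Continuity is known on the ambient rectangle but closedness only on the smaller one, so that
    [goursat_point] can apply this to strips that avoid a point. *)
Lemma goursat a b c d : subrect a0 b0 c0 d0 a b c d ->
  (forall x y, a <= x <= b -> c <= y <= d -> closed_at x y) -> circ a b c d = 0.
Proof.
move=> sub cl.
have [[a0a ab bb0] [c0c cd dd0]] := subrectP sub.
have subs a' b' c' d' : subrect a b c d a' b' c' d' -> subrect a0 b0 c0 d0 a' b' c' d'.
  move=> /and5P[h1 h2 h3 h4 /andP[h5 h6]].
  by rewrite /subrect (le_trans a0a) // h2 (le_trans h3) // (le_trans c0c) // h5 (le_trans h6).
apply: (@bisection_eq0 _ a b c d).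
- by move=> a' m b' c' d' /subs; exact: circ_splitx.
- by move=> a' b' c' m d' /subs; exact: circ_splity.
- move=> x y e xi yi e0.
  have xi0 : a0 <= x <= b0 by case/andP: xi => h1 h2; rewrite (le_trans a0a) // (le_trans h2).
  have yi0 : c0 <= y <= d0 by case/andP: yi => h1 h2; rewrite (le_trans c0c) // (le_trans h2).
  have [r r0 H] := circ_local xi0 yi0 (cl _ _ xi yi) e0.
  by exists r => // a' b' c' d' /subs; exact: H.
- by rewrite /subrect !lexx ab cd.
Qed.

(** Strips that avoid the exceptional point contribute nothing; what remains is a rectangle with
    sides at most 2 r on which P and Q are bounded, and its circulation is of order r. *)
Lemma goursat_point x0 y0 : a0 <= x0 <= b0 -> c0 <= y0 <= d0 ->
  (forall x y, a0 <= x <= b0 -> c0 <= y <= d0 -> (x, y) != (x0, y0) -> closed_at x y) ->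
  circ a0 b0 c0 d0 = 0.
Proof.
move=> xi yi cl.
have [/andP[ax xb] /andP[cy yd]] := (xi, yi).
have ab0 : a0 <= b0 by exact: le_trans xb.
have cd0 : c0 <= d0 by exact: le_trans yd.
(* Clamping by [max] and [min] allows the point to be on or near the boundary: a strip that is
   clamped away is degenerate and has circulation 0. *)
have shrink r : 0 < r -> circ a0 b0 c0 d0 =
    circ (Num.max a0 (x0 - r)) (Num.min b0 (x0 + r)) (Num.max c0 (y0 - r)) (Num.min d0 (y0 + r)).
  move=> r0.
  set a := Num.max _ _; set b := Num.min _ _; set c := Num.max _ _; set d := Num.min _ _.
  have a0a : a0 <= a by rewrite le_max lexx.
  have ax0 : a <= x0 by rewrite ge_max ax; lra.
  have x0b : x0 <= b by rewrite le_min xb; lra.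
  have bb0 : b <= b0 by rewrite ge_min lexx.
  have c0c : c0 <= c by rewrite le_max lexx.
  have cy0 : c <= y0 by rewrite ge_max cy; lra.
  have y0d : y0 <= d by rewrite le_min yd; lra.
  have dd0 : d <= d0 by rewrite ge_min lexx.
  have ab := le_trans ax0 x0b; have cd := le_trans cy0 y0d.
  have subx a1 b1 c1 d1 : a0 <= a1 -> a1 <= b1 -> b1 <= b0 -> c0 <= c1 -> c1 <= d1 -> d1 <= d0 ->
    subrect a0 b0 c0 d0 a1 b1 c1 d1 by move=> *; apply/and5P; split=> //; apply/andP.
  rewrite (@circ_splitx a0 a) ?subx ?a0a //=; last exact: le_trans bb0.
  rewrite (_ : circ a0 a c0 d0 = 0) ?add0r; last first.
    rewrite {a0a ax0 ab}/a; case: (lerP a0 (x0 - r)) => h; last first.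
      by rewrite /circ !seg_id; ring.
    apply: goursat => [|x y /andP[x1 x2] yy]; first by apply: subx => //; lra.
    apply: cl => //; first by rewrite x1; lra.
    by apply: contraTneq x2 => -[-> _]; rewrite -ltNge; lra.
  rewrite (@circ_splitx a b) ?subx ?ab //=; last exact: le_trans bb0.
  rewrite (_ : circ b b0 c0 d0 = 0) ?addr0; last first.
    rewrite {bb0 x0b ab}/b; case: (lerP b0 (x0 + r)) => h.
      by rewrite /circ !seg_id; ring.
    apply: goursat => [|x y /andP[x1 x2] yy]; first by apply: subx => //; lra.
    apply: cl => //; first by rewrite x2; lra.
    by apply: contraTneq x1 => -[-> _]; rewrite -ltNge; lra.
  rewrite (@circ_splity a b c0 c) ?subx ?c0c //=; last exact: le_trans dd0.
  rewrite (_ : circ a b c0 c = 0) ?add0r; last first.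
    rewrite {c0c cy0 cd}/c; case: (lerP c0 (y0 - r)) => h; last first.
      by rewrite /circ !seg_id; ring.
    apply: goursat => [|x y /andP[x1 x2] /andP[y1 y2]]; first by apply: subx => //; lra.
    apply: cl; [by rewrite (le_trans a0a) // (le_trans x2)| by rewrite y1; lra|].
    by apply: contraTneq y2 => -[_ ->]; rewrite -ltNge; lra.
  rewrite (@circ_splity a b c d) ?subx ?cd //=; last exact: le_trans dd0.
  rewrite (_ : circ a b d d0 = 0) ?addr0 //.
  rewrite {dd0 y0d cd}/d; case: (lerP d0 (y0 + r)) => h.
    by rewrite /circ !seg_id; ring.
  apply: goursat => [|x y /andP[x1 x2] /andP[y1 y2]]; first by apply: subx => //; lra.
  apply: cl; [by rewrite (le_trans a0a) // (le_trans x2)| by rewrite y2; lra|].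
  by apply: contraTneq y1 => -[_ ->]; rewrite -ltNge; lra.
have [rp rp0 Pb] := cP xi yi ltr01; have [rq rq0 Qb] := cQ xi yi ltr01.
pose M := 1 + `|P x0 y0| + `|Q x0 y0|.
have M0 : 0 < M by rewrite /M; have := normr_ge0 (P x0 y0); have := normr_ge0 (Q x0 y0); lra.
apply/eqP; rewrite -normr_le0; apply/ler_addgt0Pr => e e0; rewrite add0r.
(* Four sides of length at most 2 r with integrands at most M give 8 M r <= e. *)
pose r := Num.min (Num.min (rp / 2) (rq / 2)) (e / (8 * M)).
have r0 : 0 < r by rewrite !lt_min !divr_gt0 // mulr_gt0.
have rrp : r < rp by apply: (@le_lt_trans _ _ (rp / 2)); [rewrite /r !ge_min lexx|lra].
have rrq : r < rq by apply: (@le_lt_trans _ _ (rq / 2)); [rewrite /r !ge_min lexx orbT|lra].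
have re : M * (8 * r) <= e.
  have : r <= e / (8 * M) by rewrite /r !ge_min lexx !orbT.
  by rewrite ler_pdivlMr ?mulr_gt0 // => h; rewrite (_ : M * (8 * r) = r * (8 * M)) //; ring.
rewrite (shrink r r0).
set a := Num.max _ _; set b := Num.min _ _; set c := Num.max _ _; set d := Num.min _ _.
have [a0a ax0] : a0 <= a /\ a <= x0 by rewrite /a le_max lexx ge_max ax; split => //; lra.
have [bb0 x0b] : b <= b0 /\ x0 <= b by rewrite /b ge_min lexx le_min xb; split => //; lra.
have [c0c cy0] : c0 <= c /\ c <= y0 by rewrite /c le_max lexx ge_max cy; split => //; lra.
have [dd0 y0d] : d <= d0 /\ y0 <= d by rewrite /d ge_min lexx le_min yd; split => //; lra.
have ar : x0 - r <= a by rewrite le_max lexx orbT.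
have br : b <= x0 + r by rewrite ge_min lexx orbT.
have cr : y0 - r <= c by rewrite le_max lexx orbT.
have dr : d <= y0 + r by rewrite ge_min lexx orbT.
have nx x : a <= x <= b -> `|x - x0| <= r.
  by move=> /andP[? ?]; rewrite ler_norml; apply/andP; split; lra.
have ny y : c <= y <= d -> `|y - y0| <= r.
  by move=> /andP[? ?]; rewrite ler_norml; apply/andP; split; lra.
have PM x y : a <= x <= b -> c <= y <= d -> `|P x y| <= M.
  move=> /nx x1 /ny y1; have := Pb _ _ (le_lt_trans x1 rrp) (le_lt_trans y1 rrp).
  have := ler_normD (P x y - P x0 y0) (P x0 y0); rewrite subrK /M.
  by have := normr_ge0 (Q x0 y0); lra.
have QM x y : a <= x <= b -> c <= y <= d -> `|Q x y| <= M.
  move=> /nx x1 /ny y1; have := Qb _ _ (le_lt_trans x1 rrq) (le_lt_trans y1 rrq).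
  have := ler_normD (Q x y - Q x0 y0) (Q x0 y0); rewrite subrK /M.
  by have := normr_ge0 (P x0 y0); lra.
have ab := le_trans ax0 x0b; have cd := le_trans cy0 y0d.
have sP y : c <= y <= d -> `|seg a b (P ^~ y)| <= M * (2 * r).
  move=> yy; have : `|seg a b (P ^~ y)| <= M * (b - a).
    apply: seg_le => // [|x xx]; last exact: PM.
    by case/andP: yy => y1 y2; apply: segP => //; rewrite (le_trans c0c) // (le_trans y2).
  by move/le_trans; apply; rewrite ler_pM2l //; lra.
have sQ x : a <= x <= b -> `|seg c d (Q x)| <= M * (2 * r).
  move=> xx; have : `|seg c d (Q x)| <= M * (d - c).
    apply: seg_le => // [|y yy]; last exact: QM.
    by case/andP: xx => y1 y2; apply: segQ => //; rewrite (le_trans a0a) // (le_trans y2).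
  by move/le_trans; apply; rewrite ler_pM2l //; lra.
have h1 := sP c; have h2 := sP d; have h3 := sQ a; have h4 := sQ b.
rewrite !lexx ab cd in h1 h2 h3 h4.
have {}h1 := h1 isT; have {}h2 := h2 isT; have {}h3 := h3 isT; have {}h4 := h4 isT.
apply: le_trans re; rewrite /circ.
apply: le_trans (ler_normB _ _) _.
have := ler_normB (seg a b (P^~ c) + seg c d (Q b)) (seg a b (P^~ d)).
have := ler_normD (seg a b (P^~ c)) (seg c d (Q b)).
lra.
Qed.
End rectangle.
End Goursat.

(** * Measurability in the plane and substitutions on the line *)

Section PlaneMeasure.
Context {R : realType}.
Local Notation mu := (@lebesgue_measure R).

(** An open set is the countable union of the rational squares that it contains, and each square is
    a product of intervals. *)
Lemma plane_open_measurable (U : set (R * R)) :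
  (forall p, U p -> exists2 r, 0 < r & forall q,
     `|q.1 - p.1| < r -> `|q.2 - p.2| < r -> U q) -> measurable U.
Proof.
move=> oU.
pose box (i : rat * rat * rat) : set (R * R) :=
  [set p | `|p.1 - ratr i.1.1| < ratr i.2] `&` [set p | `|p.2 - ratr i.1.2| < ratr i.2].
pose F i := if `[< box i `<=` U >] then box i else set0.
have -> : U = \bigcup_i F i.
  apply/seteqP; split=> p; last first.
    by case=> i _; rewrite /F; case: asboolP => // h /h.
  move=> /oU[r r0 H].
  have [q /[!in_itv]/= /andP[q0 qr]] := rat_in_itvoo (divr_gt0 r0 (ltr0Sn R 1)).
  have [s1 /[!in_itv]/= /andP[s1l s1r]] := @rat_in_itvoo R (p.1 - ratr q) (p.1 + ratr q) ltac:(lra).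
  have [s2 /[!in_itv]/= /andP[s2l s2r]] := @rat_in_itvoo R (p.2 - ratr q) (p.2 + ratr q) ltac:(lra).
  exists (s1, s2, q) => //; rewrite /F asboolT.
    by split => /=; rewrite ltr_norml; apply/andP; split; lra.
  move=> z [/=]; rewrite !ltr_norml => /andP[z1 z2] /andP[z3 z4].
  by apply: H; rewrite ltr_norml; apply/andP; split; lra.
apply: countable_bigcupT_measurable; first exact: countableP.
move=> i; rewrite /F; case: asboolP => // _.
have ball_m (c e : R) : measurable [set x : R | `|x - c| < e].
  have -> : [set x : R | `|x - c| < e] = `]c - e, c + e[.
    apply/seteqP; split=> x /=; rewrite in_itv /= ltr_norml.
      by move=> /andP[? ?]; apply/andP; split; lra.
    by move=> /andP[? ?]; apply/andP; split; lra.
  exact: measurable_itv.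
apply: measurableI.
  by rewrite -[X in measurable X]setTI; exact: (@measurable_fst _ _ R R measurableT _ (ball_m _ _)).
by rewrite -[X in measurable X]setTI; exact: (@measurable_snd _ _ R R measurableT _ (ball_m _ _)).
Qed.

(** The shape of functions built from [extend]: continuous inside the half-plane, 0 outside,
    possibly jumping at the boundary. A superlevel set is an open set, joined with the complement of
    the half-plane when the level is negative. *)
Lemma half_cont_measurable (F : R -> R -> R) :
  (forall x y, x <= 0 -> F x y = 0) ->
  (forall x y, 0 < x -> cont_at2 F x y) ->
  measurable_fun setT (fun p : R * R => F p.1 p.2).
Proof.
move=> F0 cF mD; apply: (measurability _ (measurable_realfun.RGenOInfty.measurableE R)) => //.
move=> _ [_ [a ->] <-]; rewrite setTI.
have -> : (fun p : R * R => F p.1 p.2) @^-1` `]a, +oo[ =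
    [set p | 0 < p.1 /\ a < F p.1 p.2] `|` (if a < 0 then ~` [set p | 0 < p.1] else set0).
  apply/seteqP; split=> -[x y] /=; rewrite in_itv /= andbT.
    have [x0|x0] := ltrP 0 x; first by left.
    by rewrite F0 // => ->; right => /=; rewrite ltNge x0.
  case=> [[]//|]; case: ifPn => // a0 /= /negP; rewrite -leNgt => x0.
  by rewrite F0.
have mH : measurable [set p : R * R | 0 < p.1].
  apply: plane_open_measurable => p /= p0; exists p.1 => // q.
  by rewrite ltr_norml => /andP[h _] _; lra.
apply: measurableU; last by case: ifP => _ //; exact: measurableC.
apply: plane_open_measurable => -[x y] /= [x0 aF].
have e0 : 0 < (F x y - a) / 2 by rewrite divr_gt0 // subr_gt0.
have [r r0 H] := cF x y x0 _ e0.
exists (Num.min r x) => [|[x' y'] /=]; first by rewrite lt_min r0.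
rewrite !lt_min => /andP[h1 h2] /andP[h3 _]; split.
  by move: h2; rewrite ltr_norml => /andP[h _]; lra.
by have := H _ _ h1 h3; rewrite ler_norml => /andP[h _]; lra.
Qed.

(** Otherwise the integral over [N, +oo[ alone would be infinite. This supplies the heights and
    abscissas at which boundary terms are small. *)
Lemma ge0_small_value (f : R -> \bar R) (N e : R) : measurable_fun [set: R] f ->
  (forall y, 0 <= f y)%E -> (\int[mu]_y f y < +oo)%E -> 0 < e ->
  exists2 y, N <= y & (f y < e%:E)%E.
Proof.
move=> mf f0 fi e0; apply: contrapT => /forall2NP H.
have {}H y : N <= y -> (e%:E <= f y)%E.
  by move=> Ny; case: (H y) => // /negP; rewrite -leNgt.
have : (\int[mu]_(y in `[N, +oo[) cst e%:E y <= \int[mu]_y f y)%E.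
  apply: (@le_trans _ _ (\int[mu]_(y in `[N, +oo[) f y)%E).
    apply: ge0_le_integral => //; first by move=> ? _; rewrite lee_fin ltW.
      exact: measurable_funTS.
    by move=> y /=; rewrite in_itv /= andbT; exact: H.
  exact: ge0_subset_integral.
rewrite integral_cst //= lebesgue_measure_itv /= ltry gt0_muley ?lte_fin //.
by rewrite leye_eq => /eqP ioo; move: fi; rewrite ioo ltxx.
Qed.

(** The pushforward of Lebesgue measure under x |-> c x + d, scaled by |c|, agrees with Lebesgue
    measure on intervals, hence is Lebesgue measure. *)
Lemma ge0_integral_affine (c d : R) (f : R -> \bar R) : c != 0 ->
  measurable_fun [set: R] f -> (forall x, 0 <= f x)%E ->
  (\int[mu]_x f x = `|c|%:E * \int[mu]_x f (c * x + d)%R)%E.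
Proof.
move=> c0 mf f0.
have nc0 : 0 < `|c| by rewrite normr_gt0.
pose phi : R -> measurableTypeR R := fun x => c * x + d.
have mphi : measurable_fun setT phi.
  by apply: measurable_funD => //; exact: measurable_funM.
pose nu0 : {measure set (measurableTypeR R) -> \bar R} :=
  mscale (NngNum (ltW nc0)) (pushforward mu phi).
pose nu := nu0 mphi.
have nuE A : measurable A -> mu A = nu A.
  apply: lebesgue_measure_unique => _ [[a b] _ <-] /=.
  rewrite /nu /nu0 /mscale /= /pushforward.
  have [cp|cn] := ltrP 0 c.
    have -> : phi @^-1` `]a, b] = `](a - d) / c, (b - d) / c].
      apply/seteqP; split => x; rewrite /= /phi !in_itv /= ltr_pdivrMr // ler_pdivlMr // [x * c]mulrC => /andP[? ?]; apply/andP; split; lra.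
    rewrite !lebesgue_measure_itv /= !lte_fin ltr_pM2r ?invr_gt0 // ltrD2r.
    case: ifPn => ab; rewrite ?mule0 // -!EFinD -EFinM; congr EFin.
    by rewrite (gtr0_norm cp) mulrC -mulrBl divfK //; ring.
  have {}cn : c < 0 by rewrite lt_neqAle c0.
  have -> : phi @^-1` `]a, b] = `[(b - d) / c, (a - d) / c[.
    apply/seteqP; split => x; rewrite /= /phi !in_itv /= ltr_ndivlMr // ler_ndivrMr // [x * c]mulrC => /andP[? ?]; apply/andP; split; lra.
  rewrite !lebesgue_measure_itv /= !lte_fin ltr_nM2r ?invr_lt0 // ltrD2r.
  case: ifPn => ab; rewrite ?mule0 // -!EFinD -EFinM; congr EFin.
  by rewrite (ltr0_norm cn) mulNr mulrC -mulrBl divfK //; ring.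
transitivity (\int[nu]_x f x)%E; first by apply: eq_measure_integral => A mA _; exact: nuE.
rewrite ge0_integral_mscale //=; congr (_ * _)%E.
by rewrite ge0_integral_pushforward // preimage_setT.
Qed.

(** Exhaust the half-line by the segments [F n], which x |-> 1 / x maps onto themselves, substitute
    on each and pass to the limit by monotone convergence. *)
Lemma ge0_integral_invr (G : R -> R) : (forall x : R, 0 < x -> {for x, continuous G}) ->
  (forall x, 0 <= G x) ->
  (\int[mu]_(x in `]0%R, +oo[) (G x)%:E = \int[mu]_(x in `]0%R, +oo[) (G x^-1 * x ^- 2)%:E)%E.
Proof.
move=> cG G0.
pose F n : set R := `[n.+1%:R^-1, n.+1%:R].
have n0 n : 0 < (n.+1%:R : R) by rewrite ltr0n.
have UF : \bigcup_n F n = `]0, +oo[.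
  apply/seteqP; split=> x.
    by case=> n _; rewrite /F /= !in_itv /= andbT => /andP[h _]; apply: lt_le_trans h; rewrite invr_gt0.
  rewrite /= in_itv /= andbT => x0.
  exists (maxn (Num.truncn x) (Num.truncn x^-1)) => //; rewrite /F /= in_itv /=.
  apply/andP; split.
    rewrite -[leRHS]invrK lef_pV2 ?posrE ?invr_gt0 //.
    apply: le_trans (ltW (truncnS_gt _)) _.
    by rewrite ler_nat ltnS; exact: leq_maxr.
  apply: le_trans (ltW (truncnS_gt _)) _.
  by rewrite ler_nat ltnS; exact: leq_maxl.
have ndF : nondecreasing_seq F.
  move=> m n mn; rewrite subsetEset; apply: subset_itv; rewrite bnd_simp.
    by rewrite lef_pV2 ?posrE // ler_nat ltnS.
  by rewrite ler_nat ltnS.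
have FP n x : F n x -> 0 < x.
  by rewrite /F /= in_itv /= => /andP[h _]; apply: lt_le_trans h; rewrite invr_gt0.
have cinv (x : R) : 0 < x -> {for x, continuous (fun x : R => x^-1)}.
  by move=> x0; apply: inv_continuous; rewrite lt0r_neq0.
have cGi (x : R) : 0 < x -> {for x, continuous (fun x : R => G x^-1 * x ^- 2)}.
  move=> x0; apply: continuousM.
    by apply: continuous_comp; [exact: cinv|apply: cG; rewrite invr_gt0].
  apply: continuousV; first by rewrite lt0r_neq0 // exprn_gt0.
  exact: exprn_continuous.
have mF n : measurable (F n) by exact: measurable_itv.
have meas (f : R -> R) n : (forall x : R, 0 < x -> {for x, continuous f}) -> measurable_fun (F n) (EFin \o f).
  move=> cf; apply/measurable_EFinP; apply: subspace_continuous_measurable_fun => //.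
  by apply: continuous_in_subspaceT => x; rewrite inE => /FP; exact: cf.
have c1 := ge0_nondecreasing_set_cvg_integral (mu := mu) ndF mF
  (fun n => meas G n cG) (fun _ x _ => G0 x).
have Gi0 n x : F n x -> (0 <= (EFin \o (fun x : R => G x^-1 * x ^- 2)%R) x)%E.
  by move=> /FP x0; rewrite lee_fin mulr_ge0 // invr_ge0 exprn_ge0 // ltW.
have c2 := ge0_nondecreasing_set_cvg_integral (mu := mu) ndF mF
  (fun n => meas _ n cGi) Gi0.
rewrite -UF.
apply: (cvg_unique (@ereal_hausdorff R) c1).
apply: (cvg_trans _ c2); apply: near_eq_cvg; near=> n.
have inv1 : (n.+1%:R^-1 : R) <= 1 by rewrite invf_le1 // ler1n.
have der (x : R) : 0 < x -> (GRing.inv : R -> R)^`() x = - x ^- 2.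
  move=> x0; rewrite derive1E (@deriveV _ _ id) ?lt0r_neq0 //.
  by rewrite derive_id /GRing.scale /= mulr1.
have derc (x : R) : 0 < x -> (GRing.inv : R -> R)^`() y @[y --> x] --> - x ^- 2.
  move=> x0; apply: (@cvg_trans _ ((fun y : R => - y ^- 2) @ x)).
    apply: near_eq_cvg; near=> y; rewrite der //; near: y; exact: lt_nbhsr.
  have : {for x, continuous (fun y : R => - y ^- 2)}.
    apply: (@continuousN R R^o); apply: continuousV; first by rewrite lt0r_neq0 // exprn_gt0.
    exact: exprn_continuous.
  by [].
have a0 : 0 < (n.+1%:R^-1 : R) by rewrite invr_gt0.
have n1 : 1 <= (n.+1%:R : R) by rewrite ler1n.
have := @integration_by_substitution_decreasing R GRing.inv G n.+1%:R^-1 n.+1%:R.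
rewrite invrK => ->.
- apply: eq_integral => x; rewrite inE => /FP x0 /=.
  have E (D : R -> R) : ((G \o GRing.inv) * (- D)) x = G x^-1 * - D x by [].
  by rewrite E der // opprK.
- exact: le_trans n1.
- move=> x y /[!in_itv]/= /andP[x1 _] /andP[y1 _] xy.
  by rewrite ltf_pV2 // posrE; [exact: lt_le_trans x1|exact: lt_le_trans y1].
- move=> x /[!in_itv]/= /andP[x1 _]; have x0 := lt_trans a0 x1.
  by rewrite /continuous_at der //; exact: derc.
- by apply/cvg_ex; exists (- n.+1%:R^-1 ^- 2); apply: cvg_at_right_filter; exact: derc.
- by apply/cvg_ex; exists (- n.+1%:R ^- 2); apply: cvg_at_left_filter; exact: derc.
- split.
  + move=> x /[!in_itv]/= /andP[x1 _]; have x0 := lt_trans a0 x1.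
    by apply: (@derivableV _ _ id) => //; rewrite lt0r_neq0.
  + by apply: cvg_at_right_filter; exact: cinv.
  + by apply: cvg_at_left_filter; exact: cinv.
- by apply: continuous_in_subspaceT => x; rewrite inE => /FP; exact: cG.
Unshelve. all: by end_near. Qed.
End PlaneMeasure.

(** * Tails, strips and Fubini for real-valued integrals *)

Section RealIntegrals.
Context {R : realType}.
Local Notation mu := (@lebesgue_measure R).

(** The error is at most the integral of |f| off A, hence at most the part of the integral of |f|
    missed by [F n], which monotone convergence makes small. *)
Lemma Rintegral_exhaust d (T : measurableType d) (m : {measure set T -> \bar R})
    (F : (set T)^nat) (f : T -> R) (e : R) :
  nondecreasing_seq F -> (forall n, measurable (F n)) -> \bigcup_n F n = setT ->
  m.-integrable setT (EFin \o f) -> 0 < e ->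
  exists n, forall A, measurable A -> F n `<=` A ->
    `|\int[m]_x f x - \int[m]_(x in A) f x| <= e.
Proof.
move=> ndF mF UF fi e0.
have mf : measurable_fun setT (EFin \o f) by exact: (measurable_int _ fi).
pose af (x : T) : R := `|f x|.
have af0 x : (0 <= (af x)%:E)%E by rewrite lee_fin normr_ge0.
have ai : m.-integrable setT (EFin \o af) by exact: (integrable_abse fi).
have mai : measurable_fun setT (EFin \o af) by exact: (measurable_int _ ai).
have c := @ge0_nondecreasing_set_cvg_integral _ _ _ F (EFin \o af) m ndF mF
  (fun n => measurable_funTS mai) (fun _ x _ => af0 x).
rewrite UF in c.
pose I := (\int[m]_x (EFin \o af) x)%E.
have Ifin : I \is a fin_num by exact: integrable_fin_num.
have Ie : (I - e%:E < I)%E by rewrite lteBlDr // lteDl // lte_fin.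
have nI : nbhs I [set y | (I - e%:E < y)%E].
  by apply: open_nbhs_nbhs; split => //; exact: open_ereal_gt_ereal.
have [n _ nP] := c _ nI.
exists n => A mA FA.
have In : (I - e%:E < \int[m]_(x in F n) (EFin \o af) x)%E by exact: (nP n (leqnn n)).
have CA : [disjoint A & ~` A] by apply/disj_setPS => x [].
have mCA : measurable (~` A) by exact: measurableC.
have fTA (g : T -> R) : m.-integrable setT (EFin \o g) ->
    \int[m]_x g x = \int[m]_(x in A) g x + \int[m]_(x in ~` A) g x.
  move=> gi; rewrite -[in LHS](setUv A) Rintegral_setU // setUv //.
rewrite (fTA f fi) addrAC subrr add0r.
have fiC : m.-integrable (~` A) (EFin \o f) by exact: integrableS fi.
apply: le_trans (le_normr_Rintegral mCA fiC) _.
have E := fTA af ai.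
have aiA : m.-integrable A (EFin \o af) by exact: integrableS ai.
have Iin : \int[m]_x af x - e <= \int[m]_(x in A) af x.
  rewrite -lee_fin EFinB /Rintegral !fineK ?(integrable_fin_num measurableT ai) ?(integrable_fin_num mA aiA) //.
  apply: (le_trans (ltW In)); apply: ge0_subset_integral => //.
    exact: measurable_funTS.
  by move=> x _; exact: af0.
by move: E Iin; rewrite -/af; clear; lra.
Qed.

Lemma integral_tails (f : R -> R) (e : R) : mu.-integrable setT (EFin \o f) -> 0 < e ->
  exists N : R, forall M : R, N <= M -> `|\int[mu]_x f x - seg (- M) M f| <= e.
Proof.
move=> fi e0.
pose F n : set R := `[- n%:R, n%:R].
have ndF : nondecreasing_seq F.
  by move=> m n mn; rewrite subsetEset; apply: subset_itv; rewrite bnd_simp ?lerN2 ler_nat.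
have UF : \bigcup_n F n = setT.
  apply/seteqP; split=> // x _; exists (Num.truncn `|x|).+1 => //=.
  by rewrite /F /= in_itv /= -ler_norml ltW // truncnS_gt.
have [n nP] := @Rintegral_exhaust _ _ mu F f e ndF (fun n => measurable_itv _) UF fi e0.
exists n%:R => M nM; apply: nP; first exact: measurable_itv.
by apply: subset_itv; rewrite bnd_simp ?lerN2.
Qed.

(** Goursat on [t1, t2] x [-N, N]. The vertical sides tend to the full lines; the horizontal sides
    are bounded by E(N) and E(-N), and finiteness of the integral of E provides arbitrarily large N
    for which both are small. *)
Lemma strip_shift (P Q : R -> R -> R) (t1 t2 x0 y0 : R) (E : R -> \bar R) :
  t1 <= x0 <= t2 ->
  (forall x y, t1 <= x <= t2 -> cont_at2 P x y) ->
  (forall x y, t1 <= x <= t2 -> cont_at2 Q x y) ->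
  (forall x y, t1 <= x <= t2 -> (x, y) != (x0, y0) -> closed_at P Q x y) ->
  mu.-integrable setT (EFin \o Q t1) -> mu.-integrable setT (EFin \o Q t2) ->
  measurable_fun [set: R] E -> (forall y, 0 <= E y)%E -> (\int[mu]_y E y < +oo)%E ->
  (forall y, (`|seg t1 t2 (P ^~ y)|%:E <= E y)%E) ->
  \int[mu]_y Q t1 y = \int[mu]_y Q t2 y.
Proof.
move=> x0i cP cQ cl i1 i2 mE E0 Ei PE; apply/eqP; rewrite -subr_eq0 -normr_le0.
apply/ler_addgt0Pr => e e0; rewrite add0r.
have e3 : 0 < e / 3 by rewrite divr_gt0.
have [N1 H1] := integral_tails i1 e3; have [N2 H2] := integral_tails i2 e3.
have mEN : measurable_fun [set: R] (fun y => E (- y)) by exact: measurableT_comp.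
have mE2 : measurable_fun [set: R] (fun y => E y + E (- y)%R)%E by exact: emeasurable_funD.
have E20 y : (0 <= E y + E (- y)%R)%E by rewrite adde_ge0.
have iE2 : (\int[mu]_y (E y + E (- y)%R) < +oo)%E.
  rewrite ge0_integralD //.
  have n1 : (-1 : R) != 0 by rewrite oppr_eq0 oner_eq0.
  have := @ge0_integral_affine R (-1) 0 E n1 mE E0.
  rewrite normrN1 mul1e; under [in RHS]eq_integral do rewrite mulN1r addr0.
  by move=> <-; rewrite lte_add_pinfty.
(* The lower bound |y0| places the exceptional point inside the rectangle. *)
have [N NN EN] := ge0_small_value (Num.max (Num.max N1 N2) (`|y0|)) mE2 E20 iE2 e3.
have [N1N N2N y0N] : [/\ N1 <= N, N2 <= N & `|y0| <= N].
  by move: NN; rewrite !ge_max => /andP[/andP[]].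
move: y0N; rewrite ler_norml => y0N.
have := @goursat_point R P Q t1 t2 (- N) N (fun x y xi _ => cP x y xi)
   (fun x y xi _ => cQ x y xi) x0 y0 x0i y0N (fun x y xi _ => cl x y xi).
rewrite /circ => C.
have h1 := H1 _ N1N; have h2 := H2 _ N2N.
have h3 : `|seg t1 t2 (P ^~ N)| + `|seg t1 t2 (P ^~ (- N))| < e / 3.
  by rewrite -lte_fin EFinD; apply: le_lt_trans EN; exact: leeD.
have := ler_normB (\int[mu]_y Q t1 y - seg (- N) N (Q t1)) (\int[mu]_y Q t2 y - seg (- N) N (Q t2)).
have := ler_normB (seg t1 t2 (P ^~ N)) (seg t1 t2 (P ^~ (- N))).
have := ler_normD (\int[mu]_y Q t1 y - seg (- N) N (Q t1) - (\int[mu]_y Q t2 y - seg (- N) N (Q t2)))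
  (seg (- N) N (Q t1) - seg (- N) N (Q t2)).
have -> : seg (- N) N (Q t1) - seg (- N) N (Q t2) = - (seg t1 t2 (P ^~ N) - seg t1 t2 (P ^~ (- N))) by lra.
rewrite normrN [X in `|X| <= _ -> _](_ : _ = \int[mu]_y Q t1 y - \int[mu]_y Q t2 y); last lra.
lra.
Qed.

(** The real inner integral is [fine] of the extended one; they can differ only where the latter is
    infinite, which is a null set. *)
Lemma Rintegral_fubini1 (f : R * R -> R) : (mu \x mu)%E.-integrable setT (EFin \o f) ->
  mu.-integrable setT (EFin \o (fun x => \int[mu]_y f (x, y))) /\
  \int[(mu \x mu)%E]_p f p = \int[mu]_x \int[mu]_y f (x, y).
Proof.
move=> fi.
have mF := measurable_fubini_F fi.
have iF := integrable_fubini_F fi.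
have ae : ae_eq mu setT (fubini_F mu (EFin \o f)) (EFin \o (fun x => \int[mu]_y f (x, y))).
  have := integrable_ae measurableT iF; apply: filterS => x /= h _.
  by rewrite /Rintegral fineK //; exact: h.
have mF2 : measurable_fun [set: R] (EFin \o (fun x => \int[mu]_y f (x, y))).
  apply/measurable_EFinP; apply: (measurableT_comp (@fine_measurable R setT measurableT)).
  exact: mF.
split.
  apply/integrableP; split => //.
  rewrite -(ge0_ae_eq_integral (mu := mu) (f := abse \o fubini_F mu (EFin \o f))) //.
  - by case/integrableP: iF.
  - exact: measurableT_comp.
  - exact: measurableT_comp.
  - by move=> x _; exact: abse_ge0.
  - by move: ae; apply: filterS => x h Dx; rewrite /= h.
rewrite [LHS]/Rintegral -(integral12_prod_meas1 fi).
by rewrite [RHS]/Rintegral; congr fine; apply: ae_eq_integral.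
Qed.

Lemma Rintegral_fubini2 (f : R * R -> R) : (mu \x mu)%E.-integrable setT (EFin \o f) ->
  mu.-integrable setT (EFin \o (fun y => \int[mu]_x f (x, y))) /\
  \int[(mu \x mu)%E]_p f p = \int[mu]_y \int[mu]_x f (x, y).
Proof.
move=> fi.
pose fs (p : R * R) := f (p.2, p.1).
have mf := measurable_int _ fi.
have mfs : measurable_fun setT (EFin \o fs : measurableTypeR R * measurableTypeR R -> \bar R).
  apply: (measurableT_comp mf).
  by apply: measurable_fun_pair; [exact: measurable_snd|exact: measurable_fst].
have fsi : (mu \x mu)%E.-integrable setT (EFin \o fs).
  apply/(integrable12ltyP _ _ mfs).
  exact: (integrable21ltyP mu mu mf).1.
have [h1 h2] := Rintegral_fubini1 fsi; split => //.
rewrite -h2 /Rintegral -(integral12_prod_meas1 fsi) -(integral21_prod_meas1 fi) //.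
Qed.
End RealIntegrals.

Lemma eq_ler (R : realType) (x y : R) : x = y -> x <= y. Proof. by move=> ->. Qed.

(** * Modulus, real part and imaginary part *)

Section ComplexModulus.
Context {R : realType}.
Implicit Types z w : R[i].

Lemma normc_ge0 z : 0 <= normc z.
Proof. by case: z => x y; exact: sqrtr_ge0. Qed.

Lemma sqr_normcE z : normc z ^+ 2 = Re z ^+ 2 + Im z ^+ 2.
Proof. by case: z => x y /=; rewrite sqr_sqrtr // addr_ge0 ?sqr_ge0. Qed.

Lemma normc_eq0 z : (normc z == 0) = (z == 0).
Proof.
by apply/eqP/eqP => [/Normc.eq0_normc|->] //; exact: Normc.normc0.
Qed.

Lemma normc_gt0 z : (0 < normc z) = (z != 0).
Proof. by rewrite lt_neqAle normc_ge0 andbT eq_sym normc_eq0. Qed.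

Lemma Re_le_normc z : `|Re z| <= normc z.
Proof.
rewrite -ler_sqr ?nnegrE ?normc_ge0 // sqr_normcE real_normK ?num_real //.
by rewrite lerDl sqr_ge0.
Qed.

Lemma Im_le_normc z : `|Im z| <= normc z.
Proof.
rewrite -ler_sqr ?nnegrE ?normc_ge0 // sqr_normcE real_normK ?num_real //.
by rewrite lerDr sqr_ge0.
Qed.

Lemma normc_real (x : R) : normc x%:C = `|x|.
Proof. by rewrite /= expr0n addr0 sqrtr_sqr. Qed.

Lemma normcJ z : normc (conjc z) = normc z.
Proof. by case: z => x y /=; rewrite sqrrN. Qed.

Lemma normcX z n : normc (z ^+ n) = normc z ^+ n.
Proof.
by elim: n => [|n IH]; rewrite ?expr0 ?Normc.normc1 // !exprS Normc.normcM IH.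
Qed.

Lemma normc_le_ReIm z : normc z <= `|Re z| + `|Im z|.
Proof.
have -> : z = (Re z)%:C + (0 +i* 1) * (Im z)%:C by case: z => x y; apply/eqP; rewrite eq_complex /=; apply/andP; split; apply/eqP; ring.
apply: le_trans (le_normcD _ _) _; rewrite Normc.normcM !normc_real.
rewrite [X in _ + X * _](_ : _ = 1) ?mul1r; last by rewrite /= expr0n add0r expr1n sqrtr1.
by case: z => x y /=; rewrite !(mulr0, mul0r, mul1r, addr0, add0r, subr0).
Qed.

Lemma normcE_Re z : `|z| = (normc z)%:C.
Proof. by rewrite normc_def; case: z. Qed.

Lemma gt0_complexE z : (0 < z) = (0 < Re z) && (Im z == 0).
Proof. by rewrite ltcE /= andbC eq_sym. Qed.

Lemma Re_add z w : Re (z + w) = Re z + Re w. Proof. by case: z; case: w. Qed.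
Lemma Im_add z w : Im (z + w) = Im z + Im w. Proof. by case: z; case: w. Qed.
Lemma Re_opp z : Re (- z) = - Re z. Proof. by case: z. Qed.
Lemma Im_opp z : Im (- z) = - Im z. Proof. by case: z. Qed.
Lemma Re_mul z w : Re (z * w) = Re z * Re w - Im z * Im w.
Proof. by case: z; case: w. Qed.
Lemma Im_mul z w : Im (z * w) = Re z * Im w + Im z * Re w.
Proof. by case: z; case: w. Qed.
Lemma Re_conjc z : Re (conjc z) = Re z. Proof. by case: z. Qed.
Lemma Im_conjc z : Im (conjc z) = - Im z. Proof. by case: z. Qed.
Lemma conj_add z w : (conjc (z + w)) = (conjc z) + (conjc w). Proof. exact: rmorphD. Qed.
Lemma conj_mul z w : (conjc (z * w)) = (conjc z) * (conjc w). Proof. exact: rmorphM. Qed.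
Lemma conj_exp z n : (conjc (z ^+ n)) = (conjc z) ^+ n. Proof. exact: rmorphXn. Qed.
Lemma conj_real (x : R) : conjc x%:C = x%:C. Proof. exact: conjc_real. Qed.
Lemma conjK z : conjc (conjc z) = z. Proof. exact: conjcK. Qed.
Lemma conj_inv z : (conjc (z^-1)) = (conjc z)^-1. Proof. exact: conjc_inv. Qed.
End ComplexModulus.

(** * Complex differentiability and the Cauchy-Riemann equations *)

Section ComplexDerivative.
Context {R : realType}.
Implicit Types (F G : R[i] -> R[i]) (z w : R[i]).

(** An epsilon-delta form of [derivable] with real-valued moduli and tolerances, from which
    expansions of the real and imaginary parts can be read off. *)
Definition Cdiff F z := exists d, forall e : R, 0 < e ->
  exists2 r : R, 0 < r & forall w, normc (w - z) < r ->
    normc (F w - F z - d * (w - z)) <= e * normc (w - z).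

Definition Ccont F z := forall e : R, 0 < e ->
  exists2 r : R, 0 < r & forall w, normc (w - z) < r -> normc (F w - F z) <= e.

(** In the normed space [R[i]^o] norms, radii and tolerances are elements of [R[i]], positive
    meaning real and positive; the proof carries them to [R] and back. *)
Lemma derivable_Cdiff F z : derivable (F : R[i]^o -> R[i]^o) z 1 <-> Cdiff F z.
Proof.
split.
  move=> /cvg_ex[/= d /cvgrPdist_le /= H]; exists d => e e0.
  have e0C : 0 < e%:C by rewrite gt0_complexE /= e0 eqxx.
  have /nbhs_ballP[r /= r0 {}H] := H _ e0C.
  move: r0; rewrite gt0_complexE => /andP[r0 /eqP ri].
  exists (Re r) => // w wr.
  have [->|wz] := eqVneq w z.
    by rewrite !subrr mulr0 subr0 Normc.normc0 mulr0.
  have wz0 : w - z != 0 by rewrite subr_eq0.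
  have := H (w - z); rewrite /ball /= sub0r normrN normcE_Re.
  have -> : r = (Re r)%:C by case: (r) ri => a b /= ->.
  rewrite ltcR => /(_ wr wz0).
  rewrite /GRing.scale /= mulr1 subrK normcE_Re lecR => {}H.
  have -> : F w - F z - d * (w - z) = - ((d - (w - z)^-1 * (F w - F z)) * (w - z)).
    by rewrite mulrBl mulrAC mulVf // mul1r opprB.
  by rewrite normcN Normc.normcM ler_wpM2r // normc_ge0.
move=> [d H]; apply/cvg_ex; exists d; apply/cvgrPdist_le => /= e.
rewrite gt0_complexE => /andP[e0 /eqP ei].
have [r r0 {}H] := H _ e0.
apply/nbhs_ballP; exists r%:C => /=; first by rewrite gt0_complexE /= r0 eqxx.
move=> h; rewrite /ball /= sub0r normrN normcE_Re ltcR => hr h0.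
rewrite /GRing.scale /= mulr1 normcE_Re.
have -> : e = (Re e)%:C by case: (e) ei => a b /= ->.
rewrite lecR.
have := H (h + z); rewrite addrK => /(_ hr) {}H.
rewrite -(@ler_pM2r _ (normc h)) ?normc_gt0 // -Normc.normcM.
rewrite (le_trans _ H) // -normcN; apply: eq_ler; congr normc.
by rewrite mulrBl mulrAC mulVf // mul1r opprB.
Qed.

Lemma Cdiff_cont F z : Cdiff F z -> Ccont F z.
Proof.
move=> [d /(_ 1 ltr01)[r r0 H]] e e0.
have M0 : 0 < normc d + 1 by apply: ltr_wpDl => //; exact: normc_ge0.
exists (Num.min r (e / (normc d + 1))); first by rewrite lt_min r0 divr_gt0.
move=> w; rewrite lt_min => /andP[wr we].
have {}H := H w wr.
have -> : F w - F z = (F w - F z - d * (w - z)) + d * (w - z) by rewrite subrK.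
apply: le_trans (le_normcD _ _) _.
rewrite Normc.normcM.
move: we; rewrite ltr_pdivlMr // mulrDr mulr1 [_ * normc d]mulrC.
by move: H; rewrite mul1r; lra.
Qed.

Lemma Cdiff_local F G z (r : R) : 0 < r ->
  (forall w, normc (w - z) < r -> F w = G w) -> Cdiff F z -> Cdiff G z.
Proof.
move=> r0 FG [d H]; exists d => e /H[s s0 {}H].
exists (Num.min s r) => [|w]; first by rewrite lt_min s0.
rewrite lt_min => /andP[ws wr].
have zz : normc (z - z) < r by rewrite subrr Normc.normc0.
by rewrite -!FG //; exact: H.
Qed.

Lemma Ccont_local F G z (r : R) : 0 < r ->
  (forall w, normc (w - z) < r -> F w = G w) -> Ccont F z -> Ccont G z.
Proof.
move=> r0 FG H e /H[s s0 {}H].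
exists (Num.min s r) => [|w]; first by rewrite lt_min s0.
rewrite lt_min => /andP[ws wr].
have zz : normc (z - z) < r by rewrite subrr Normc.normc0.
by rewrite -!FG //; exact: H.
Qed.

Lemma Cdiff_cst c z : Cdiff (fun=> c) z.
Proof. by apply/derivable_Cdiff; exact: derivable_cst. Qed.

Lemma Cdiff_id z : Cdiff id z.
Proof. by apply/derivable_Cdiff; exact: derivable_id. Qed.

Lemma CdiffD F G z : Cdiff F z -> Cdiff G z -> Cdiff (fun w => F w + G w) z.
Proof. by move=> /derivable_Cdiff f /derivable_Cdiff g; apply/derivable_Cdiff; exact: (@derivableD R[i] R[i]^o R[i]^o F G z 1 f g). Qed.

Lemma CdiffM F G z : Cdiff F z -> Cdiff G z -> Cdiff (fun w => F w * G w) z.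
Proof. by move=> /derivable_Cdiff f /derivable_Cdiff g; apply/derivable_Cdiff; exact: (@derivableM R[i] R[i]^o F G z 1 f g). Qed.

Lemma CdiffV F z : F z != 0 -> Cdiff F z -> Cdiff (fun w => (F w)^-1) z.
Proof. by move=> h /derivable_Cdiff f; apply/derivable_Cdiff; exact: (@derivableV R[i] R[i]^o F z 1 h f). Qed.

Lemma CdiffX F n z : Cdiff F z -> Cdiff (fun w => F w ^+ n) z.
Proof.
move=> f; elim: n => [|n IH].
  by under [X in Cdiff X _]funext do rewrite expr0; exact: Cdiff_cst.
by under [X in Cdiff X _]funext do rewrite exprS; exact: CdiffM.
Qed.

Lemma Cdiff_comp F G z : Cdiff G z -> Cdiff F (G z) -> Cdiff (fun w => F (G w)) z.
Proof.
move=> dG [d H]; have [c K] := dG; exists (d * c) => e e0.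
pose M := normc c + 1; pose N := normc d + 1.
have M0 : 0 < M by have := normc_ge0 c; rewrite /M; lra.
have N0 : 0 < N by have := normc_ge0 d; rewrite /N; lra.
have e1 : 0 < e / (2 * M) by rewrite divr_gt0 // mulr_gt0.
have e2 : 0 < Num.min 1 (e / (2 * N)) by rewrite lt_min ltr01 divr_gt0 // mulr_gt0.
have [r1 r10 {}H] := H _ e1; have [r2 r20 {}K] := K _ e2.
have [r3 r30 L] := Cdiff_cont dG (divr_gt0 r10 (ltr0Sn R 1)).
exists (Num.min r2 r3) => [|w]; first by rewrite lt_min r20.
rewrite lt_min => /andP[/K {}K /L {}L].
have {}H := H (G w) ltac:(lra).
have K1 : normc (G w - G z) <= M * normc (w - z).
  have -> : G w - G z = (G w - G z - c * (w - z)) + c * (w - z) by rewrite subrK.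
  apply: le_trans (le_normcD _ _) _; rewrite Normc.normcM /M mulrDl mul1r addrC lerD2l.
  apply: le_trans K _; rewrite -[leRHS]mul1r ler_wpM2r ?normc_ge0 //.
  by rewrite ge_min lexx.
have K2 : normc (G w - G z - c * (w - z)) <= e / (2 * N) * normc (w - z).
  by apply: le_trans K _; rewrite ler_wpM2r ?normc_ge0 // ge_min lexx orbT.
have -> : F (G w) - F (G z) - d * c * (w - z) =
   (F (G w) - F (G z) - d * (G w - G z)) + d * (G w - G z - c * (w - z)) by ring.
apply: le_trans (le_normcD _ _) _.
rewrite [e]splitr mulrDl Normc.normcM; apply: lerD.
  apply: le_trans H _; apply: le_trans (ler_wpM2l (ltW e1) K1) _.
  by apply: eq_ler; rewrite mulrA; congr (_ * _); field; rewrite lt0r_neq0.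
apply: le_trans (ler_wpM2l (normc_ge0 d) K2) _.
rewrite mulrA ler_wpM2r ?normc_ge0 //.
rewrite mulrA ler_pdivrMr ?mulr_gt0 // mulrC.
have -> : e / 2 * (2 * N) = e * N by field.
by rewrite ler_pM2l // /N lerDl.
Qed.

Lemma CcontM F G z : Ccont F z -> Ccont G z -> Ccont (fun w => F w * G w) z.
Proof.
move=> f g e e0.
pose M := normc (F z) + normc (G z) + 1.
have M0 : 0 < M by have := normc_ge0 (F z); have := normc_ge0 (G z); rewrite /M; lra.
pose eta := Num.min 1 (e / M).
have eta0 : 0 < eta by rewrite lt_min ltr01 divr_gt0.
have eta1 : eta <= 1 by rewrite ge_min lexx.
have etae : eta * M <= e by rewrite -ler_pdivlMr // ge_min lexx orbT.
have [r1 r10 {}f] := f _ eta0; have [r2 r20 {}g] := g _ eta0.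
exists (Num.min r1 r2) => [|w]; first by rewrite lt_min r10.
rewrite lt_min => /andP[/f {}f /g {}g].
have -> : F w * G w - F z * G z = (F w - F z) * (G w - G z) + (F w - F z) * G z + F z * (G w - G z) by ring.
have := le_normcD ((F w - F z) * (G w - G z) + (F w - F z) * G z) (F z * (G w - G z)).
have := le_normcD ((F w - F z) * (G w - G z)) ((F w - F z) * G z).
rewrite !Normc.normcM => h1 h2.
have h3 : normc (F w - F z) * normc (G w - G z) <= eta * 1.
  by apply: ler_pM; rewrite ?normc_ge0 // (le_trans g).
have h4 : normc (F w - F z) * normc (G z) <= eta * normc (G z) by rewrite ler_wpM2r // normc_ge0.
have h5 : normc (F z) * normc (G w - G z) <= normc (F z) * eta by rewrite ler_wpM2l // normc_ge0.
by rewrite /M !mulrDr in etae; lra.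
Qed.

Lemma Ccont_Re F x y : Ccont F (x +i* y) -> cont_at2 (fun x y => Re (F (x +i* y))) x y.
Proof.
move=> H e /H[r r0 {}H]; exists (r / 2); first by rewrite divr_gt0.
move=> x' y' h1 h2; apply: le_trans (H (x' +i* y') _); last first.
  by apply: le_lt_trans (normc_le_ReIm _) _ => /=; lra.
by apply: le_trans _ (Re_le_normc _); rewrite Re_add Re_opp.
Qed.

Lemma Ccont_Im F x y : Ccont F (x +i* y) -> cont_at2 (fun x y => Im (F (x +i* y))) x y.
Proof.
move=> H e /H[r r0 {}H]; exists (r / 2); first by rewrite divr_gt0.
move=> x' y' h1 h2; apply: le_trans (H (x' +i* y') _); last first.
  by apply: le_lt_trans (normc_le_ReIm _) _ => /=; lra.
by apply: le_trans _ (Im_le_normc _); rewrite Im_add Im_opp.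
Qed.

(** The Cauchy-Riemann equations: multiplication by p + i q has the real matrix (p, -q; q, p). *)
Lemma Cdiff_expansion F x y : Cdiff F (x +i* y) -> exists p q : R,
  expansion_at2 (fun x y => Re (F (x +i* y))) x y p (- q) /\
  expansion_at2 (fun x y => Im (F (x +i* y))) x y q p.
Proof.
move=> [[p q] H]; exists p, q.
have {}H e : 0 < e -> exists2 r, 0 < r & forall x' y', `|x' - x| < r -> `|y' - y| < r ->
   normc (F (x' +i* y') - F (x +i* y) - (p +i* q) * ((x' - x) +i* (y' - y)))
      <= e * (`|x' - x| + `|y' - y|).
  move=> e0; have [r r0 {}H] := H _ e0; exists (r / 2); first by rewrite divr_gt0.
  move=> x' y' h1 h2; have h3 : normc ((x' - x) +i* (y' - y)) <= `|x' - x| + `|y' - y|.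
    exact: normc_le_ReIm.
  have := H (x' +i* y'); rewrite (_ : (x' +i* y') - (x +i* y) = (x' - x) +i* (y' - y)) // => {}H.
  apply: le_trans (H _) _; first by apply: le_lt_trans h3 _; lra.
  by rewrite ler_pM2l.
split => e /H[r r0 {}H]; exists r => // x' y' h1 h2; apply: le_trans (H _ _ h1 h2).
  apply: le_trans _ (Re_le_normc _); rewrite !Re_add !Re_opp Re_mul /=; apply: eq_ler.
  by congr `|_|; ring.
apply: le_trans _ (Im_le_normc _); rewrite !Im_add !Im_opp Im_mul /=; apply: eq_ler.
by congr `|_|; ring.
Qed.

Lemma expansionN (F : R -> R -> R) x y p q : expansion_at2 F x y p q ->
  expansion_at2 (fun x y => - F x y) x y (- p) (- q).
Proof.
move=> H e /H[r r0 {}H]; exists r => // x' y' h1 h2.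
by apply: le_trans (H _ _ h1 h2); rewrite -normrN; apply: eq_ler; congr `|_|; ring.
Qed.

(** The form P dx + Q dy is here the imaginary part of F dz; in [Cdiff_closed2] it is minus the real
    part. *)
Lemma Cdiff_closed1 F x y : Cdiff F (x +i* y) ->
  closed_at (fun x y => Im (F (x +i* y))) (fun x y => Re (F (x +i* y))) x y.
Proof.
by move=> /Cdiff_expansion[p [q [h1 h2]]]; exists q, p, (- q).
Qed.

Lemma Cdiff_closed2 F x y : Cdiff F (x +i* y) ->
  closed_at (fun x y => - Re (F (x +i* y))) (fun x y => Im (F (x +i* y))) x y.
Proof.
move=> /Cdiff_expansion[p [q [h1 h2]]]; exists (- p), q, p; split => //.
by rewrite -[q]opprK; exact: expansionN.
Qed.
End ComplexDerivative.

(** * Integrals of complex-valued functions *)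

Section ComplexIntegral.
Context {R : realType} d (T : measurableType d) (m : {measure set T -> \bar R}).
Implicit Types (F G : T -> R[i]) (g : T -> R).

Definition Cmeas F :=
  measurable_fun setT (fun x => Re (F x)) /\ measurable_fun setT (fun x => Im (F x)).

Definition Cint F := m.-integrable setT (EFin \o (fun x => Re (F x))) /\
  m.-integrable setT (EFin \o (fun x => Im (F x))).

Definition CI F : R[i] := (\int[m]_x Re (F x)) +i* (\int[m]_x Im (F x)).

Lemma CmeasM F G : Cmeas F -> Cmeas G -> Cmeas (fun x => F x * G x).
Proof.
move=> [f1 f2] [g1 g2]; split.
  by under eq_fun do rewrite Re_mul; apply: measurable_funB; exact: measurable_funM.
by under eq_fun do rewrite Im_mul; apply: measurable_funD; exact: measurable_funM.
Qed.

Lemma CmeasJ F : Cmeas F -> Cmeas (fun x => (conjc (F x))).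
Proof.
move=> [f1 f2]; split.
  by under eq_fun do rewrite Re_conjc.
by under eq_fun do rewrite Im_conjc; exact: measurable_funN.
Qed.

Lemma Cmeas_real g : measurable_fun setT g -> Cmeas (fun x => (g x)%:C).
Proof. by move=> mg; split => //=; exact: measurable_cst. Qed.

Lemma Cint_le F g : Cmeas F -> m.-integrable setT (EFin \o g) ->
  (forall x, normc (F x) <= g x) -> Cint F.
Proof.
move=> [mR mI] gi Fg; split; apply: (le_integrable measurableT _ _ gi).
- exact/measurable_EFinP.
- move=> x _ /=; rewrite lee_fin.
  by apply: le_trans (Re_le_normc _) _; apply: le_trans (Fg x) (ler_norm _).
- exact/measurable_EFinP.
- move=> x _ /=; rewrite lee_fin.
  by apply: le_trans (Im_le_normc _) _; apply: le_trans (Fg x) (ler_norm _).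
Qed.

(** The factor 2 comes from bounding the real and imaginary parts separately. *)
Lemma CI_le F g : Cint F -> m.-integrable setT (EFin \o g) ->
  (forall x, normc (F x) <= g x) -> normc (CI F) <= 2 * \int[m]_x g x.
Proof.
move=> [iR iI] gi Fg; apply: le_trans (normc_le_ReIm _) _ => /=.
have H (f : T -> R) : m.-integrable setT (EFin \o f) -> (forall x, `|f x| <= normc (F x)) ->
    `|\int[m]_x f x| <= \int[m]_x g x.
  move=> fi fF; apply: le_trans (le_normr_Rintegral measurableT fi) _.
  apply: le_Rintegral => //; first exact: (integrable_abse fi).
  by move=> x _; apply: le_trans (fF x) (Fg x).
rewrite mulr_natl mulr2n; apply: lerD; apply: H => // x.
  exact: Re_le_normc.
exact: Im_le_normc.
Qed.

Lemma CID F G : Cint F -> Cint G -> CI (fun x => F x + G x) = CI F + CI G.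
Proof.
move=> [f1 f2] [g1 g2]; rewrite /CI.
under eq_Rintegral do rewrite Re_add.
under [X in _ +i* X]eq_Rintegral do rewrite Im_add.
by rewrite !RintegralD.
Qed.

Lemma Cint_scale c F : Cint F -> Cint (fun x => c * F x).
Proof.
move=> [f1 f2]; split.
  under eq_fun do rewrite Re_mul.
  exact: (integrableB measurableT (integrableZl measurableT (Re c) f1) (integrableZl measurableT (Im c) f2)).
under eq_fun do rewrite Im_mul.
exact: (integrableD measurableT (integrableZl measurableT (Re c) f2) (integrableZl measurableT (Im c) f1)).
Qed.

Lemma CI_scale c F : Cint F -> CI (fun x => c * F x) = c * CI F.
Proof.
move=> [f1 f2]; rewrite /CI.
under eq_Rintegral do rewrite Re_mul.
under [X in _ +i* X]eq_Rintegral do rewrite Im_mul.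
have Z (k : R) (f : T -> R) : m.-integrable setT (EFin \o f) ->
   m.-integrable setT (EFin \o (fun x => k * f x)).
  by move=> fi; exact: (integrableZl measurableT k fi).
rewrite RintegralB ?RintegralD //; try exact: Z.
by rewrite !RintegralZl //; case: c.
Qed.

Lemma CIJ F : Cint F -> CI (fun x => (conjc (F x))) = (conjc (CI F)).
Proof.
move=> [f1 f2]; rewrite /CI.
under eq_Rintegral do rewrite Re_conjc.
under [X in _ +i* X]eq_Rintegral do rewrite Im_conjc -mulN1r.
by rewrite RintegralZl // mulN1r.
Qed.

Lemma eq_CI F G : F =1 G -> CI F = CI G.
Proof. by move=> /funext ->. Qed.

Lemma CI_ae F G : Cint F -> Cint G -> {ae m, forall x, F x = G x} -> CI F = CI G.
Proof.
move=> [f1 f2] [g1 g2] ae; rewrite /CI /Rintegral; congr (fine _ +i* fine _).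
  apply: ae_eq_integral => //; [exact: measurable_int f1|exact: measurable_int g1|].
  by move: ae; apply: filterS => x h _; rewrite h.
apply: ae_eq_integral => //; [exact: measurable_int f2|exact: measurable_int g2|].
by move: ae; apply: filterS => x h _; rewrite h.
Qed.
End ComplexIntegral.

(** * Complex Fubini and Cauchy's theorem on vertical strips *)

Section ComplexIntegralPlane.
Context {R : realType}.
Local Notation mu := (@lebesgue_measure R).
Local Notation area := (mu \x mu)%E.

Lemma CI_fubini1 (F : R * R -> R[i]) : Cint area F ->
  Cint mu (fun x => CI mu (fun y => F (x, y))) /\
  CI area F = CI mu (fun x => CI mu (fun y => F (x, y))).
Proof.
move=> [/Rintegral_fubini1[f1 e1] /Rintegral_fubini1[f2 e2]].
by split; [split|rewrite /CI e1 e2].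
Qed.

Lemma CI_fubini2 (F : R * R -> R[i]) : Cint area F ->
  Cint mu (fun y => CI mu (fun x => F (x, y))) /\
  CI area F = CI mu (fun y => CI mu (fun x => F (x, y))).
Proof.
move=> [/Rintegral_fubini2[f1 e1] /Rintegral_fubini2[f2 e2]].
by split; [split|rewrite /CI e1 e2].
Qed.

Lemma integrable_cauchy_density : mu.-integrable setT (EFin \o (fun y : R => (1 + y ^+ 2)^-1)).
Proof.
have cf : continuous (fun y : R => (1 + y ^+ 2)^-1) by exact: continuous_oneDsqrV.
have f0 (y : R) : 0 <= (1 + y ^+ 2)^-1 by rewrite invr_ge0 addr_ge0 // sqr_ge0.
apply/integrableP; split; first by apply/measurable_EFinP; apply: continuous_measurable_fun.
under eq_integral do rewrite /= ger0_norm //.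
rewrite (ge0_symfun_integralT f0 cf); last by move=> y /=; rewrite sqrrN.
by rewrite -set_itvcy; have /= -> := @integral0y_oneDsqr R; rewrite -EFinM ltry.
Qed.

(** Cauchy densities with another centre and width are dominated by the standard one, uniformly for
    widths at least c, because y^2 <= 2 (y - v)^2 + 2 v^2. *)
Lemma cauchy_density_dom (c v : R) : 0 < c -> exists2 K, 0 < K &
  forall (x y : R), c <= x -> (x ^+ 2 + (y - v) ^+ 2)^-1 <= K * (1 + y ^+ 2)^-1.
Proof.
move=> c0; pose K := 2 + (1 + 2 * v ^+ 2) / c ^+ 2.
have c20 : 0 < c ^+ 2 by exact: exprn_gt0.
have v0 : 0 <= v ^+ 2 by exact: sqr_ge0.
have K2 : 2 <= K by rewrite /K lerDl divr_ge0 // ?ltW //; lra.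
have K0 : 0 < K by lra.
exists K => // x y cx.
have x0 : 0 < x by lra.
have y0 : 0 <= y ^+ 2 by exact: sqr_ge0.
have yv0 : 0 <= (y - v) ^+ 2 by exact: sqr_ge0.
have x20 : 0 < x ^+ 2 by exact: exprn_gt0.
have cx2 : c ^+ 2 <= x ^+ 2 by rewrite ler_sqr ?nnegrE //; lra.
rewrite ler_pdivlMr; last lra.
rewrite mulrC ler_pdivrMr; last lra.
rewrite mulrDr.
have h1 : 1 + 2 * v ^+ 2 <= K * x ^+ 2.
  apply: (@le_trans _ _ (K * c ^+ 2)); last by rewrite ler_pM2l.
  rewrite (_ : K * c ^+ 2 = 2 * c ^+ 2 + (1 + 2 * v ^+ 2)); first lra.
  by rewrite /K; field; rewrite lt0r_neq0.
have h2 : 2 * (y - v) ^+ 2 <= K * (y - v) ^+ 2 by rewrite ler_wpM2r.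
have h3 : 2 * (y - v) ^+ 2 + 2 * v ^+ 2 - y ^+ 2 = (y - 2 * v) ^+ 2 by ring.
have := sqr_ge0 (y - 2 * v); lra.
Qed.

(* Cauchy's theorem on a vertical strip; at [z0] the function is only assumed continuous. *)
Lemma CI_strip_shift (F : R[i] -> R[i]) (t1 t2 : R) (z0 : R[i]) (G : R * R -> R) :
  t1 <= Re z0 <= t2 ->
  (forall z, t1 <= Re z <= t2 -> Ccont F z) ->
  (forall z, t1 <= Re z <= t2 -> z != z0 -> Cdiff F z) ->
  Cint mu (fun y => F (t1 +i* y)) -> Cint mu (fun y => F (t2 +i* y)) ->
  area.-integrable setT (EFin \o G) -> (forall p, 0 <= G p) ->
  (forall x y, t1 <= x <= t2 -> normc (F (x +i* y)) <= G (x, y)) ->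
  CI mu (fun y => F (t1 +i* y)) = CI mu (fun y => F (t2 +i* y)).
Proof.
case: z0 => x0 y0 /= x0i cF dF [i1R i1I] [i2R i2I] iG G0 FG.
have mG := measurable_int _ iG.
have G0e p : (0 <= (EFin \o G) p)%E by rewrite /= lee_fin.
(* E(y) bounds the integral along the horizontal segment at height y, and is integrable in y by
   Tonelli. *)
pose E y := (\int[mu]_x (G (x, y))%:E)%E.
have mE : measurable_fun [set: R] E by exact: (measurable_fun_fubini_tonelli_G (m1 := mu) (EFin \o G) mG G0e).
have E0 y : (0 <= E y)%E by apply: integral_ge0 => x _; exact: (G0e (x, y)).
have Ei : (\int[mu]_y E y < +oo)%E.
  have e1 := fubini_tonelli1 (m1 := mu) (m2 := mu) (EFin \o G) mG G0e.
  have e2 := fubini_tonelli (m1 := mu) (m2 := mu) (EFin \o G) mG G0e.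
  have := integrable_lty measurableT iG; apply: le_lt_trans.
  by rewrite le_eqVlt; apply/orP; left; apply/eqP; exact: (esym (etrans e1 e2)).
have cR x y : t1 <= x <= t2 -> cont_at2 (fun x y => Re (F (x +i* y))) x y.
  by move=> xi; apply: Ccont_Re; exact: cF.
have cI x y : t1 <= x <= t2 -> cont_at2 (fun x y => Im (F (x +i* y))) x y.
  by move=> xi; apply: Ccont_Im; exact: cF.
have cNR x y : t1 <= x <= t2 -> cont_at2 (fun x y => - Re (F (x +i* y))) x y.
  move=> xi e /(cR x y xi)[r r0 H]; exists r => // x' y' h1 h2.
  by rewrite -opprD normrN; apply: H.
have bound (f : R -> R -> R) y : (forall x, `|f x y| <= normc (F (x +i* y))) ->
    (forall x, t1 <= x <= t2 -> cont_at2 f x y) -> (`|seg t1 t2 (f^~ y)|%:E <= E y)%E.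
  move=> fF cf.
  have si : segint t1 t2 (f^~ y).
    by apply: segint_continuous => x xi; apply: cont_at2_fix2; exact: cf.
  rewrite EFin_normr_Rintegral //; apply: le_trans (le_abse_integral _ _ _) _ => //.
    exact: measurable_int si.
  apply: (@le_trans _ _ (\int[mu]_(x in `[t1, t2]) (G (x, y))%:E)%E).
    apply: ge0_le_integral => //.
    - by apply: measurableT_comp => //; exact: measurable_int si.
    - by apply: measurable_funTS; exact: (measurableT_comp mG).
    - move=> x /=; rewrite in_itv /= lee_fin => xi.
      by apply: le_trans (fF x) _; exact: FG.
  apply: ge0_subset_integral => //; last by move=> x _; exact: (G0e (x, y)).
  exact: (measurableT_comp mG).
have ne (x y : R) : (x, y) != (x0, y0) -> x +i* y != x0 +i* y0.
  by apply: contraNneq => -[-> ->].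
(* On a vertical line dz = i dy, so Re F dy is the imaginary part of F dz and Im F dy is minus its
   real part. *)
congr (_ +i* _).
  apply: (@strip_shift R (fun x y => Im (F (x +i* y))) (fun x y => Re (F (x +i* y))) t1 t2 x0 y0 E) => //.
  - by move=> x y xi /ne nz; apply: Cdiff_closed1; exact: dF.
  - by move=> y; apply: (bound (fun x y => Im (F (x +i* y)))) => [x|x xi]; [exact: Im_le_normc|exact: cI].
apply: (@strip_shift R (fun x y => - Re (F (x +i* y))) (fun x y => Im (F (x +i* y))) t1 t2 x0 y0 E) => //.
- by move=> x y xi /ne nz; apply: Cdiff_closed2; exact: dF.
- by move=> y; apply: (bound (fun x y => - Re (F (x +i* y)))) => [x|x xi]; [rewrite normrN; exact: Re_le_normc|exact: cNR].
Qed.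
End ComplexIntegralPlane.

(** * Functions on the half-plane, extended by zero *)

Section HalfPlaneFunctions.
Context {R : realType}.
Local Notation H := (rhp R -> R[i]).
Implicit Types (h u v : H).

Lemma extend_val h (z : rhp R) : extend h (val z) = h z.
Proof. by rewrite /extend valK. Qed.

Lemma extend_in h (z : R[i]) (z0 : 0 < Re z) : extend h z = h (exist _ z z0).
Proof. by rewrite -(extend_val h (exist _ z z0)). Qed.

Lemma extend_out h (z : R[i]) : Re z <= 0 -> extend h z = 0.
Proof. by move=> z0; rewrite /extend insubF //= ltNge z0. Qed.

Lemma extend0 z : extend (fun=> 0 : R[i]) z = 0.
Proof. by rewrite /extend; case: insub. Qed.

Lemma analyticP h : analytic h <-> forall z, 0 < Re z -> Cdiff (extend h) z.
Proof.
split=> [ah z z0|ah z]; last by apply/derivable_Cdiff/ah; exact: valP z.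
by apply/derivable_Cdiff; exact: (ah (exist _ z z0)).
Qed.

Lemma Re_near (z w : R[i]) : normc (w - z) < Re z -> 0 < Re w.
Proof.
move=> wz; have := le_lt_trans (Re_le_normc _) wz.
by rewrite Re_add Re_opp ltr_norml => /andP[h _]; lra.
Qed.

Lemma analytic_of (F : R[i] -> R[i]) h : (forall z, 0 < Re z -> Cdiff F z) ->
  (forall z : rhp R, h z = F (val z)) -> analytic h.
Proof.
move=> dF hF; apply/analyticP => z z0.
apply: (Cdiff_local z0 _ (dF z z0)) => w /Re_near w0.
by rewrite (extend_in h w0) hF.
Qed.

Lemma analytic_lin (c : R[i]) u v : analytic u -> analytic v ->
  analytic (fun z => c * u z + v z).
Proof.
move=> /analyticP au /analyticP av.
apply: (@analytic_of (fun z => c * extend u z + extend v z)) => [z z0|z].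
  by apply: CdiffD; [apply: CdiffM; [exact: Cdiff_cst|exact: au]|exact: av].
by rewrite !extend_val.
Qed.

Lemma extend_lin (c : R[i]) u v z :
  extend (fun z => c * u z + v z) z = c * extend u z + extend v z.
Proof.
have [z0|z0] := ltrP 0 (Re z); first by rewrite !(extend_in _ z0).
by rewrite !extend_out // mulr0 addr0.
Qed.
End HalfPlaneFunctions.

(** Algebra for polarization: the diagonal terms s and t are cancelled from the expansions of two
    equal squared norms. Then [polarization_cancel] combines the instances c = 1 and c = i. *)
Lemma sesquilinear_cancel (F : comRingType) (c d s t a b a' b' : F) :
  c * (d * s + a') + (d * b' + t) = c * (d * s + a) + (d * b + t) ->
  d * b' + c * a' = d * b + c * a.
Proof.
move=> E; apply: (addIr (c * (d * s) + t)).
transitivity (c * (d * s + a') + (d * b' + t)); first ring.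
by rewrite E; ring.
Qed.

Lemma polarization_cancel (F : numFieldType) (i b b' a a' : F) : i != 0 ->
  b + a = b' + a' -> - i * b + i * a = - i * b' + i * a' -> b = b'.
Proof.
move=> i0 E1 E2.
have E3 : a - b = a' - b'.
  apply: (mulfI i0); transitivity (- i * b + i * a); first ring.
  by rewrite E2; ring.
have : 2 * b = 2 * b'.
  transitivity ((b + a) - (a - b)); first ring.
  by rewrite E1 E3; ring.
by apply: mulfI; rewrite pnatr_eq0.
Qed.

(** * The Bergman space and its inner product *)

Section BergmanSpace.
Context {R : realType} (l : nat).
Local Notation H := (rhp R -> R[i]).
Local Notation mu := (@lebesgue_measure R).
Local Notation area := (mu \x mu)%E.
Local Notation MR := (measurableTypeR R).
Implicit Types (h u v : H).

Definition density h (p : R * R) : R :=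
  p.1 ^+ l * normc (extend h (p.1 +i* p.2)) ^+ 2.

Definition pairing u v (p : R * R) : R[i] :=
  (p.1 ^+ l)%:C * (extend u (p.1 +i* p.2) * conjc (extend v (p.1 +i* p.2))).

Lemma density_ge0 h p : 0 <= density h p.
Proof.
rewrite /density; have [p0|p0] := lerP p.1 0.
  by rewrite extend_out // Normc.normc0 expr0n mulr0.
by apply: mulr_ge0; apply: exprn_ge0; [exact: ltW|exact: normc_ge0].
Qed.

Lemma density_out h p : p.1 <= 0 -> density h p = 0.
Proof. by move=> p0; rewrite /density extend_out // Normc.normc0 expr0n mulr0. Qed.

(** The density vanishes off the half-plane, so the integral may run over the whole plane, a product
    space on which Fubini applies directly. *)
Lemma bergman_sqnormE h :
  bergman_sqnorm l h = ((pi^-1)%:E * \int[area]_p (density h p)%:E)%E.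
Proof.
rewrite /bergman_sqnorm integral_mkcond; congr (_ * _)%E.
apply: eq_integral => p _; rewrite patchE; case: ifPn => // /negP pn.
rewrite density_out // leNgt; apply/negP => p0; apply: pn.
by rewrite inE.
Qed.

Lemma bergman_innerE u v : bergman_inner l u v = (pi^-1)%:C * CI area (pairing u v).
Proof.
rewrite /bergman_inner; congr (_ * _); rewrite /CI.
have E (f : R[i] -> R) : f 0 = 0 ->
    \int[area]_(p in half_plane) f (pairing u v p) = \int[area]_p f (pairing u v p).
  move=> f0; rewrite Rintegral_mkcond; apply: eq_Rintegral => p _.
  rewrite patchE; case: ifPn => // /negP pn.
  rewrite /pairing extend_out ?mul0r ?mulr0 ?f0 // leNgt; apply/negP => p0.
  by apply: pn; rewrite inE.
by congr (_ +i* _); [exact: (E (@complex.Re R) erefl)|exact: (E (@complex.Im R) erefl)].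
Qed.

Lemma analytic_measurable h : analytic h ->
  Cmeas (fun p : MR * MR => extend h (p.1 +i* p.2)).
Proof.
move=> /analyticP ah; split.
  apply: (half_cont_measurable (F := fun x y => Re (extend h (x +i* y)))) => x y x0.
    by rewrite extend_out.
  by apply: Ccont_Re; apply: Cdiff_cont; exact: ah.
apply: (half_cont_measurable (F := fun x y => Im (extend h (x +i* y)))) => x y x0.
  by rewrite extend_out.
by apply: Ccont_Im; apply: Cdiff_cont; exact: ah.
Qed.

Lemma measurable_weight : measurable_fun setT (fun p : MR * MR => p.1 ^+ l).
Proof. by apply: measurable_funX; exact: measurable_fst. Qed.

Lemma density_measurable h : analytic h ->
  measurable_fun setT (density h : MR * MR -> R).
Proof.
move=> /analytic_measurable[m1 m2]; rewrite /density.
under eq_fun do rewrite sqr_normcE.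
apply: measurable_funM; first exact: measurable_weight.
by apply: measurable_funD; exact: measurable_funX.
Qed.

(** Analyticity makes the density measurable; as it is nonnegative, a finite squared norm amounts to
    integrability. *)
Lemma bergmanP h : bergman l h <->
  analytic h /\ area.-integrable setT (EFin \o density h).
Proof.
have pi0 : 0 < (pi^-1 : R) by rewrite invr_gt0 pi_gt0.
split=> -[ah fin]; split=> //.
  apply/integrableP; split; first by apply/measurable_EFinP; exact: density_measurable.
  under eq_integral do rewrite /= ger0_norm ?density_ge0 //.
  move: fin; rewrite bergman_sqnormE.
  have K (I : \bar R) : ((pi^-1)%:E * I < +oo -> I < +oo)%E.
    by case: I => [r _| |_]; rewrite ?ltry ?ltNyr // gt0_muley ?lte_fin.
  exact: K.
rewrite bergman_sqnormE lte_mul_pinfty ?lee_fin ?ltW //.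
exact: (integrable_lty measurableT fin).
Qed.

Lemma bergman_analytic h : bergman l h -> analytic h.
Proof. by case. Qed.

Lemma density_integrable h : bergman l h -> area.-integrable setT (EFin \o density h).
Proof. by move/bergmanP => []. Qed.

Lemma bergman_le h (g : R * R -> R) : analytic h -> area.-integrable setT (EFin \o g) ->
  (forall p, 0 < p.1 -> density h p <= g p) -> (forall p, 0 <= g p) -> bergman l h.
Proof.
move=> ah gi hg g0; apply/bergmanP; split => //.
apply: (le_integrable measurableT _ _ gi).
  by apply/measurable_EFinP; exact: density_measurable.
move=> p _ /=; rewrite lee_fin !ger0_norm ?density_ge0 //.
have [p0|/hg//] := lerP p.1 0.
by rewrite density_out.
Qed.

Definition sqn h : R := pi^-1 * \int[area]_p density h p.

Lemma sqn_ge0 h : 0 <= sqn h.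
Proof.
rewrite /sqn mulr_ge0 ?invr_ge0 ?pi_ge0 //; apply: Rintegral_ge0 => p _.
exact: density_ge0.
Qed.

(** Valid for every [h]: when the squared norm is infinite, [fine] makes both sides 0. *)
Lemma bergman_normE h : bergman_norm l h = Num.sqrt (sqn h).
Proof.
rewrite /bergman_norm bergman_sqnormE /sqn /Rintegral.
congr Num.sqrt; case: (integral _ _ _) => [r| |] //=.
  by rewrite gt0_muley ?lte_fin ?invr_gt0 ?pi_gt0 //= mulr0.
by rewrite gt0_muleNy ?lte_fin ?invr_gt0 ?pi_gt0 //= mulr0.
Qed.

Lemma bergman_norm_ge0 h : 0 <= bergman_norm l h.
Proof. exact: sqrtr_ge0. Qed.

Lemma bergman_norm_sqr h : bergman_norm l h ^+ 2 = sqn h.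
Proof. by rewrite bergman_normE sqr_sqrtr // sqn_ge0. Qed.

Lemma density_lin_le (c : R[i]) u v p :
  density (fun z => c * u z + v z) p <= 2 * normc c ^+ 2 * density u p + 2 * density v p.
Proof.
have [p0|p0] := lerP p.1 0; first by rewrite !density_out // !mulr0 addr0.
rewrite /density extend_lin; set U := extend u _; set V := extend v _.
have pl : 0 <= p.1 ^+ l by rewrite exprn_ge0 // ltW.
rewrite [X in _ <= X](_ : _ = p.1 ^+ l * (2 * (normc c * normc U) ^+ 2 + 2 * normc V ^+ 2)); last ring.
rewrite ler_wpM2l // -Normc.normcM.
have : normc (c * U + V) ^+ 2 <= (normc (c * U) + normc V) ^+ 2.
  by rewrite ler_sqr ?nnegrE ?addr_ge0 ?normc_ge0 // le_normcD.
have := sqr_ge0 (normc (c * U) - normc V).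
by move: (normc (c * U)) (normc V) (normc (c * U + V)) => a b e; rewrite sqrrB sqrrD; lra.
Qed.

Lemma bergman_lin (c : R[i]) u v : bergman l u -> bergman l v ->
  bergman l (fun z => c * u z + v z).
Proof.
move=> bu bv; have iu := density_integrable bu; have iv := density_integrable bv.
apply: (@bergman_le _ (fun p => (2 * normc c ^+ 2) * density u p + 2 * density v p)).
- by apply: analytic_lin; exact: bergman_analytic.
- exact: (integrableD measurableT (integrableZl measurableT _ iu) (integrableZl measurableT _ iv)).
- by move=> p _; exact: density_lin_le.
- by move=> p; rewrite addr_ge0 // mulr_ge0 ?density_ge0 // mulr_ge0 // exprn_ge0 // normc_ge0.
Qed.

Lemma bergman0 : bergman l (fun=> 0 : R[i]).
Proof.
apply: (@bergman_le _ (fun=> 0)).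
- by apply: (@analytic_of _ (fun=> 0)) => // z _; exact: Cdiff_cst.
- exact: integrable0.
- by move=> p p0; rewrite /density extend0 Normc.normc0 expr0n mulr0.
- by [].
Qed.

Lemma bergmanZ (c : R[i]) u : bergman l u -> bergman l (fun z => c * u z).
Proof.
move=> bu; have := bergman_lin c bu bergman0.
by congr (bergman l _); apply/funext => z; rewrite addr0.
Qed.

Lemma bergmanB u v : bergman l u -> bergman l v -> bergman l (fun z => u z - v z).
Proof.
move=> bu bv; have := bergman_lin (-1) bv bu.
by congr (bergman l _); apply/funext => z; rewrite mulN1r addrC.
Qed.

(** The weighted inequality |U| |V| <= (c / 2) |U|^2 + |V|^2 / (2 c), that is (c |U| - |V|)^2 >=
    0. *)
Lemma pairing_le u v (c : R) p : 0 < c ->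
  normc (pairing u v p) <= (c / 2) * density u p + (2 * c)^-1 * density v p.
Proof.
move=> c0; have [p0|p0] := lerP p.1 0.
  by rewrite /pairing !density_out // extend_out // mul0r !mulr0 addr0 Normc.normc0.
rewrite /pairing /density !Normc.normcM normcJ normc_real.
have pl : 0 <= p.1 ^+ l by rewrite exprn_ge0 // ltW.
rewrite ger0_norm //; set U := normc (extend u _); set V := normc (extend v _).
rewrite [X in _ <= X](_ : _ = p.1 ^+ l * (c / 2 * U ^+ 2 + (2 * c)^-1 * V ^+ 2)); last ring.
rewrite ler_wpM2l // -subr_ge0.
rewrite [X in _ <= X](_ : _ = (2 * c)^-1 * (c * U - V) ^+ 2).
  by rewrite mulr_ge0 ?sqr_ge0 // invr_ge0 mulr_ge0 // ltW.
by field; rewrite lt0r_neq0.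
Qed.

Lemma pairing_meas u v : analytic u -> analytic v -> Cmeas (pairing u v : MR * MR -> R[i]).
Proof.
move=> au av; apply: CmeasM; first by apply: Cmeas_real; exact: measurable_weight.
apply: CmeasM; first exact: analytic_measurable.
by apply: CmeasJ; exact: analytic_measurable.
Qed.

Lemma pairing_int u v : bergman l u -> bergman l v -> Cint area (pairing u v).
Proof.
move=> bu bv; have iu := density_integrable bu; have iv := density_integrable bv.
apply: (@Cint_le _ _ _ area _ (fun p => (1 / 2) * density u p + (2 * 1)^-1 * density v p)).
- by apply: pairing_meas; exact: bergman_analytic.
- exact: (integrableD measurableT (integrableZl measurableT _ iu) (integrableZl measurableT _ iv)).
- by move=> p; exact: pairing_le.
Qed.

Lemma inner_lin (c : R[i]) u v w : bergman l u -> bergman l v -> bergman l w ->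
  bergman_inner l (fun z => c * u z + v z) w = c * bergman_inner l u w + bergman_inner l v w.
Proof.
move=> bu bv bw; rewrite !bergman_innerE mulrCA -mulrDr; congr (_ * _).
rewrite -CI_scale; last exact: pairing_int.
rewrite -CID; [|by apply: Cint_scale; exact: pairing_int|exact: pairing_int].
by apply: eq_CI => p; rewrite /pairing extend_lin; ring.
Qed.

Lemma innerJ u v : bergman l u -> bergman l v ->
  bergman_inner l u v = (conjc (bergman_inner l v u)).
Proof.
move=> bu bv; rewrite !bergman_innerE conj_mul conj_real; congr (_ * _).
rewrite -CIJ; last exact: pairing_int.
by apply: eq_CI => p; rewrite /pairing !conj_mul conj_real conjK [_ * extend u _]mulrC.
Qed.

Lemma inner_linr (c : R[i]) u v w : bergman l u -> bergman l v -> bergman l w ->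
  bergman_inner l w (fun z => c * u z + v z) =
    (conjc c) * bergman_inner l w u + bergman_inner l w v.
Proof.
move=> bu bv bw; rewrite innerJ //; last exact: bergman_lin.
by rewrite inner_lin // conj_add conj_mul -!innerJ.
Qed.

Lemma innerZ (c : R[i]) u w : bergman l u -> bergman l w ->
  bergman_inner l (fun z => c * u z) w = c * bergman_inner l u w.
Proof.
move=> bu bw; have E := inner_lin c bu bergman0 bw.
have E0 : bergman_inner l (fun=> 0) w = 0.
  rewrite bergman_innerE; have -> : pairing (fun=> 0) w = fun=> 0.
    by apply/funext => p; rewrite /pairing extend0 mul0r mulr0.
  by rewrite /CI /= Rintegral_cst // mul0r mulr0.
have -> : (fun z => c * u z) = (fun z => c * u z + 0) by apply/funext => z; rewrite addr0.
by rewrite E E0 (addr0 (c * bergman_inner l u w)).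
Qed.

Lemma inner_self u : bergman l u -> bergman_inner l u u = (sqn u)%:C.
Proof.
move=> bu; rewrite bergman_innerE /sqn (rmorphM (real_complex R)); congr (_ * _).
have E p : pairing u u p = (density u p)%:C.
  rewrite /pairing /density; case: (extend u _) => x y /=; rewrite sqr_sqrtr ?addr_ge0 ?sqr_ge0 //.
  by apply/eqP; rewrite eq_complex /=; apply/andP; split; apply/eqP; ring.
by under eq_CI do rewrite E; rewrite /CI /= Rintegral_cst // mul0r.
Qed.

Lemma inner_le u v (c : R) : bergman l u -> bergman l v -> 0 < c ->
  normc (bergman_inner l u v) <= c * sqn u + c^-1 * sqn v.
Proof.
move=> bu bv c0; have iu := density_integrable bu; have iv := density_integrable bv.
have pi0 : 0 < (pi^-1 : R) by rewrite invr_gt0 pi_gt0.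
rewrite bergman_innerE Normc.normcM normc_real gtr0_norm //.
have zu := integrableZl measurableT (c / 2) iu; have zv := integrableZl measurableT (2 * c)^-1 iv.
have := CI_le (pairing_int bu bv) (integrableD measurableT zu zv) (fun p => pairing_le u v p c0).
rewrite RintegralD // !RintegralZl // => h.
rewrite /sqn; apply: le_trans (ler_wpM2l (ltW pi0) h) _; apply: eq_ler.
by move: (pi^-1 : R) => q; field; rewrite (lt0r_neq0 c0).
Qed.

(** A weak form of Cauchy-Schwarz that still gives continuity in u. It is [inner_le] with c the
    inverse of a number t slightly above the norm of u; the excess keeps t positive when that norm
    is 0. *)
Lemma inner_bound u v : bergman l u -> bergman l v ->
  normc (bergman_inner l u v) <= (1 + sqn v) * bergman_norm l u.
Proof.
move=> bu bv; have u0 := bergman_norm_ge0 u; have v0 := sqn_ge0 v.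
apply/ler_addgt0Pr => e e0.
pose t := bergman_norm l u + e / (1 + sqn v).
have e1 : 0 < e / (1 + sqn v) by rewrite divr_gt0 //; lra.
have t0 : 0 < t by rewrite /t; lra.
have ti : 0 < t^-1 by rewrite invr_gt0.
apply: le_trans (inner_le bu bv ti) _; rewrite invrK.
have h1 : t^-1 * sqn u <= t.
  have nt : bergman_norm l u <= t by rewrite /t lerDl ltW.
  by rewrite mulrC ler_pdivrMr // -bergman_norm_sqr expr2 ler_pM.
have h2 : (1 + sqn v) * t = (1 + sqn v) * bergman_norm l u + e.
  by rewrite /t mulrDr [_ * (e / _)]mulrC divfK //; apply: lt0r_neq0; lra.
rewrite -h2 (_ : (1 + sqn v) * t = t + t * sqn v); last ring.
by rewrite lerD2r.
Qed.

(** Polarization: [key] compares the squared norms of c v + u and of its image, and c = 1 and c = i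
    isolate the inner product. *)
Lemma isometry_inner (U : H -> H) :
  (forall h, bergman l h -> bergman l (U h) /\ sqn (U h) = sqn h) ->
  (forall c u v, U (fun z => c * u z + v z) = (fun z => c * U u z + U v z)) ->
  forall u v, bergman l u -> bergman l v ->
    bergman_inner l (U u) (U v) = bergman_inner l u v.
Proof.
move=> iso lin u v bu bv.
have [bUu nu] := iso _ bu; have [bUv nv] := iso _ bv.
have key (c : R[i]) : (conjc c) * bergman_inner l (U u) (U v) + c * bergman_inner l (U v) (U u) =
    (conjc c) * bergman_inner l u v + c * bergman_inner l v u.
  have bl := bergman_lin c bv bu.
  have [bUl nl] := iso _ bl.
  have E1 : bergman_inner l (U (fun z => c * v z + u z)) (U (fun z => c * v z + u z)) =
            bergman_inner l (fun z => c * v z + u z) (fun z => c * v z + u z).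
    by rewrite !inner_self // nl.
  move: E1; rewrite lin !(inner_lin, inner_linr) //; try exact: bergman_lin.
  rewrite !inner_self // nu nv => E1.
  exact: sesquilinear_cancel E1.
apply: (@polarization_cancel _ (0 +i* 1) _ _ (bergman_inner l (U v) (U u)) (bergman_inner l v u)).
- by apply/eqP => -[] /eqP; rewrite oner_eq0.
- by have := key 1; rewrite conjc1 !mul1r.
- by have := key (0 +i* 1); rewrite (_ : conjc (0 +i* 1) = - (0 +i* 1 : R[i])) //; apply/eqP; rewrite eq_complex /= oppr0 !eqxx.
Qed.
End BergmanSpace.

(** * Affine maps and inversion as substitutions in the plane *)

Section PlaneSubstitution.
Context {R : realType}.
Local Notation mu := (@lebesgue_measure R).
Local Notation area := (mu \x mu)%E.
Local Notation MR := (measurableTypeR R).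

Lemma plane_integral_affine (c1 c2 s b : R) (N : R * R -> R) : c1 ^+ 2 = 1 -> c2 ^+ 2 = 1 ->
  measurable_fun setT (N : MR * MR -> R) -> (forall p, 0 <= N p) ->
  (\int[area]_p (N (c1 * p.1 + s, c2 * p.2 + b)%R)%:E = \int[area]_p (N p)%:E)%E.
Proof.
move=> e1 e2 mN N0.
have unit (c : R) : c ^+ 2 = 1 -> c != 0 /\ `|c| = 1.
  move=> cc; split; last by apply/eqP; rewrite -(@pexpr_eq1 _ _ 2) // real_normK ?num_real // cc.
  by apply/eqP => c0; move/eqP: cc; rewrite c0 expr0n eq_sym oner_eq0.
have [c10 nc1] := unit _ e1; have [c20 nc2] := unit _ e2.
have mNE : measurable_fun setT (EFin \o N : MR * MR -> \bar R) by exact/measurable_EFinP.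
have N0E p : (0 <= (EFin \o N) p)%E by rewrite /= lee_fin.
pose S (p : MR * MR) : MR * MR := (c1 * p.1 + s, c2 * p.2 + b).
have mS : measurable_fun setT S.
  apply: measurable_fun_pair.
    by apply: measurable_funD => //; apply: measurable_funM => //; exact: measurable_fst.
  by apply: measurable_funD => //; apply: measurable_funM => //; exact: measurable_snd.
have mNS : measurable_fun setT (EFin \o (N \o S)) by exact: (measurableT_comp mNE mS).
have := fubini_tonelli1 (m1 := mu) (m2 := mu) (EFin \o (N \o S)) mNS (fun p => N0E (S p)).
rewrite /fubini_F => E1.
transitivity (\int[area]_p (EFin \o (N \o S)) p)%E; first by [].
rewrite E1.
have := fubini_tonelli1 (m1 := mu) (m2 := mu) (EFin \o N) mNE N0E.
rewrite /fubini_F => E2.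
transitivity (\int[area]_p (EFin \o N) p)%E; last by [].
rewrite E2.
pose Phi x := (\int[mu]_y (EFin \o N) (x, y))%E.
have mPhi : measurable_fun [set: R] Phi by exact: (measurable_fun_fubini_tonelli_F (m2 := mu) (EFin \o N) mNE N0E).
have Phi0 x : (0 <= Phi x)%E by exact: integral_ge0.
transitivity (\int[mu]_x Phi (c1 * x + s)%R)%E.
  apply: eq_integral => x _.
  rewrite [RHS](@ge0_integral_affine R c2 b (fun y => (EFin \o N) (c1 * x + s, y)) c20).
  - by rewrite nc2 mul1e.
  - exact: (measurableT_comp mNE).
  - by move=> y; exact: N0E.
by have := @ge0_integral_affine R c1 s Phi c10 mPhi Phi0; rewrite nc1 mul1e => <-.
Qed.

Section inversion.
Variable N : R -> R -> R.
Hypothesis N0 : forall x y, 0 <= N x y.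
Hypothesis Nout : forall x y, x <= 0 -> N x y = 0.
Hypothesis cN : forall x y, 0 < x -> cont_at2 N x y.

Let mN : measurable_fun setT (fun p : MR * MR => N p.1 p.2).
Proof. exact: half_cont_measurable. Qed.

Let measN (f g : MR * MR -> R) : measurable_fun setT f -> measurable_fun setT g ->
  measurable_fun setT (fun p => N (f p) (g p)).
Proof.
move=> mf mg; exact: (measurableT_comp mN (measurable_fun_pair mf mg)).
Qed.

Let minv (f : MR * MR -> R) : measurable_fun setT f -> measurable_fun setT (fun p => (f p)^-1).
Proof.
move=> mf; apply: (measurableT_comp _ mf).
have m0 : measurable ([set 0] : set R) by exact: measurable_set1.
have -> : [set: R] = ~` [set 0] `|` [set 0] by rewrite setUC setUv.
apply/measurable_funU => //; first exact: measurableC.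
split; last exact: measurable_fun_set1.
apply: open_continuous_measurable_fun.
  rewrite openC; exact: closed_eq.
by move=> x; rewrite inE /= => /eqP x0; exact: inv_continuous.
Qed.

(** In the coordinates (x, t) with y = x t, the map z |-> 1 / z becomes (x, t) |-> (1 / ((1 + t^2)
    x), -t). [A] is the integrand in these coordinates, [A'] its transform under x |-> 1 / x, and
    [B] the transform of [A'] under scaling by 1 + t^2. *)
Let A x t := `|x| * N x (x * t).
Let A' x t := A x^-1 t * x ^- 2.
Let B x t := (1 + t ^+ 2) * A' ((1 + t ^+ 2) * x) t.

Let cA t x : 0 < x -> {for x, continuous (A ^~ t)}.
Proof.
move=> x0; apply: continuousM; first exact: norm_continuous.
apply/cvgrPdist_le => /= e e0; have [r r0 H] := cN (x * t) x0 e0.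
have M0 : 0 < `|t| + 1 by apply: ltr_wpDl.
apply/nbhs_ballP; exists (Num.min r (r / (`|t| + 1))) => /=; first by rewrite lt_min r0 divr_gt0.
move=> z; rewrite /ball /= lt_min => /andP[h1 h2].
rewrite distrC; apply: H; first by rewrite distrC.
rewrite -mulrBl normrM; move: h2; rewrite ltr_pdivlMr // distrC mulrDr mulr1.
by apply: le_lt_trans; rewrite lerDl.
Qed.

(** Four substitutions in one variable, linked by Tonelli: t = - y / x, scaling of x by 1 + t^2, x
    |-> 1 / x, and back through y = x t. *)
Lemma plane_integral_inversion :
  (\int[area]_p (((p.1 ^+ 2 + p.2 ^+ 2) ^- 2 *
      N (p.1 / (p.1 ^+ 2 + p.2 ^+ 2)) (- p.2 / (p.1 ^+ 2 + p.2 ^+ 2)))%R)%:E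
    = \int[area]_p (N p.1 p.2)%:E)%E.
Proof.
have m1 : measurable_fun setT (fun p : MR * MR => p.1 : R) by exact: measurable_fst.
have m2 : measurable_fun setT (fun p : MR * MR => p.2 : R) by exact: measurable_snd.
have mA : measurable_fun setT (fun p : MR * MR => (A p.1 p.2)%:E).
  apply/measurable_EFinP; apply: measurable_funM; first exact: (measurableT_comp (@normr_measurable R setT)).
  by apply: measN => //; exact: measurable_funM.
have mq : measurable_fun setT (fun p : MR * MR => 1 + p.2 ^+ 2).
  by apply: measurable_funD => //; exact: measurable_funX.
have mB : measurable_fun setT (fun p : MR * MR => (B p.1 p.2)%:E).
  apply/measurable_EFinP; apply: measurable_funM => //.
  have mqx : measurable_fun setT (fun p : MR * MR => ((1 + p.2 ^+ 2) * p.1)^-1).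
    by apply: minv; exact: measurable_funM.
  apply: measurable_funM; last first.
    by under eq_fun do rewrite -exprVn; exact: measurable_funX.
  apply: measurable_funM; first exact: (measurableT_comp (@normr_measurable R setT)).
  by apply: measN => //; exact: measurable_funM.
have mA' : measurable_fun setT (fun p : MR * MR => (A' p.1 p.2)%:E).
  have mx : measurable_fun setT (fun p : MR * MR => (p.1)^-1) by exact: minv.
  apply/measurable_EFinP; apply: measurable_funM; last first.
    by under eq_fun do rewrite -exprVn; exact: measurable_funX.
  apply: measurable_funM; first exact: (measurableT_comp (@normr_measurable R setT)).
  by apply: measN => //; exact: measurable_funM.
have mF : measurable_fun setT (fun p : MR * MR => ((p.1 ^+ 2 + p.2 ^+ 2) ^- 2 *
      N (p.1 / (p.1 ^+ 2 + p.2 ^+ 2)) (- p.2 / (p.1 ^+ 2 + p.2 ^+ 2)))%:E).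
  have mr : measurable_fun setT (fun p : MR * MR => (p.1 ^+ 2 + p.2 ^+ 2)^-1).
    by apply: minv; apply: measurable_funD; exact: measurable_funX.
  apply/measurable_EFinP; apply: measurable_funM.
    by under eq_fun do rewrite -exprVn; exact: measurable_funX.
  by apply: measN; apply: measurable_funM => //; exact: measurable_funN.
have q0 (t : R) : 0 < 1 + t ^+ 2 by rewrite ltr_pwDl // sqr_ge0.
have A0 x t : 0 <= A x t by rewrite mulr_ge0.
have A'0 x t : 0 <= A' x t by rewrite mulr_ge0 // invr_ge0 sqr_ge0.
have B0 x t : 0 <= B x t by rewrite mulr_ge0 // ltW.
have Aout x t : x <= 0 -> A x t = 0 by move=> x0; rewrite /A (Nout _ x0) mulr0.
have A'out x t : x <= 0 -> A' x t = 0 by move=> x0; rewrite /A' Aout ?mul0r // invr_le0.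
have Bout x t : x <= 0 -> B x t = 0.
  by move=> x0; rewrite /B A'out ?mulr0 // pmulr_rle0.
have F0 (x y : R) : 0 <= (x ^+ 2 + y ^+ 2) ^- 2 * N (x / (x ^+ 2 + y ^+ 2)) (- y / (x ^+ 2 + y ^+ 2)).
  by rewrite mulr_ge0 // invr_ge0 sqr_ge0.
have Fout (x y : R) : x <= 0 ->
    (x ^+ 2 + y ^+ 2) ^- 2 * N (x / (x ^+ 2 + y ^+ 2)) (- y / (x ^+ 2 + y ^+ 2)) = 0.
  move=> x0; have r0 : 0 <= (x ^+ 2 + y ^+ 2)^-1.
    by rewrite invr_ge0; apply: addr_ge0; exact: sqr_ge0.
  by rewrite (Nout _ (mulr_le0_ge0 x0 r0)) mulr0.
have E1 := fubini_tonelli1 (m1 := mu) (m2 := mu) _ mF (fun p => F0 p.1 p.2).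
have E2 := fubini_tonelli1 (m1 := mu) (m2 := mu) _ (proj2 (measurable_EFinP _ _) mN) (fun p => N0 p.1 p.2).
rewrite /fubini_F /= in E1 E2; rewrite E1 E2.
have EA := fubini_tonelli (m1 := mu) (m2 := mu) _ mA (fun p => A0 p.1 p.2).
have EB := fubini_tonelli (m1 := mu) (m2 := mu) _ mB (fun p => B0 p.1 p.2).
rewrite /= in EA EB.
have mR2 (f : MR * MR -> \bar R) x : measurable_fun setT f -> measurable_fun [set: R] (fun y => f (x, y)).
  by move=> mf; exact: (measurableT_comp mf).
have mR1 (f : MR * MR -> \bar R) y : measurable_fun setT f -> measurable_fun [set: R] (fun x => f (x, y)).
  by move=> mf; exact: (measurableT_comp mf).
transitivity (\int[mu]_x \int[mu]_t (B x t)%:E)%E.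
  apply: eq_integral => x _; have [x0|x0] := lerP x 0.
    transitivity (0 : \bar R)%E; last first.
      by apply/esym; apply: integral0_eq => t _; rewrite Bout.
    by apply: integral0_eq => y _; rewrite Fout.
  have xi : - x^-1 != 0 by rewrite oppr_eq0 invr_eq0 lt0r_neq0.
  have mBx := mR2 _ x mB; rewrite /= in mBx.
  rewrite (@ge0_integral_affine R (- x^-1) 0 (fun t => (B x t)%:E) xi mBx); last first.
    by move=> t; rewrite lee_fin.
  rewrite -ge0_integralZl; last 4 first.
  - exact: measurableT.
  - by apply: (measurableT_comp mBx); apply: measurable_funD => //; exact: measurable_funM.
  - by move=> t _; rewrite lee_fin.
  - by rewrite lee_fin.
  apply: eq_integral => y _; rewrite -EFinM; congr EFin.
  have r0 : 0 < x ^+ 2 + y ^+ 2 by apply: ltr_pwDl; rewrite ?exprn_gt0 ?sqr_ge0.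
  rewrite /B /A' /A addr0.
  have -> : 1 + (- x^-1 * y) ^+ 2 = (x ^+ 2 + y ^+ 2) / x ^+ 2 by field; rewrite lt0r_neq0.
  set r := x ^+ 2 + y ^+ 2 in r0 *.
  have -> : (r / x ^+ 2 * x)^-1 = x / r by field; rewrite !lt0r_neq0.
  have -> : (r / x ^+ 2 * x) ^- 2 = (x / r) ^+ 2 by field; rewrite !lt0r_neq0.
  have -> : x / r * (- x^-1 * y) = - y / r by field; rewrite !lt0r_neq0.
  have xr0 : 0 < x / r by rewrite divr_gt0.
  rewrite normrN normfV (gtr0_norm x0) (gtr0_norm xr0).
  by field; rewrite !lt0r_neq0.
rewrite EB.
transitivity (\int[mu]_t \int[mu]_x (A x t)%:E)%E.
  apply: eq_integral => t _.
  have qn : 1 + t ^+ 2 != 0 by rewrite lt0r_neq0.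
  have mAt := mR1 _ t mA'; rewrite /= in mAt.
  transitivity (\int[mu]_x (A' x t)%:E)%E.
    rewrite [RHS](@ge0_integral_affine R (1 + t ^+ 2) 0 (fun x => (A' x t)%:E) qn mAt); last first.
      by move=> x; rewrite lee_fin.
    rewrite (gtr0_norm (q0 t)) -ge0_integralZl.
    - by apply: eq_integral => x _; rewrite addr0 -EFinM.
    - exact: measurableT.
    - by apply: (measurableT_comp mAt); apply: measurable_funD => //; exact: measurable_funM.
    - by move=> x _; rewrite lee_fin.
    - by rewrite lee_fin ltW.
  have red (f : R -> R) : (forall x, x <= 0 -> f x = 0) ->
      (\int[mu]_x (f x)%:E = \int[mu]_(x in `]0%R, +oo[) (f x)%:E)%E.
    move=> f0; rewrite [RHS]integral_mkcond; apply: eq_integral => x _.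
    rewrite patchE; case: ifPn => [//|]; rewrite notin_setE /= in_itv /= andbT => /negP.
    by rewrite -leNgt => /f0 ->.
  rewrite (red (fun x => A x t)); last by move=> x; exact: Aout.
  rewrite (red (fun x => A' x t)); last by move=> x; exact: A'out.
  by rewrite (@ge0_integral_invr R (fun x => A x t)); [by []|exact: cA|by move=> x; exact: A0].
rewrite -EA; apply: eq_integral => x _; have [x0|x0] := lerP x 0.
  transitivity (0 : \bar R)%E; first by apply: integral0_eq => t _; rewrite Aout.
  by apply/esym; apply: integral0_eq => y _; rewrite Nout.
have xn : x != 0 by rewrite lt0r_neq0.
have mNx := mR2 _ x (proj2 (measurable_EFinP _ _) mN); rewrite /= in mNx.
rewrite [RHS](@ge0_integral_affine R x 0 (fun y => (N x y)%:E) xn mNx); last first.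
  by move=> y; rewrite lee_fin.
rewrite -ge0_integralZl.
- by apply: eq_integral => y _; rewrite addr0 -EFinM.
- exact: measurableT.
- by apply: (measurableT_comp mNx); apply: measurable_funD => //; exact: measurable_funM.
- by move=> y _; rewrite lee_fin.
- by rewrite lee_fin.
Qed.
End inversion.
End PlaneSubstitution.

Lemma Cdiff_conj (R : realType) (F : R[i] -> R[i]) (z : R[i]) : Cdiff F (conjc z) ->
  Cdiff (fun w => conjc (F (conjc w))) z.
Proof.
move=> [d Hd]; exists (conjc d) => e /Hd[r r0 {}Hd]; exists r => // w wr.
have E : conjc w - conjc z = conjc (w - z) by rewrite (rmorphB (@conjc R)).
have := Hd (conjc w); rewrite E normcJ => /(_ wr).
rewrite -(normcJ (_ - _ - _)) !(rmorphB (@conjc R)) /= conj_mul; apply: le_trans.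
by rewrite (rmorphB (@conjc R)) /= !conjK.
Qed.

(** * Translations, reflection and inversion on the Bergman space *)

Section BergmanTransformations.
Context {R : realType} (l : nat).
Local Notation H := (rhp R -> R[i]).
Local Notation mu := (@lebesgue_measure R).
Local Notation area := (mu \x mu)%E.
Local Notation MR := (measurableTypeR R).
Implicit Types (h u v : H).

Definition transl (c : R[i]) h : H := fun z => extend h (val z + c).
(** Composition with 1 / z, weighted by the power (l + 2) / 2 of its derivative up to a unimodular
    constant, which makes it a unitary involution. *)
Definition inversion h : H := fun z => (val z ^+ (l + 2))^-1 * extend h (val z)^-1.

(* An isometry or contraction is recognised on the densities, up to a change of variables [S]. *)
Lemma bergman_transport h k (D : R * R -> R) : analytic k -> bergman l h ->
  (forall p, 0 <= D p) -> measurable_fun setT (D : MR * MR -> R) ->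
  (\int[area]_p (D p)%:E = \int[area]_p (density l h p)%:E)%E ->
  (forall p, density l k p <= D p) ->
  [/\ bergman l k, sqn l k <= sqn l h & (forall p, density l k p = D p) -> sqn l k = sqn l h].
Proof.
move=> ak /bergmanP[ah ih] D0 mD E kD.
have iD : area.-integrable setT (EFin \o D).
  apply/integrableP; split; first exact/measurable_EFinP.
  under eq_integral do rewrite /= ger0_norm //.
  rewrite E; exact: (integrable_lty measurableT ih).
have bk : bergman l k.
  by apply: (bergman_le ak iD) => // p _; exact: kD.
have ER : \int[area]_p D p = \int[area]_p density l h p by rewrite /Rintegral E.
split => //.
  rewrite /sqn ler_wpM2l ?invr_ge0 ?pi_ge0 // -ER.
  by apply: le_Rintegral => //; exact: density_integrable.
by move=> kE; rewrite /sqn -ER; congr (_ * _); apply: eq_Rintegral => p _.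
Qed.

Lemma measurable_density_affine h (c1 c2 s b : R) : analytic h ->
  measurable_fun setT (fun p : MR * MR => density l h (c1 * p.1 + s, c2 * p.2 + b)).
Proof.
move=> ah; apply: (measurableT_comp (density_measurable l ah)).
apply: measurable_fun_pair.
  by apply: measurable_funD => //; apply: measurable_funM => //; exact: measurable_fst.
by apply: measurable_funD => //; apply: measurable_funM => //; exact: measurable_snd.
Qed.

Lemma integral_density_affine h (c1 c2 s b : R) : c1 ^+ 2 = 1 -> c2 ^+ 2 = 1 -> analytic h ->
  (\int[area]_p (density l h (c1 * p.1 + s, c2 * p.2 + b)%R)%:E = \int[area]_p (density l h p)%:E)%E.
Proof.
move=> e1 e2 ah; apply: (plane_integral_affine s b e1 e2).
  exact: density_measurable.
exact: density_ge0.
Qed.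

Lemma density_affine_integrable h (c1 c2 s b : R) : c1 ^+ 2 = 1 -> c2 ^+ 2 = 1 -> bergman l h ->
  area.-integrable setT (EFin \o (fun p => density l h (c1 * p.1 + s, c2 * p.2 + b))).
Proof.
move=> e1 e2 bh; have ah := bergman_analytic bh.
apply/integrableP; split; first by apply/measurable_EFinP; exact: measurable_density_affine.
under eq_integral do rewrite /= ger0_norm ?density_ge0 //.
rewrite integral_density_affine //.
exact: (integrable_lty measurableT (density_integrable bh)).
Qed.

Lemma extend_transl c h z : 0 < Re z -> extend (transl c h) z = extend h (z + c).
Proof. by move=> z0; rewrite (extend_in _ z0). Qed.

Lemma analytic_transl c h : 0 <= Re c -> analytic h -> analytic (transl c h).
Proof.
move=> c0 /analyticP ah; apply: (@analytic_of _ (fun z => extend h (z + c))) => // z z0.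
apply: (@Cdiff_comp _ (extend h) (fun z => z + c)).
  by apply: CdiffD; [exact: Cdiff_id|exact: Cdiff_cst].
by apply: ah; rewrite Re_add ltr_pwDl.
Qed.

Lemma complex_add (x y s b : R) : (x +i* y) + (s +i* b) = (x + s) +i* (y + b).
Proof. by []. Qed.

(** The density of the translate at z is at most that of h at z + c, since x^l <= (x + Re c)^l, with
    equality when Re c = 0. *)
Lemma transl_bergman c h : 0 <= Re c -> bergman l h ->
  [/\ bergman l (transl c h), sqn l (transl c h) <= sqn l h &
      Re c = 0 -> sqn l (transl c h) = sqn l h].
Proof.
move=> c0 bh; have ah := bergman_analytic bh.
pose D (p : R * R) := density l h (1 * p.1 + Re c, 1 * p.2 + Im c).
have TD p : density l (transl c h) p <= D p.
  rewrite /D; have [p0|p0] := lerP p.1 0; first by rewrite density_out // density_ge0.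
  rewrite /density extend_transl //= !mul1r (_ : c = Re c +i* Im c); last by case: (c).
  rewrite complex_add /= ler_wpM2r ?exprn_ge0 ?normc_ge0 //.
  by apply: lerXn2r; rewrite ?nnegrE ?lerDl //; lra.
have [b1 b2 b3] := bergman_transport (analytic_transl c0 ah) bh (fun p => density_ge0 l h _)
  (measurable_density_affine 1 1 (Re c) (Im c) ah)
  (integral_density_affine (Re c) (Im c) (expr1n _ 2) (expr1n _ 2) ah) TD.
split => // cE; apply: b3 => p.
have [p0|p0] := lerP p.1 0; first by rewrite !density_out // cE addr0 mul1r.
rewrite /density extend_transl //= !mul1r cE addr0.
have -> // : (p.1 +i* p.2) + c = p.1 +i* (p.2 + Im c).
by move: cE; clear; case: c => c1 c2 /= ->; rewrite complex_add addr0.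
Qed.

Lemma transl_lin c (e : R[i]) u v : transl c (fun z => e * u z + v z) =
  (fun z => e * transl c u z + transl c v z).
Proof. by apply/funext => z; rewrite /transl extend_lin. Qed.

Lemma analytic_reflect (a : R) h : analytic h -> analytic (conj_a a h).
Proof.
move=> /analyticP ah.
apply: (@analytic_of _ (fun z => conjc (extend h (conjc z + (0 +i* a))))) => [z z0|z]; last first.
  by rewrite /conj_a -(extend_val h).
apply: (@Cdiff_conj _ (fun z => extend h (z + (0 +i* a)))).
apply: (@Cdiff_comp _ (extend h) (fun z => z + (0 +i* a))).
  by apply: CdiffD; [exact: Cdiff_id|exact: Cdiff_cst].
by apply: ah; rewrite Re_add Re_conjc /= addr0.
Qed.

Lemma extend_reflect (a : R) h (x y : R) : 0 < x ->
  extend (conj_a a h) (x +i* y) = conjc (extend h (x +i* (a - y))).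
Proof.
move=> x0; have z0 : 0 < Re (x +i* y) by [].
rewrite (extend_in _ z0) /conj_a -(extend_val h); congr (conjc (extend h _)).
by apply/eqP; rewrite eq_complex /= addr0 [- y + a]addrC !eqxx.
Qed.

Lemma reflect_bergman (a : R) h : bergman l h -> bergman l (conj_a a h).
Proof.
move=> bh; have ah := bergman_analytic bh.
have e1 : (1 : R) ^+ 2 = 1 by rewrite expr1n.
have e2 : (-1 : R) ^+ 2 = 1 by rewrite sqrrN expr1n.
have CD p : density l (conj_a a h) p <= density l h (1 * p.1 + 0, (-1) * p.2 + a).
  have [p0|p0] := lerP p.1 0; first by rewrite density_out // density_ge0.
  by rewrite /density extend_reflect //= normcJ addr0 mul1r mulN1r [- _ + a]addrC.
by have [] := bergman_transport (@analytic_reflect a h ah) bh (fun p => density_ge0 l h _)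
  (measurable_density_affine 1 (-1) 0 a ah) (integral_density_affine 0 a e1 e2 ah) CD.
Qed.

Lemma Ccont_weight z : Ccont (fun z : R[i] => (Re z ^+ l)%:C) z.
Proof.
have c1 : Ccont (fun z : R[i] => (Re z)%:C) z.
  move=> e e0; exists e => // w wz; apply: le_trans (ltW wz).
  by rewrite -(rmorphB (real_complex R)) normc_real -Re_opp -Re_add Re_le_normc.
elim: l => [|n IH].
  by move=> e e0; exists 1 => // w _; rewrite !expr0 subrr Normc.normc0 ltW.
have := CcontM c1 IH; apply: (Ccont_local ltr01) => w _.
by rewrite exprS (rmorphM (real_complex R)).
Qed.

(** Writing |h|^2 as h times its conjugate reduces this to continuity of complex products. *)
Lemma density_cont h x y : analytic h -> 0 < x -> cont_at2 (fun x y => density l h (x, y)) x y.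
Proof.
move=> /analyticP ah x0.
have c2 : Ccont (extend h) (x +i* y) by apply: Cdiff_cont; exact: ah.
have c3 : Ccont (fun z => conjc (extend h z)) (x +i* y).
  move=> e /c2[r r0 Hr]; exists r => // w /Hr.
  by rewrite -(rmorphB (@conjc R)) normcJ.
have := Ccont_Re (CcontM (Ccont_weight (x +i* y)) (CcontM c2 c3)).
move=> K e /K[r r0 {}K]; exists r => // x' y' h1 h2.
have E (a b : R) : density l h (a, b) =
    Re ((Re (a +i* b) ^+ l)%:C * (extend h (a +i* b) * conjc (extend h (a +i* b)))).
  by rewrite /density sqr_normcE /=; case: (extend h _) => p q /=; ring.
by rewrite !E; exact: K.
Qed.

Lemma ReV (z : R[i]) : Re z^-1 = Re z / normc z ^+ 2.
Proof. by rewrite sqr_normcE; case: z. Qed.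

Lemma complex_neq0 (z : R[i]) : 0 < Re z -> z != 0.
Proof. by move=> z0; apply: contraTneq z0 => ->; rewrite /= ltxx. Qed.

Lemma ReV_gt0 (z : R[i]) : 0 < Re z -> 0 < Re z^-1.
Proof.
move=> z0; rewrite ReV divr_gt0 // exprn_gt0 // normc_gt0; exact: complex_neq0.
Qed.

Lemma extend_inversion h z : 0 < Re z ->
  extend (inversion h) z = (z ^+ (l + 2))^-1 * extend h z^-1.
Proof. by move=> z0; rewrite (extend_in _ z0). Qed.

Lemma analytic_inversion h : analytic h -> analytic (inversion h).
Proof.
move=> /analyticP ah.
apply: (@analytic_of _ (fun z => (z ^+ (l + 2))^-1 * extend h z^-1)) => // z z0.
have zn := complex_neq0 z0.
apply: CdiffM.
  by apply: CdiffV; [rewrite expf_neq0|apply: CdiffX; exact: Cdiff_id].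
apply: (@Cdiff_comp _ (extend h) (fun z => z^-1)).
  by apply: (@CdiffV _ id) => //; exact: Cdiff_id.
by apply: ah; exact: ReV_gt0.
Qed.

(** The identity x^l |z|^(-2 (l + 2)) = |z|^-4 (x / |z|^2)^l splits the density into the Jacobian of
    1 / z and the weight at 1 / z. *)
Lemma inversion_bergman h : bergman l h ->
  bergman l (inversion h) /\ sqn l (inversion h) = sqn l h.
Proof.
move=> bh; have ah := bergman_analytic bh.
pose D (p : R * R) := (p.1 ^+ 2 + p.2 ^+ 2) ^- 2 *
  density l h (p.1 / (p.1 ^+ 2 + p.2 ^+ 2), - p.2 / (p.1 ^+ 2 + p.2 ^+ 2)).
have DE p : density l (inversion h) p = D p.
  case: p => x y; have [x0|x0] := lerP x 0.
    rewrite density_out // /D [density l h _]density_out ?mulr0 //=.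
    by rewrite mulr_le0_ge0 // invr_ge0 addr_ge0 // sqr_ge0.
  rewrite /D /density extend_inversion //=.
  rewrite Normc.normcM Normc.normcV normcX.
  have r0 : 0 < x ^+ 2 + y ^+ 2 by apply: ltr_pwDl; rewrite ?exprn_gt0 ?sqr_ge0.
  have nE : normc (x +i* y) ^+ 2 = x ^+ 2 + y ^+ 2 by rewrite sqr_normcE.
  have -> : (x +i* y)^-1 = (x / (x ^+ 2 + y ^+ 2)) +i* (- y / (x ^+ 2 + y ^+ 2)).
    by apply/eqP; rewrite eq_complex /= mulNr !eqxx.
  rewrite exprMn exprVn -exprM mulnC exprM nE expr_div_n exprD.
  by field; rewrite !lt0r_neq0 // exprn_gt0.
have D0 p : 0 <= D p by rewrite -DE density_ge0.
have mD : measurable_fun setT (D : MR * MR -> R).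
  rewrite (_ : D = density l (inversion h)); last by apply/funext => p; rewrite DE.
  by apply: density_measurable; exact: analytic_inversion.
have E : (\int[area]_p (D p)%:E = \int[area]_p (density l h p)%:E)%E.
  have -> : (\int[area]_p (density l h p)%:E = \int[area]_p (density l h (p.1, p.2))%:E)%E.
    by apply: eq_integral => -[x y].
  apply: (@plane_integral_inversion R (fun x y => density l h (x, y))).
  - by move=> x y; exact: density_ge0.
  - by move=> x y x0; exact: density_out.
  - by move=> x y x0; exact: density_cont.
have [b1 _ b3] := bergman_transport (analytic_inversion ah) bh D0 mD E (fun p => eq_ler (DE p)).
by split => //; exact: b3.
Qed.

Lemma inversion_lin (e : R[i]) u v : inversion (fun z => e * u z + v z) =
  (fun z => e * inversion u z + inversion v z).
Proof. by apply/funext => z; rewrite /inversion extend_lin; ring. Qed.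

Lemma inversionK h : inversion (inversion h) = h.
Proof.
apply/funext => z; rewrite /inversion.
have z0 := valP z.
rewrite extend_inversion; last exact: ReV_gt0.
rewrite invrK extend_val exprVn mulrA mulfV ?mul1r //.
by rewrite invr_eq0 expf_neq0 // complex_neq0.
Qed.

Lemma inversion_inner u v : bergman l u -> bergman l v ->
  bergman_inner l (inversion u) v = bergman_inner l u (inversion v).
Proof.
move=> bu bv; rewrite -{1}(inversionK v).
apply: (isometry_inner inversion_bergman) => //; first exact: inversion_lin.
exact: (inversion_bergman bv).1.
Qed.

Lemma transl_add c d h : 0 <= Re d -> transl d (transl c h) = transl (d + c) h.
Proof.
move=> d0; apply/funext => z; rewrite /transl extend_transl ?addrA //.
by rewrite Re_add; apply: ltr_pwDl => //; exact: valP z.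
Qed.

Lemma transl0 h : transl 0 h = h.
Proof. by apply/funext => z; rewrite /transl addr0 extend_val. Qed.

(** Vertical translations are isometries, and conj c = - c gives the inverse one. *)
Lemma transl_imag_inner c u v : Re c = 0 -> bergman l u -> bergman l v ->
  bergman_inner l (transl c u) v = bergman_inner l u (transl (conjc c) v).
Proof.
move=> c0 bu bv.
have cJ : c + conjc c = 0.
  by case: c c0 => x y /= ->; apply/eqP; rewrite eq_complex /= addr0 subrr !eqxx.
have c0' : 0 <= Re c by rewrite c0.
have d0 : 0 <= Re (conjc c) by rewrite Re_conjc c0.
have -> : bergman_inner l (transl c u) v = bergman_inner l (transl c u) (transl c (transl (conjc c) v)).
  by rewrite transl_add // cJ transl0.
apply: (@isometry_inner _ l (transl c)) => //.
- by move=> h bh; have [h1 h2 h3] := transl_bergman c0' bh; split => //; exact: h3.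
- by move=> e h k; exact: transl_lin.
- by have [] := transl_bergman d0 bv.
Qed.
End BergmanTransformations.

(** * Adjoints of translations, by Cauchy's theorem along vertical lines *)

Section VerticalLines.
Context {R : realType} (l : nat).
Local Notation H := (rhp R -> R[i]).
Local Notation mu := (@lebesgue_measure R).
Local Notation area := (mu \x mu)%E.
Local Notation MR := (measurableTypeR R).
Implicit Types (h u v : H).

Definition square_int (F : R -> R[i]) :=
  Cmeas (F : MR -> R[i]) /\ mu.-integrable setT (EFin \o (fun y => normc (F y) ^+ 2)).

Lemma square_intM F G : square_int F -> square_int G -> Cint mu (fun y => F y * G y).
Proof.
move=> [mF iF] [mG iG].
apply: (@Cint_le _ _ _ mu _ (fun y => normc (F y) ^+ 2 + normc (G y) ^+ 2)).
- exact: CmeasM.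
- exact: (integrableD measurableT iF iG).
- move=> y; rewrite Normc.normcM.
  have := sqr_ge0 (normc (F y) - normc (G y)); rewrite sqrrB.
  have := mulr_ge0 (normc_ge0 (F y)) (normc_ge0 (G y)); lra.
Qed.

Lemma square_intJ F : square_int F -> square_int (fun y => conjc (F y)).
Proof.
by move=> [mF iF]; split; [exact: CmeasJ|under eq_fun do rewrite normcJ].
Qed.

Lemma line_meas h x : analytic h -> Cmeas (fun y : MR => extend h (x +i* y)).
Proof.
move=> /analytic_measurable[m1 m2].
by split; [exact: (measurable_fun_pair2 x m1)|exact: (measurable_fun_pair2 x m2)].
Qed.

(** Fubini for the density: on a line with x > 0 the weight is a nonzero constant. *)
Lemma ae_square_int h : bergman l h ->
  {ae mu, forall x : MR, 0 < (x : R) -> square_int (fun y => extend h (x +i* y))}.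
Proof.
move=> bh; have := ae_integrable1 (density_integrable bh).
apply: filterS => x /= hi x0; split; first by apply: line_meas; exact: (bergman_analytic bh).
have := integrableZl measurableT (x ^- l) hi; apply: eq_integrable => // y _.
rewrite /= /density /= -EFinM; congr EFin.
by rewrite mulrA mulVf ?mul1r // expf_neq0 // lt0r_neq0.
Qed.

Lemma normc_sqr_le_density h (t x y : R) : 0 < t -> t <= x ->
  normc (extend h (x +i* y)) ^+ 2 <= t ^- l * density l h (x, y).
Proof.
move=> t0 tx; rewrite /density /= mulrA -[leLHS]mul1r ler_wpM2r ?sqr_ge0 //.
rewrite mulrC ler_pdivlMr ?exprn_gt0 // mul1r.
by apply: lerXn2r; rewrite ?nnegrE; lra.
Qed.

Lemma pairing_out u v x y : x <= 0 -> pairing l u v (x, y) = 0.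
Proof. by move=> x0; rewrite /pairing extend_out // mul0r mulr0. Qed.

(** Cauchy's theorem for F(z) = u(z + x) conj(v(x + s - conj z)), analytic on 0 <= Re z <= s: its
    values on the two boundary lines are the two integrands. *)
Lemma transl_line_inner (s x : R) u v : 0 <= s -> 0 < x -> bergman l u -> bergman l v ->
  square_int (fun y => extend u (x +i* y)) -> square_int (fun y => extend v (x +i* y)) ->
  square_int (fun y => extend u ((x + s) +i* y)) -> square_int (fun y => extend v ((x + s) +i* y)) ->
  CI mu (fun y => extend u ((x + s) +i* y) * conjc (extend v (x +i* y))) =
  CI mu (fun y => extend u (x +i* y) * conjc (extend v ((x + s) +i* y))).
Proof.
move=> s0 x0 bu bv ux vx us vs.
have /analyticP au := bergman_analytic bu; have /analyticP av := bergman_analytic bv.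
pose F (z : R[i]) := extend u (z + x%:C) * conjc (extend v (conjc (- z) + (x + s)%:C)).
have FE (t y : R) : F (t +i* y) = extend u ((x + t) +i* y) * conjc (extend v ((x + s - t) +i* y)).
  congr (extend u _ * conjc (extend v _)); apply/eqP; rewrite eq_complex /=.
    by rewrite addr0 [t + x]addrC !eqxx.
  by rewrite opprK addr0 [- t + _]addrC !eqxx.
have dF (z : R[i]) : 0 <= Re z <= s -> Cdiff F z.
  move=> /andP[z0 zs]; apply: CdiffM.
    apply: (@Cdiff_comp _ (extend u) (fun z => z + x%:C)).
      by apply: CdiffD; [exact: Cdiff_id|exact: Cdiff_cst].
    by apply: au; rewrite Re_add /=; lra.
  have E : (fun w => conjc (extend v (conjc (- w) + (x + s)%:C))) =
           (fun w => conjc (extend v ((-1) * conjc w + (x + s)%:C))).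
    by apply/funext => w; rewrite (rmorphN (@conjc R)) mulN1r.
  rewrite E.
  apply: (@Cdiff_conj _ (fun w => extend v ((-1) * w + (x + s)%:C))).
  apply: (@Cdiff_comp _ (extend v) (fun w => (-1) * w + (x + s)%:C)).
    by apply: CdiffD; [apply: CdiffM; [exact: Cdiff_cst|exact: Cdiff_id]|exact: Cdiff_cst].
  by apply: av; rewrite mulN1r Re_add Re_opp Re_conjc /=; lra.
have e1 : (1 : R) ^+ 2 = 1 by rewrite expr1n.
have e2 : (-1 : R) ^+ 2 = 1 by rewrite sqrrN expr1n.
have E0 : (fun y => F (0 +i* y)) = (fun y => extend u (x +i* y) * conjc (extend v ((x + s) +i* y))).
  by apply/funext => y; rewrite FE addr0 subr0.
have Es : (fun y => F (s +i* y)) = (fun y => extend u ((x + s) +i* y) * conjc (extend v (x +i* y))).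
  by apply/funext => y; rewrite FE addrK.
(* F is differentiable on the whole strip, so the exceptional point is an arbitrary one. The
   majorant is a sum of shifted and reflected densities; x + t and x + s - t stay above x, which
   bounds the weight from below. *)
have := @CI_strip_shift R F 0 s (0 +i* 0)
  (fun p => x ^- l * density l u (1 * p.1 + x, 1 * p.2 + 0) + x ^- l * density l v ((-1) * p.1 + (x + s), 1 * p.2 + 0)).
rewrite E0 Es => <- //.
- by rewrite lexx.
- by move=> z zs; apply: Cdiff_cont; exact: dF.
- by move=> z zs _; exact: dF.
- by apply: square_intM => //; exact: square_intJ.
- by apply: square_intM => //; exact: square_intJ.
- exact: (integrableD measurableT (integrableZl measurableT (x ^- l) (density_affine_integrable x 0 e1 e1 bu))
   (integrableZl measurableT (x ^- l) (density_affine_integrable (x + s) 0 e2 e1 bv))).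
- by move=> p; rewrite addr_ge0 // mulr_ge0 ?density_ge0 // invr_ge0 exprn_ge0 // ltW.
- move=> t y /andP[t0 ts]; rewrite FE Normc.normcM normcJ /= !mul1r mulN1r addr0 [t + x]addrC [- t + _]addrC.
  have h1 : x <= x + t by lra.
  have h2 : x <= x + s - t by lra.
  have := normc_sqr_le_density u y x0 h1; have := normc_sqr_le_density v y x0 h2.
  have := sqr_ge0 (normc (extend u ((x + t) +i* y)) - normc (extend v ((x + s - t) +i* y))).
  have := mulr_ge0 (normc_ge0 (extend u ((x + t) +i* y))) (normc_ge0 (extend v ((x + s - t) +i* y))).
  rewrite sqrrB; lra.
Qed.

(** Slice the plane by vertical lines: on almost every one the functions and their translates are
    square integrable, and [transl_line_inner] applies. *)
Lemma transl_real_inner (s : R) u v : 0 <= s -> bergman l u -> bergman l v ->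
  bergman_inner l (transl s%:C u) v = bergman_inner l u (transl s%:C v).
Proof.
move=> s0 bu bv.
have sC : 0 <= Re s%:C by [].
have [bTu _ _] := transl_bergman sC bu; have [bTv _ _] := transl_bergman sC bv.
rewrite !bergman_innerE; congr (_ * _).
have [iu ->] := CI_fubini1 (pairing_int bTu bv).
have [iv ->] := CI_fubini1 (pairing_int bu bTv).
apply: CI_ae => //.
have ET h x y : 0 < x -> extend (transl s%:C h) (x +i* y) = extend h ((x + s) +i* y).
  by move=> x0; rewrite extend_transl // complex_add addr0.
have aeI (P Q : MR -> Prop) : {ae mu, forall x, P x} -> {ae mu, forall x, Q x} ->
    {ae mu, forall x, P x /\ Q x}.
  by move=> hP hQ; apply: filterS2 hP hQ => x.
have := aeI _ _ (aeI _ _ (ae_square_int bu) (ae_square_int bv))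
                (aeI _ _ (ae_square_int bTu) (ae_square_int bTv)).
apply: filterS => x [[hu hv] [hTu hTv]] /=; have [x0|x0] := lerP x 0.
  by apply: eq_CI => y; rewrite !pairing_out.
have E (h k : H) y : pairing l h k (x, y) =
    (x ^+ l)%:C * (extend h (x +i* y) * conjc (extend k (x +i* y))) by [].
under eq_CI do rewrite E ET //.
under [RHS]eq_CI do rewrite E ET //.
have us : square_int (fun y => extend u ((x + s) +i* y)).
  by have := hTu x0; under eq_fun do rewrite ET //.
have vs : square_int (fun y => extend v ((x + s) +i* y)).
  by have := hTv x0; under eq_fun do rewrite ET //.
rewrite !CI_scale.
- by rewrite (transl_line_inner s0 x0 bu bv (hu x0) (hv x0) us vs).
- by apply: square_intM; [exact: hu|exact: square_intJ].
- by apply: square_intM => //; apply: square_intJ; exact: hv.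
Qed.

Lemma transl_inner (c : R[i]) u v : 0 <= Re c -> bergman l u -> bergman l v ->
  bergman_inner l (transl c u) v = bergman_inner l u (transl (conjc c) v).
Proof.
case: c => s b /= s0 bu bv.
have sC : 0 <= Re s%:C by [].
have i0 : Re (0 +i* b) = 0 by [].
have i0' : 0 <= Re (0 +i* b) by rewrite i0.
have j0' : 0 <= Re (conjc (0 +i* b)) by [].
have [b1 _ _] := transl_bergman i0' bu.
have [b2 _ _] := transl_bergman sC bv.
have -> : s +i* b = s%:C + (0 +i* b) by rewrite complex_add addr0 add0r.
rewrite -(transl_add (0 +i* b) u sC) (transl_real_inner s0 b1 bv) (transl_imag_inner i0 bu b2).
rewrite (transl_add s%:C v j0'); congr (bergman_inner l u (transl _ v)).
by apply/eqP; rewrite eq_complex /= !(add0r, addr0) !eqxx.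
Qed.
End VerticalLines.

(** * Complex-valued functions of a real variable *)

Section RealVariable.
Context {R : realType}.
Local Notation mu := (@lebesgue_measure R).
Local Notation area := (mu \x mu)%E.
Local Notation MR := (measurableTypeR R).

Lemma ae_exists_itv (P : MR -> Prop) (a b : R) : a < b -> {ae mu, forall x, P x} ->
  exists2 x, a < x < b & P x.
Proof.
move=> ab [N [mN N0 PN]]; apply: contrapT => noP.
have sub : `]a, b[ `<=` N.
  move=> x /=; rewrite in_itv /= => xab; apply: PN => /= Px.
  by apply: noP; exists x.
have : (mu (`]a, b[%classic) <= mu N)%E by apply: le_measure => //; rewrite inE.
rewrite [mu N]N0 lebesgue_measure_itv /= lte_fin ab -EFinB lee_fin; lra.
Qed.

Lemma integrable_prod (f g : R -> R) : (forall x, 0 <= f x) -> (forall x, 0 <= g x) ->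
  mu.-integrable setT (EFin \o f) -> mu.-integrable setT (EFin \o g) ->
  area.-integrable setT (EFin \o (fun p => f p.1 * g p.2)).
Proof.
move=> f0 g0 fi gi.
have mf := measurable_int _ fi; have mg := measurable_int _ gi.
move/measurable_EFinP in mf; move/measurable_EFinP in mg.
have mfg : measurable_fun setT (EFin \o (fun p : MR * MR => f p.1 * g p.2)).
  apply/measurable_EFinP; apply: measurable_funM.
    exact: (measurableT_comp mf (@measurable_fst _ _ MR MR)).
  exact: (measurableT_comp mg (@measurable_snd _ _ MR MR)).
apply/(integrable12ltyP mu mu mfg).
pose J := (\int[mu]_y (g y)%:E)%E.
have Jfin : J \is a fin_num by exact: (integrable_fin_num measurableT gi).
have J0 : (0 <= J)%E by apply: integral_ge0 => y _; rewrite lee_fin.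
have E : (\int[mu]_x \int[mu]_y `|(EFin \o (fun p : MR * MR => (f p.1 * g p.2)%R)) (x, y)| =
    \int[mu]_x (J * (f x)%:E))%E.
  apply: eq_integral => x _; rewrite muleC -ge0_integralZl.
  - by apply: eq_integral => y _ /=; rewrite ger0_norm ?mulr_ge0.
  - exact: measurableT.
  - exact/measurable_EFinP.
  - by move=> y _; rewrite lee_fin.
  - by rewrite lee_fin.
rewrite E ge0_integralZl; last 4 first.
- exact: measurableT.
- exact/measurable_EFinP.
- by move=> x _; rewrite lee_fin.
- exact: J0.
by apply: lte_mul_pinfty => //; exact: (integrable_lty measurableT fi).
Qed.

Definition Cderiv (F : R -> R[i]) x d := forall e : R, 0 < e ->
  exists2 r : R, 0 < r & forall y, `|y - x| < r ->
    normc (F y - F x - d * (y - x)%:C) <= e * `|y - x|.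

Lemma Cderiv_cont F x d : Cderiv F x d -> forall e : R, 0 < e ->
  exists2 r : R, 0 < r & forall y, `|y - x| < r -> normc (F y - F x) <= e.
Proof.
move=> /(_ 1 ltr01)[r r0 H] e e0.
have M0 : 0 < normc d + 1 by apply: ltr_wpDl => //; exact: normc_ge0.
exists (Num.min r (e / (normc d + 1))); first by rewrite lt_min r0 divr_gt0.
move=> w; rewrite lt_min => /andP[wr we].
have {}H := H w wr.
have -> : F w - F x = (F w - F x - d * (w - x)%:C) + d * (w - x)%:C by rewrite subrK.
apply: le_trans (le_normcD _ _) _.
rewrite Normc.normcM normc_real.
move: we; rewrite ltr_pdivlMr // mulrDr mulr1 [_ * normc d]mulrC.
by move: H; rewrite mul1r; lra.
Qed.

Lemma CderivM F G x dF dG : Cderiv F x dF -> Cderiv G x dG ->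
  Cderiv (fun y => F y * G y) x (dF * G x + F x * dG).
Proof.
move=> hF hG e e0.
pose M := normc (F x) + normc (G x) + normc dF + 1.
have M0 : 0 < M.
  by rewrite /M; have := normc_ge0 (F x); have := normc_ge0 (G x); have := normc_ge0 dF; lra.
pose eta := Num.min 1 (e / M).
have eta0 : 0 < eta by rewrite lt_min ltr01 divr_gt0.
have eta1 : eta <= 1 by rewrite ge_min lexx.
have etae : eta * M <= e by rewrite -ler_pdivlMr // ge_min lexx orbT.
have [r1 r10 {}hF] := hF _ eta0; have [r3 r30 hc] := Cderiv_cont hG eta0.
have [r2 r20 {}hG] := hG _ eta0.
exists (Num.min r1 (Num.min r2 r3)) => [|y]; first by rewrite !lt_min r10 r20.
rewrite !lt_min => /and3P[/hF {}hF /hG {}hG /hc {}hc].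
set h := (y - x)%:C.
have nh : normc h = `|y - x| by rewrite normc_real.
have -> : F y * G y - F x * G x - (dF * G x + F x * dG) * h =
  (F y - F x - dF * h) * G y + F x * (G y - G x - dG * h) + dF * h * (G y - G x) by ring.
have Gy : normc (G y) <= normc (G x) + eta.
  by rewrite -[G y](subrK (G x)) addrC; apply: le_trans (le_normcD _ _) _; rewrite lerD2l.
have t1 : normc ((F y - F x - dF * h) * G y) <= eta * `|y - x| * (normc (G x) + 1).
  by rewrite Normc.normcM; apply: ler_pM; rewrite ?normc_ge0 //; lra.
have t2 : normc (F x * (G y - G x - dG * h)) <= normc (F x) * (eta * `|y - x|).
  by rewrite Normc.normcM; apply: ler_wpM2l => //; exact: normc_ge0.
have t3 : normc (dF * h * (G y - G x)) <= normc dF * `|y - x| * eta.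
  rewrite !Normc.normcM nh; apply: ler_wpM2l => //.
  by apply: mulr_ge0 => //; exact: normc_ge0.
apply: le_trans (le_normcD _ _) _.
apply: le_trans (lerD (le_trans (le_normcD _ _) (lerD t1 t2)) t3) _.
rewrite (_ : _ + _ = eta * M * `|y - x|); first by rewrite ler_wpM2r.
by rewrite /M; ring.
Qed.

Lemma Cderiv_scale c F x d : Cderiv F x d -> Cderiv (fun y => c * F y) x (c * d).
Proof.
move=> H e e0; have M0 : 0 < normc c + 1 by apply: ltr_wpDl => //; exact: normc_ge0.
have [r r0 {}H] := H _ (divr_gt0 e0 M0); exists r => // y /H {}H.
have -> : c * F y - c * F x - c * d * (y - x)%:C = c * (F y - F x - d * (y - x)%:C) by ring.
rewrite Normc.normcM; apply: le_trans (ler_wpM2l (normc_ge0 c) H) _.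
rewrite mulrA ler_wpM2r // mulrA ler_pdivrMr // mulrC ler_pM2l //.
by rewrite lerDl.
Qed.

Lemma CderivX F n x d : Cderiv F x d ->
  Cderiv (fun y => F y ^+ n.+1) x (n.+1%:R * F x ^+ n * d).
Proof.
move=> hF; elim: n => [|n IH].
  by under [X in Cderiv X _ _]funext do rewrite expr1; rewrite expr0 !mul1r.
under [X in Cderiv X _ _]funext do rewrite exprS.
have := CderivM hF IH; congr Cderiv.
by rewrite -[in RHS]natr1 !exprS; ring.
Qed.

(** The remainder is exactly - 2 A (y - x)^2 / ((A + 2 y) (A + 2 x)^2), and each factor of the
    denominator has modulus at least Re A / 2 as soon as y >= - Re A / 4. *)
Lemma Cderiv_ratio (A : R[i]) (x : R) : 0 < Re A -> 0 <= x ->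
  Cderiv (fun y => y%:C / (A + 2 * y%:C)) x (A / (A + 2 * x%:C) ^+ 2).
Proof.
move=> A0 x0 e e0.
have cN (y : R) : - (Re A / 4) <= y -> Re A / 2 <= normc (A + 2 * y%:C).
  move=> y0; apply: le_trans (Re_le_normc _); apply: le_trans (ler_norm _).
  rewrite Re_add Re_mul /= addr0 mulr0 subr0; lra.
pose c := Re A / 2.
have c0 : 0 < c by rewrite /c divr_gt0.
pose K := 2 * normc A / c ^+ 3.
have K0 : 0 <= K by rewrite /K divr_ge0 ?mulr_ge0 ?normc_ge0 ?exprn_ge0 // ltW.
have K1 : 0 < K + 1 by lra.
exists (Num.min (Re A / 4) (e / (K + 1))) => [|y]; first by rewrite lt_min !divr_gt0.
rewrite lt_min => /andP[h1 h2].
have y0 : - (Re A / 4) <= y by move: h1; rewrite ltr_norml => /andP[h _]; lra.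
have ny := cN y y0; have nx := cN x ltac:(lra).
have yn : A + 2 * y%:C != 0 by rewrite -normc_gt0; apply: lt_le_trans ny.
have xn : A + 2 * x%:C != 0 by rewrite -normc_gt0; apply: lt_le_trans nx.
have -> : y%:C / (A + 2 * y%:C) - x%:C / (A + 2 * x%:C) - A / (A + 2 * x%:C) ^+ 2 * (y - x)%:C =
    - (2 * A) * (y - x)%:C ^+ 2 / ((A + 2 * y%:C) * (A + 2 * x%:C) ^+ 2).
  by rewrite (rmorphB (real_complex R)) /=; field; rewrite yn xn.
rewrite !(normcX, Normc.normcM, Normc.normcV, normcN, normc_real).
have n2 : normc (2 : R[i]) = 2 by rewrite (_ : 2 = (2 : R)%:C) ?normc_real ?ger0_norm //; exact: (esym (rmorph_nat (real_complex R) 2)).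
rewrite n2 expr2.
have D0 : 0 < normc (A + 2 * y%:C) * normc (A + 2 * x%:C) ^+ 2.
  by rewrite mulr_gt0 ?exprn_gt0 ?normc_gt0.
have cD : c ^+ 3 <= normc (A + 2 * y%:C) * normc (A + 2 * x%:C) ^+ 2.
  rewrite exprS; apply: ler_pM; [exact: ltW|by rewrite exprn_ge0 // ltW|exact: ny|].
  by apply: lerXn2r; rewrite ?nnegrE ?normc_ge0 // ltW.
apply: (@le_trans _ _ (2 * normc A * (`|y - x| * `|y - x|) / c ^+ 3)).
  apply: ler_wpM2l; first by rewrite !mulr_ge0 ?normc_ge0.
  by rewrite lef_pV2 // posrE // exprn_gt0.
rewrite (_ : _ / _ = K * `|y - x| * `|y - x|); last by rewrite /K; ring.
rewrite ler_wpM2r //.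
move: h2; rewrite ltr_pdivlMr // mulrDr mulr1 mulrC; have := normr_ge0 (y - x); lra.
Qed.

Lemma real_derivative (f : R -> R) (x d : R) :
  (forall e, 0 < e -> exists2 r, 0 < r & forall y, `|y - x| < r ->
     `|f y - f x - d * (y - x)| <= e * `|y - x|) ->
  derivable f x 1 /\ derive1 f x = d.
Proof.
move=> H.
have c : (fun h => h^-1 *: (f (h *: 1 + x) - f x)) @ 0^' --> d.
  apply/cvgrPdist_le => /= e e0; have [r r0 {}H] := H _ e0.
  apply/nbhs_ballP; exists r => //= h; rewrite /ball /= sub0r normrN => hr h0.
  rewrite /GRing.scale /= mulr1.
  have := H (h + x); rewrite addrK => /(_ hr) {}H.
  rewrite -(@ler_pM2r _ `|h|) ?normr_gt0 // -normrM.
  rewrite (le_trans _ H) // -normrN; apply: eq_ler; congr `|_|.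
  by rewrite mulrBl mulrAC mulVf // mul1r opprB.
split; first by apply/cvg_ex; exists d.
by rewrite derive1E; apply: cvg_lim.
Qed.

Lemma Cdiff_Cderiv (F : R[i] -> R[i]) (x : R) : Cdiff F x%:C ->
  exists d, Cderiv (fun y => F y%:C) x d.
Proof.
move=> [d H]; exists d => e /H[r r0 {}H]; exists r => // y yr.
have E : y%:C - x%:C = (y - x)%:C by rewrite (rmorphB (real_complex R)).
by have := H y%:C; rewrite E normc_real; apply.
Qed.

Lemma Cderiv_part_continuous (part : R[i] -> R) (G : R -> R[i]) (x : R) d :
  (forall z w, part (z - w) = part z - part w) -> (forall z, `|part z| <= normc z) ->
  Cderiv G x d -> {for x, continuous (fun x => part (G x))}.
Proof.
move=> pB pn /Cderiv_cont cG; apply/cvgrPdist_le => /= e /cG[r r0 {}cG].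
apply/nbhs_ballP; exists r => //= y; rewrite /ball /= distrC => /cG {}cG.
by rewrite distrC -pB; apply: le_trans cG.
Qed.

Lemma CFTC (F f : R -> R[i]) (a b : R) : a < b ->
  (forall x, a <= x <= b -> Cderiv F x (f x)) ->
  (forall x, a <= x <= b -> exists d, Cderiv f x d) ->
  seg a b (fun x => Re (f x)) +i* seg a b (fun x => Im (f x)) = F b - F a.
Proof.
move=> ab dF df.
have K (part : R[i] -> R) : (forall z w, part (z - w) = part z - part w) ->
    (forall z (t : R), part (z * t%:C) = part z * t) -> (forall z, `|part z| <= normc z) ->
    seg a b (fun x => part (f x)) = part (F b) - part (F a).
  move=> pB pM pn.
  have pcont (G : R -> R[i]) x d := @Cderiv_part_continuous part G x d pB pn.
  have pder x : a <= x <= b -> derivable (fun x => part (F x)) x 1 /\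
      derive1 (fun x => part (F x)) x = part (f x).
    move=> xab; apply: real_derivative => e e0; have [r r0 H] := dF x xab e e0.
    exists r => // y /H {}H; rewrite -pM -!pB; exact: le_trans (pn _) H.
  have cF x : a <= x <= b -> {for x, continuous (fun x => part (F x))}.
    by move=> xab; exact: pcont (dF x xab).
  have ab1 : a <= a <= b by rewrite lexx ltW.
  have ab2 : a <= b <= b by rewrite lexx ltW.
  have cf x : a <= x <= b -> {for x, continuous (fun x => part (f x))}.
    by move=> /df[d hd]; exact: pcont hd.
  rewrite /seg /Rintegral (@continuous_FTC2 R _ (fun x => part (F x))) //.
  - apply: continuous_in_subspaceT => x; rewrite inE /= in_itv /=; exact: cf.
  - split.
    + move=> x; rewrite in_itv /= => /andP[ax xb].
      by have [] := pder x ltac:(by rewrite !ltW).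
    + by apply: cvg_at_right_filter; exact: cF.
    + by apply: cvg_at_left_filter; exact: cF.
  - move=> x; rewrite in_itv /= => /andP[ax xb].
    by have [] := pder x ltac:(by rewrite !ltW).
rewrite (K (@complex.Re R)) ?(K (@complex.Im R)).
- by case: (F b) => p q; case: (F a).
- by move=> z w; rewrite Im_add Im_opp.
- by move=> z t; rewrite Im_mul /= mulr0 add0r.
- exact: Im_le_normc.
- by move=> z w; rewrite Re_add Re_opp.
- by move=> z t; rewrite Re_mul /= mulr0 subr0.
- exact: Re_le_normc.
Qed.

(** Only existence of the derivative matters: it gives the continuity of the integrand that [CFTC]
    and the integrability of slices rely on. *)
Lemma moebius_power_deriv (n : nat) (A : R[i]) (x : R) : 0 < Re A -> 0 <= x ->
  exists d, Cderiv (fun x => (x ^+ n)%:C / (A + 2 * x%:C) ^+ (n + 2)) x d.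
Proof.
move=> A0 x0.
have xn : A + 2 * x%:C != 0.
  by apply: complex_neq0; rewrite Re_add Re_mul /= addr0 mulr0 subr0; lra.
have fE2 : (fun x => (x ^+ n)%:C / (A + 2 * x%:C) ^+ (n + 2)) =
    fun x : R => x%:C ^+ n / (A + 2 * x%:C) ^+ (n + 2).
  by apply/funext => y; rewrite (rmorphXn (real_complex R)).
rewrite fE2; apply: (@Cdiff_Cderiv (fun z => z ^+ n / (A + 2 * z) ^+ (n + 2))).
have dA : Cdiff (fun z => A + 2 * z) x%:C.
  apply: CdiffD; first exact: Cdiff_cst.
  by apply: CdiffM; [exact: Cdiff_cst|exact: Cdiff_id].
apply: CdiffM; first by apply: CdiffX; exact: Cdiff_id.
by apply: CdiffV; [rewrite expf_neq0|exact: CdiffX].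
Qed.

(* The primitive is [v ^+ n.+1 / (n.+1 A)] with [v = x / (A + 2 x)], since [v' = A / (A + 2 x) ^+ 2]. *)
Lemma seg_moebius_power (n : nat) (A : R[i]) (T : R) : 0 < Re A -> 0 < T ->
  let f (x : R) := (x ^+ n)%:C / (A + 2 * x%:C) ^+ (n + 2) in
  seg 0 T (fun x => Re (f x)) +i* seg 0 T (fun x => Im (f x)) =
  (T%:C / (A + 2 * T%:C)) ^+ n.+1 / (n.+1%:R * A).
Proof.
move=> A0 T0 f.
pose v (x : R) := x%:C / (A + 2 * x%:C).
have An : A != 0 by apply: contraTneq A0 => ->; rewrite /= ltxx.
have nn : (n.+1%:R : R[i]) != 0 by rewrite pnatr_eq0.
have fE x : f x = v x ^+ n * ((A + 2 * x%:C)^-1) ^+ 2.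
  by rewrite /f /v exprMn exprD invfM !exprVn mulrA (rmorphXn (real_complex R)).
pose F x := (n.+1%:R * A)^-1 * v x ^+ n.+1.
have xn x : 0 <= x -> A + 2 * x%:C != 0.
  by move=> x0; apply: complex_neq0; rewrite Re_add Re_mul /= addr0 mulr0 subr0; lra.
have dF x : 0 <= x <= T -> Cderiv F x (f x).
  move=> /andP[x0 _].
  have := Cderiv_scale (n.+1%:R * A)^-1 (CderivX n (Cderiv_ratio A0 x0)); congr Cderiv.
  by rewrite fE -/(v x); move: nn (xn x x0) (v x ^+ n); move: (n.+1%:R) (A + 2 * x%:C) => N B Nn Bn V; field; rewrite Nn An Bn.
have df x : 0 <= x <= T -> exists d, Cderiv f x d.
  by move=> /andP[x0 _]; exact: moebius_power_deriv.
have F0 : F 0 = 0 by rewrite /F /v (_ : 0%:C = 0 :> R[i]) // mul0r expr0n mulr0.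
by rewrite (CFTC T0 dF df) F0 subr0 mulrC.
Qed.
End RealVariable.

(** * The kernel functions *)

Section Kernel.
Context {R : realType} (l : nat).
Local Notation H := (rhp R -> R[i]).
Local Notation mu := (@lebesgue_measure R).
Local Notation area := (mu \x mu)%E.
Local Notation MR := (measurableTypeR R).

(** The reproducing kernel at [w], up to the positive constant of [reproducing]. *)
Definition kern (w : R[i]) : H := fun z => ((val z + conjc w) ^+ (l + 2))^-1.

Lemma kern_neq0 (z w : R[i]) : 0 < Re z -> 0 < Re w -> z + conjc w != 0.
Proof. by move=> z0 w0; apply: complex_neq0; rewrite Re_add Re_conjc addr_gt0. Qed.

Lemma extend_kern w z : 0 < Re z -> extend (kern w) z = ((z + conjc w) ^+ (l + 2))^-1.
Proof. by move=> z0; rewrite (extend_in _ z0). Qed.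

Lemma analytic_kern w : 0 < Re w -> analytic (kern w).
Proof.
move=> w0; apply: (@analytic_of _ (fun z => ((z + conjc w) ^+ (l + 2))^-1)) => // z z0.
apply: CdiffV; first by rewrite expf_neq0 // kern_neq0.
by apply: CdiffX; apply: CdiffD; [exact: Cdiff_id|exact: Cdiff_cst].
Qed.

Lemma density_kern (w : R[i]) (x y : R) : 0 < x ->
  density l (kern w) (x, y) = x ^+ l * ((x + Re w) ^+ 2 + (y - Im w) ^+ 2) ^- (l + 2).
Proof.
move=> x0; rewrite /density extend_kern //= Normc.normcV normcX exprVn -exprM mulnC exprM.
by rewrite sqr_normcE; case: w.
Qed.

(** With D = |z + conj w|^2 the density is (x / D)^l D^-1 D^-1. The first factor is bounded because
    x Re w <= D, and the other two are dominated by a Cauchy density in x and one in y. *)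
Lemma bergman_kern w : 0 < Re w -> bergman l (kern w).
Proof.
move=> w0; set u := Re w in w0 *; set v := Im w.
have [K1 K10 B1] := cauchy_density_dom v w0.
have [K2 K20 B2] := cauchy_density_dom 0 w0.
have q0 (x : R) : 0 < 1 + x ^+ 2 by rewrite ltr_pwDl // sqr_ge0.
have ci (K : R) := integrableZl measurableT K (@integrable_cauchy_density R).
have pos (K x : R) : 0 < K -> 0 <= K * (1 + x ^+ 2)^-1.
  by move=> K0; rewrite mulr_ge0 ?invr_ge0 ?ltW.
apply: (bergman_le (analytic_kern w0) (integrable_prod (f := fun x => u ^- l * K2 * (1 + x ^+ 2)^-1)
   (g := fun x => K1 * (1 + x ^+ 2)^-1) _ _ (ci _) (ci _))).
- by move=> x; rewrite pos // mulr_gt0 // invr_gt0 exprn_gt0.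
- by move=> x; rewrite pos.
- move=> [x y] /= x0; rewrite density_kern // -/u -/v.
  set X := (x + u) ^+ 2; set D := X + (y - v) ^+ 2.
  have X0 : 0 < X by rewrite exprn_gt0 // addr_gt0.
  have XD : X <= D by rewrite lerDl sqr_ge0.
  have D0 : 0 < D by exact: lt_le_trans XD.
  have h1 : D^-1 <= K1 * (1 + y ^+ 2)^-1 by apply: B1; rewrite lerDr ltW.
  have h2 : D^-1 <= K2 * (1 + x ^+ 2)^-1.
    apply: le_trans (_ : (u ^+ 2 + (x - 0) ^+ 2)^-1 <= _); last exact: B2.
    rewrite lef_pV2 ?posrE //; last by rewrite ltr_pwDl ?exprn_gt0 ?sqr_ge0.
    apply: le_trans XD; rewrite subr0 /X sqrrD.
    by have := mulr_gt0 x0 w0; lra.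
  have h3 : x ^+ l * D ^- l <= u ^- l.
    rewrite -!exprVn -exprMn; apply: lerXn2r; rewrite ?nnegrE ?invr_ge0 ?(ltW w0) //.
      by apply: mulr_ge0; [exact: ltW|rewrite invr_ge0 ltW].
    rewrite ler_pdivrMr // mulrC ler_pdivlMr //.
    apply: le_trans XD; rewrite /X sqrrD.
    by have := mulr_gt0 x0 w0; have := sqr_ge0 x; have := sqr_ge0 u; lra.
  rewrite [leLHS](_ : _ = x ^+ l * D ^- l * D^-1 * D^-1); last by rewrite exprD invfM expr2 invfM !mulrA.
  have Dv : 0 <= D^-1 by rewrite invr_ge0 ltW.
  have xl : 0 <= x ^+ l * D ^- l.
    by apply: mulr_ge0; rewrite ?invr_ge0; apply: exprn_ge0; exact: ltW.
  rewrite [leRHS](_ : _ = u ^- l * (K2 * (1 + x ^+ 2)^-1) * (K1 * (1 + y ^+ 2)^-1)); last ring.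
  apply: ler_pM => //; first exact: mulr_ge0.
  exact: ler_pM.
- by move=> p; rewrite mulr_ge0 // pos // mulr_gt0 // invr_gt0 exprn_gt0.
Qed.

(** The density is bounded below by a positive constant on [1, 2] x [0, 1], a square of area 1. *)
Lemma sqn_kern_gt0 w : 0 < Re w -> 0 < sqn l (kern w).
Proof.
move=> w0; set u := Re w in w0 *; set v := Im w.
pose D := (2 + u) ^+ 2 + (1 + `|v|) ^+ 2.
have D0 : 0 < D by rewrite ltr_pwDl ?exprn_gt0 ?sqr_ge0 // addr_gt0.
pose B : set (MR * MR) := `[1, 2] `*` `[0, 1].
have mB : measurable B by exact: measurableX.
have areaB : area B = 1%E.
  transitivity (mu `[1%R, 2%R]%classic * mu `[0%R, 1%R]%classic)%E.
    by apply: product_measure1E; exact: measurable_itv.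
  rewrite !lebesgue_measure_itv /= !lte_fin ltr01 (_ : 1 < 2 :> R) ?ltr1n //.
  by rewrite -!EFinB -EFinM; congr EFin; ring.
have bk := density_integrable (bergman_kern w0).
have : D ^- (l + 2) <= \int[area]_p density l (kern w) p.
  apply: (@le_trans _ _ (\int[area]_(p in B) (cst (D ^- (l + 2))) p)).
    rewrite (Rintegral_cst area mB (D ^- (l + 2))).
    by have -> : fine (area B) = 1; rewrite ?mulr1 // areaB.
  have fin1 : (\int[area]_(p in B) (cst (D ^- (l + 2)) p)%:E)%E \is a fin_num.
    have -> : (\int[area]_(p in B) (cst (D ^- (l + 2)) p)%:E = (D ^- (l + 2))%:E * area B)%E.
      exact: (integral_cst area mB (D ^- (l + 2))%:E).
    by have -> : area B = 1%E by [].
  rewrite -lee_fin /Rintegral (fineK fin1) (fineK (integrable_fin_num measurableT bk)).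
  have mk := measurable_int _ bk.
  have k0 p : (0 <= (density l (kern w) p)%:E)%E by rewrite lee_fin density_ge0.
  apply: (@le_trans _ _ (\int[area]_(p in B) (density l (kern w) p)%:E)%E).
    apply: ge0_le_integral => //.
    - by move=> p _; rewrite lee_fin invr_ge0 exprn_ge0 // ltW.
    - by apply/measurable_EFinP; exact: measurable_cst.
    - by apply: measurable_funTS.
    - move=> [x y] [/=]; rewrite !in_itv /= => /andP[x1 x2] /andP[y1 y2].
      have x0 : 0 < x by lra.
      rewrite lee_fin density_kern // -/u -/v -[leLHS]mul1r.
      have E0 : 0 < (x + u) ^+ 2 + (y - v) ^+ 2.
        by rewrite ltr_pwDl ?sqr_ge0 // exprn_gt0 // addr_gt0.
      apply: ler_pM => //; first by rewrite invr_ge0 exprn_ge0 // ltW.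
        exact: exprn_ege1.
      rewrite lef_pV2 ?posrE ?exprn_gt0 //; apply: lerXn2r; [by rewrite nnegrE ltW|by rewrite nnegrE ltW|].
      apply: lerD; first by apply: lerXn2r; rewrite ?nnegrE; lra.
      rewrite -(real_normK (num_real (y - v))); apply: lerXn2r; rewrite ?nnegrE ?addr_ge0 //.
      by apply: le_trans (ler_normB _ _) _; rewrite lerD2r ger0_norm.
  by apply: ge0_subset_integral => // p _; exact: k0.
move=> h; rewrite /sqn mulr_gt0 ?invr_gt0 ?pi_gt0 //; apply: lt_le_trans h.
by rewrite invr_gt0 exprn_gt0.
Qed.
End Kernel.

(** * Pairing with a kernel, line by line *)

Section KernelPairing.
Context {R : realType} (l : nat).
Local Notation H := (rhp R -> R[i]).
Local Notation mu := (@lebesgue_measure R).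
Local Notation area := (mu \x mu)%E.
Local Notation MR := (measurableTypeR R).
Local Notation "'cauchy' y" := ((1 + y ^+ 2)^-1) (at level 10, y at level 8).

Lemma cauchy_ge0 (y : R) : 0 <= cauchy y.
Proof. by rewrite invr_ge0 addr_ge0 // sqr_ge0. Qed.

Lemma cauchy_ge (T x : R) : `|x| <= T -> 1 <= (1 + T ^+ 2) * cauchy x.
Proof.
move=> xT; have x0 : 0 < 1 + x ^+ 2 by rewrite ltr_pwDl // sqr_ge0.
rewrite ler_pdivlMr // mul1r lerD2l -(real_normK (num_real x)).
by apply: lerXn2r; rewrite ?nnegrE // (le_trans _ xT).
Qed.

(** One power of z provides the decay in Im z; the other n powers are bounded below by c^n. *)
Lemma pole_bound (c v : R) n : 0 < c -> exists2 C : R, 0 < C & forall z : R[i],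
  c <= `|Re z| -> normc (z ^+ n.+1)^-1 ^+ 2 <= C * cauchy (v - Im z).
Proof.
move=> c0; have [K K0 B] := cauchy_density_dom v c0.
exists (c ^- n ^+ 2 * K) => [|z cz]; first by rewrite mulr_gt0 // exprn_gt0 // invr_gt0 exprn_gt0.
have nz : c <= normc z by apply: le_trans cz (Re_le_normc z).
have nz0 := lt_le_trans c0 nz.
rewrite Normc.normcV normcX [normc z ^+ n.+1]exprS invfM exprMn [X in X <= _]mulrC -[X in _ <= X]mulrA.
apply: ler_pM.
- by apply: sqr_ge0.
- by apply: sqr_ge0.
- apply: lerXn2r; rewrite ?nnegrE ?invr_ge0 ?exprn_ge0 ?normc_ge0 ?(ltW c0) //.
  rewrite lef_pV2 ?posrE ?exprn_gt0 //.
  by apply: lerXn2r; rewrite ?nnegrE ?normc_ge0 ?(ltW c0).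
- have := B `|Re z| (v - Im z) cz.
  by rewrite exprVn sqr_normcE real_normK ?num_real // addrAC subrr add0r sqrrN.
Qed.

Lemma line_cont_meas (F : R[i] -> R[i]) (t : R) : (forall y, Ccont F (t +i* y)) ->
  Cmeas (fun y : MR => F (t +i* y)).
Proof.
move=> cF; split.
  by apply: continuous_measurable_fun => y; exact: (cont_at2_fix1 (Ccont_Re (cF y))).
by apply: continuous_measurable_fun => y; exact: (cont_at2_fix1 (Ccont_Im (cF y))).
Qed.

Lemma Cdiff_pole (zeta z : R[i]) n : z != zeta -> Cdiff (fun z => ((zeta - z) ^+ n)^-1) z.
Proof.
move=> zz; apply: CdiffV; first by rewrite expf_neq0 // subr_eq0 eq_sym.
apply: CdiffX; apply: CdiffD; first exact: Cdiff_cst.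
have := CdiffM (Cdiff_cst (-1) z) (Cdiff_id z).
by apply: (Cdiff_local ltr01) => w _; rewrite mulN1r.
Qed.

Lemma Re_lt_neq (z w : R[i]) : Re z < Re w -> z != w.
Proof. by apply: contraTneq => ->; rewrite ltxx. Qed.

Lemma square_int_le F (C : R) : Cmeas (F : MR -> R[i]) ->
  (forall y, normc (F y) ^+ 2 <= C * cauchy y) -> square_int F.
Proof.
move=> mF FC; split => //.
have mN : measurable_fun [set: MR] (fun y => normc (F y) ^+ 2).
  under eq_fun do rewrite sqr_normcE.
  by case: mF => m1 m2; apply: measurable_funD; exact: measurable_funX.
apply: (le_integrable measurableT _ _ (integrableZl measurableT C (@integrable_cauchy_density R))).
  exact/measurable_EFinP.
move=> y _ /=; rewrite lee_fin ger0_norm ?sqr_ge0 //.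
by apply: le_trans (FC y) (ler_norm _).
Qed.

Lemma pole_bound_strip (zeta : R[i]) (t : R) n : t < Re zeta -> exists2 C : R, 0 < C &
  forall x y, x <= t -> normc ((zeta - (x +i* y)) ^+ n.+1)^-1 ^+ 2 <= C * cauchy y.
Proof.
move=> tz; have c0 : 0 < Re zeta - t by rewrite subr_gt0.
have [C C0 B] := @pole_bound (Re zeta - t) (Im zeta) n c0.
exists C => // x y xt; have := B (zeta - (x +i* y)).
rewrite Re_add Re_opp Im_add Im_opp /= opprD addNKr opprK; apply.
by rewrite ger0_norm; lra.
Qed.

Lemma line_pole_square_int (zeta : R[i]) (t : R) n : t < Re zeta ->
  square_int (fun y => ((zeta - (t +i* y)) ^+ n.+1)^-1).
Proof.
move=> tz; have [C C0 B] := pole_bound_strip n tz.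
apply: (@square_int_le _ C); last by move=> y; apply: B.
apply: (@line_cont_meas (fun z => ((zeta - z) ^+ n.+1)^-1)) => y; apply: Cdiff_cont.
by apply: Cdiff_pole; exact: Re_lt_neq.
Qed.

Section shift.
Variables (k : H) (bk : bergman l k).
Let K := extend k.
Let aK : forall z, 0 < Re z -> Cdiff K z.
Proof. by apply/analyticP; exact: bergman_analytic bk. Qed.

(** The pole [zeta] lies to the right of the strip, so the integrand is analytic there. *)
Lemma line_shift (zeta : R[i]) n t1 t2 : 0 < t1 -> t1 <= t2 -> t2 < Re zeta ->
  square_int (fun y => K (t1 +i* y)) -> square_int (fun y => K (t2 +i* y)) ->
  CI mu (fun y => K (t1 +i* y) * ((zeta - (t1 +i* y)) ^+ n.+1)^-1) =
  CI mu (fun y => K (t2 +i* y) * ((zeta - (t2 +i* y)) ^+ n.+1)^-1).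
Proof.
move=> t10 t12 t2z s1 s2.
have [C C0 B] := pole_bound_strip n t2z.
have ci (e : R) := integrableZl measurableT e (@integrable_cauchy_density R).
have c0 := cauchy_ge0.
have pos (e x : R) : 0 <= e -> 0 <= e * cauchy x by move=> e0; rewrite mulr_ge0.
have C'0 : 0 <= C * (1 + t2 ^+ 2) by rewrite mulr_ge0 ?addr_ge0 ?sqr_ge0 // ltW.
(* The pole term is at most C / (1 + y^2) uniformly in x; the factor (1 + t2^2) / (1 + x^2), at
   least 1 on the strip, makes the majorant integrable over the plane. *)
apply: (@CI_strip_shift R (fun z => K z * ((zeta - z) ^+ n.+1)^-1) t1 t2 (t1 +i* 0)
  (fun p => t1 ^- l * density l k p + (C * (1 + t2 ^+ 2)) * cauchy (p.1) * (1 * cauchy (p.2)))).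
- by rewrite /= lexx.
- move=> z /andP[z1 z2]; apply: Cdiff_cont; apply: CdiffM; first by apply: aK; lra.
  by apply: Cdiff_pole; apply: Re_lt_neq; lra.
- move=> z /andP[z1 z2] _; apply: CdiffM; first by apply: aK; lra.
  by apply: Cdiff_pole; apply: Re_lt_neq; lra.
- by apply: square_intM => //; apply: line_pole_square_int; lra.
- by apply: square_intM => //; apply: line_pole_square_int.
- exact: (integrableD measurableT (integrableZl measurableT _ (density_integrable bk))
    (integrable_prod (fun x => pos _ x C'0) (fun x => pos _ x ler01) (ci _) (ci _))).
- move=> p; apply: addr_ge0.
    by rewrite mulr_ge0 ?density_ge0 // invr_ge0 exprn_ge0 // ltW.
  by apply: mulr_ge0; exact: pos.
- move=> x y /andP[x1 x2]; rewrite Normc.normcM /= mul1r.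
  have h1 := normc_sqr_le_density l k y t10 x1.
  have h2 := B x y x2.
  have h3 : 1 <= (1 + t2 ^+ 2) * cauchy x by apply: cauchy_ge; rewrite ger0_norm; lra.
  have h4 : C * cauchy y <= C * (1 + t2 ^+ 2) * cauchy x * cauchy y.
    rewrite -mulrA [X in _ <= X](_ : _ = (C * cauchy y) * ((1 + t2 ^+ 2) * cauchy x)); last ring.
    by rewrite -[leLHS]mulr1 ler_wpM2l // pos // ltW.
  set a := normc (K _) in h1 *; set b := normc _^-1 in h2 *.
  have := sqr_ge0 (a - b); rewrite sqrrB.
  have := mulr_ge0 (normc_ge0 (K (x +i* y))) (normc_ge0 ((zeta - (x +i* y)) ^+ n.+1)^-1).
  rewrite -/a -/b; lra.
Qed.

Variables (w : R[i]) (w0 : 0 < Re w) (kw : K w = 0).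

(** The quotient K(z) / (z - w), completed at w by the derivative of K. Continuity is enough at w,
    since [CI_strip_shift] allows one such point. *)
Lemma divided_difference : exists Q : R[i] -> R[i],
  [/\ forall z, z != w -> Q z = K z / (z - w), Ccont Q w &
      forall z, 0 < Re z -> z != w -> Cdiff Q z].
Proof.
have [d Hd] := aK w0.
exists (fun z => if z == w then d else K z / (z - w)); split.
- by move=> z /negbTE ->.
- move=> e e0; have [r r0 Hr] := Hd e e0; exists r => // z zr; rewrite eqxx.
  case: eqVneq => [_|zw]; first by rewrite subrr Normc.normc0 ltW.
  have zw0 : z - w != 0 by rewrite subr_eq0.
  have := Hr z zr; rewrite kw subr0 => h.
  have -> : K z / (z - w) - d = (K z - d * (z - w)) / (z - w) by rewrite mulrBl mulfK.
  by rewrite Normc.normcM Normc.normcV ler_pdivrMr ?normc_gt0.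
- move=> z z0 zw; have r0 : 0 < normc (z - w) by rewrite normc_gt0 subr_eq0.
  apply: (@Cdiff_local _ (fun z => K z / (z - w)) _ _ _ r0).
    move=> z' h; case: eqVneq h => // ->.
    by rewrite -normcN opprB ltxx.
  apply: CdiffM; first exact: aK.
  apply: CdiffV; first by rewrite subr_eq0.
  by apply: CdiffD; [exact: Cdiff_id|exact: Cdiff_cst].
Qed.

(** Near w the quotient is bounded by continuity. At distance at least r, the product of |K| and 1 /
    |z - w| is split by 2 a b <= a^2 + b^2 into a density and a Cauchy density. *)
Lemma divided_difference_bound (Q : R[i] -> R[i]) (t : R) : 0 < t ->
  (forall z, z != w -> Q z = K z / (z - w)) -> Ccont Q w ->
  exists2 C, 0 <= C & forall x y, t <= x ->
    normc (Q (x +i* y)) <= t ^- l * density l k (x, y) + C * cauchy y.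
Proof.
move=> t0 QE cQ; have [r r0 Hr] := cQ 1 ltr01.
set v := Im w.
have [C C0 B] := cauchy_density_dom v r0.
pose M := normc (Q w) + 1.
have M0 : 0 <= M by rewrite /M addr_ge0 // normc_ge0.
pose C1 := M * (1 + (`|v| + r) ^+ 2).
have C10 : 0 <= C1 by rewrite mulr_ge0 // addr_ge0 // sqr_ge0.
exists (C1 + 2 * C) => [|x y tx]; first by rewrite addr_ge0 // mulr_ge0 // ltW.
have d0 : 0 <= t ^- l * density l k (x, y).
  by rewrite mulr_ge0 ?density_ge0 // invr_ge0 exprn_ge0 // ltW.
have p0 := cauchy_ge0 y.
have [zr|zr] := ltrP (normc ((x +i* y) - w)) r.
  have h1 : normc (Q (x +i* y)) <= M.
    rewrite -[Q _](subrK (Q w)); apply: le_trans (le_normcD _ _) _.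
    by rewrite /M addrC lerD2l; exact: Hr.
  have h2 : 1 <= (1 + (`|v| + r) ^+ 2) * cauchy y.
    apply: cauchy_ge; rewrite -[y](subrK v) addrC; apply: le_trans (ler_normD _ _) _.
    rewrite lerD2l; apply: ltW; apply: le_lt_trans zr.
    by apply: le_trans (Im_le_normc _); rewrite Im_add Im_opp.
  have h3 : M <= C1 * cauchy y by rewrite /C1 -mulrA -[leLHS]mulr1 ler_wpM2l.
  rewrite mulrDl; have := mulr_ge0 (ltW C0) p0; lra.
have zw : (x +i* y) != w.
  by apply: contraTneq zr => ->; rewrite subrr Normc.normc0 -ltNge.
rewrite QE // Normc.normcM Normc.normcV.
have n2 : normc ((x +i* y) - w) ^+ 2 = (x - Re w) ^+ 2 + (y - v) ^+ 2.
  by rewrite sqr_normcE Re_add Re_opp Im_add Im_opp.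
have n0 : 0 < normc ((x +i* y) - w) by exact: lt_le_trans zr.
have h1 := normc_sqr_le_density l k y t0 tx.
have h2 : (normc ((x +i* y) - w))^-1 ^+ 2 <= 2 * C * cauchy y.
  rewrite exprVn -mulrA; apply: (@le_trans _ _ (2 * (r ^+ 2 + (y - v) ^+ 2)^-1)); last first.
    by rewrite ler_pM2l //; apply: B.
  have rr : 0 < r ^+ 2 + (y - v) ^+ 2 by rewrite ltr_pwDl ?sqr_ge0 // exprn_gt0.
  rewrite ler_pdivlMr // mulrC ler_pdivrMr ?exprn_gt0 //.
  have : r ^+ 2 <= normc ((x +i* y) - w) ^+ 2.
    by apply: lerXn2r; rewrite ?nnegrE ?normc_ge0 // ltW.
  by have := sqr_ge0 (x - Re w); rewrite n2; lra.
set a := normc (K _) in h1 *; set b := _^-1 in h2 *.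
have := sqr_ge0 (a - b); rewrite sqrrB.
have b0 : 0 <= b by rewrite invr_ge0 ltW.
have := mulr_ge0 (normc_ge0 (K (x +i* y))) b0.
have := mulr_ge0 C10 p0.
rewrite -/a [(C1 + _) * _]mulrDl; lra.
Qed.

Let g x := CI mu (fun y => pairing l k (kern l w) (x, y)).

(** On the line Re z = x one has conj z = 2 x - z: for fixed x the conjugate of the kernel becomes
    analytic in z, with its pole at w + 2 x. *)
Lemma pairing_kernE x y : 0 < x -> pairing l k (kern l w) (x, y) =
  (x ^+ l)%:C * (K (x +i* y) * (((w + (2 * x)%:C) - (x +i* y)) ^+ (l + 2))^-1).
Proof.
move=> x0; rewrite /pairing extend_kern // conj_inv conj_exp conj_add conjK.
congr (_ * (_ * (_ ^+ _)^-1)); case: (w) => a b; apply/eqP; rewrite eq_complex /=.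
by apply/andP; split; apply/eqP; ring.
Qed.

(** For each x in ]0, T] move the line Re z = x to Re z = t, exchange the two integrals, and
    integrate in x by [seg_moebius_power]. The segment begins at -T to match [integral_tails]; the
    slices with x <= 0 vanish. *)
Lemma slice_integral t T : 0 < t -> t < Re w -> 0 < T ->
  square_int (fun y => K (t +i* y)) ->
  seg (- T) T (fun x => Re (g x)) +i* seg (- T) T (fun x => Im (g x)) =
  CI mu (fun y => K (t +i* y) * ((T%:C / ((w - (t +i* y)) + 2 * T%:C)) ^+ l.+1 /
     (l.+1%:R * (w - (t +i* y))))).
Proof.
move=> t0 tw T0 st.
have bkern := bergman_kern l w0.
have [gi _] := CI_fubini1 (pairing_int bk bkern).
pose gT x := if - T <= x <= T then g x else 0.
have seg_gT (part : R[i] -> R) : part 0 = 0 ->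
    seg (- T) T (fun x => part (g x)) = \int[mu]_x part (gT x).
  move=> p0; rewrite /seg Rintegral_mkcond; apply: eq_Rintegral => x _.
  rewrite patchE /gT; case: ifPn => h; first by move: h; rewrite inE /= in_itv /= => ->.
  by move: h; rewrite notin_setE /= in_itv /= => /negP/negbTE ->.
have gTi : Cint mu gT.
  have part_int (part : R[i] -> R) : part 0 = 0 ->
      mu.-integrable setT (EFin \o (fun x => part (g x))) ->
      mu.-integrable setT (EFin \o (fun x => part (gT x))).
    move=> p0 pi; have : mu.-integrable `[- T, T] (EFin \o (fun x => part (g x))).
      exact: integrableS pi.
    rewrite integrable_mkcond //; apply: eq_integrable => // x _.
    rewrite patchE /gT; case: ifPn => h; first by move: h; rewrite inE /= in_itv /= => ->.
    by move: h; rewrite notin_setE /= in_itv /= => /negP/negbTE ->; rewrite p0.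
  by case: gi => g1 g2; split; [exact: (part_int (@complex.Re R))|exact: (part_int (@complex.Im R))].
rewrite (seg_gT (@complex.Re R)) // (seg_gT (@complex.Im R)) //.
rewrite -[LHS]/(CI mu gT).
pose w' := w - t%:C.
have w'0 : 0 < Re w' by rewrite /w' Re_add Re_opp /=; lra.
pose F (x : R) : R := if 0 < x <= T then x ^+ l else 0.
(* The integrand once the line has been moved. Expressing the pole by the kernel at w - t, evaluated
   at 2 x + i y, gives joint measurability. *)
pose Hf (p : MR * MR) : R[i] := (F p.1)%:C *
  (K (t +i* p.2) * conjc (extend (kern l w') ((2 * p.1) +i* p.2))).
have HfE x y : 0 < x -> Hf (x, y) =
    (F x)%:C * (K (t +i* y) * (((w + (2 * x)%:C) - (t +i* y)) ^+ (l + 2))^-1).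
  move=> x0; rewrite /Hf extend_kern; last by rewrite /= mulr_gt0.
  rewrite conj_inv conj_exp conj_add conjK /w'.
  congr (_ * (_ * (_ ^+ _)^-1)); case: (w) => a b; apply/eqP; rewrite eq_complex /=.
  by apply/andP; split; apply/eqP; ring.
have Fout x : x <= 0 -> F x = 0 by move=> x0; rewrite /F ltNge x0.
have Hout x y : x <= 0 -> Hf (x, y) = 0 by move=> x0; rewrite /Hf /= Fout // mul0r.
have [C C0 B] := @pole_bound (Re w - t) (Im w) (l + 1) ltac:(lra).
(* P(x) S(y) dominates [Hf]: P bounds the truncated weight, S the product of K and the pole. *)
pose S y := normc (K (t +i* y)) ^+ 2 + C * cauchy y.
pose P x := T ^+ l * (1 + T ^+ 2) * cauchy x.
have S0 y : 0 <= S y by rewrite addr_ge0 ?sqr_ge0 // mulr_ge0 ?cauchy_ge0 // ltW.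
have Tl0 : 0 <= T ^+ l * (1 + T ^+ 2) by rewrite mulr_ge0 ?exprn_ge0 ?addr_ge0 ?sqr_ge0 // ltW.
have P0 x : 0 <= P x by rewrite mulr_ge0 ?cauchy_ge0.
have HPS p : normc (Hf p) <= P p.1 * S p.2.
  case: p => x y; have [x0|x0] := lerP x 0; first by rewrite Hout // Normc.normc0 mulr_ge0.
  rewrite HfE // Normc.normcM normc_real /=; apply: ler_pM; rewrite ?normc_ge0 //.
    rewrite /F x0 /=; case: (lerP x T) => xT; last by rewrite normr0.
    rewrite ger0_norm ?exprn_ge0 ?(ltW x0) // /P -mulrA -[leLHS]mulr1.
    apply: ler_pM; rewrite ?exprn_ge0 ?(ltW x0) //.
      by apply: lerXn2r; rewrite ?nnegrE ?(ltW x0) ?(ltW T0).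
    by apply: cauchy_ge; rewrite ger0_norm ?(ltW x0).
  have h2 : normc ((w + (2 * x)%:C - (t +i* y)) ^+ (l + 2))^-1 ^+ 2 <= C * cauchy y.
    have := B (w + (2 * x)%:C - (t +i* y)); rewrite !Re_add !Im_add Re_opp Im_opp /= addr0.
    rewrite opprD addNKr opprK -addnS; apply.
    by rewrite ger0_norm; lra.
  rewrite Normc.normcM /S.
  set a := normc (K _); set b := normc _^-1 in h2 *.
  have := sqr_ge0 (a - b); rewrite sqrrB.
  have := mulr_ge0 (normc_ge0 (K (t +i* y))) (normc_ge0 ((w + (2 * x)%:C - (t +i* y)) ^+ (l + 2))^-1).
  rewrite -/a -/b; lra.
have mF : measurable_fun [set: MR] F.
  have -> : F = (fun x : MR => x ^+ l) \_ `]0, T].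
    apply/funext => x; rewrite patchE /F; case: ifPn => h.
      by rewrite mem_set //= in_itv.
    by rewrite memNset //= in_itv /=; apply/negP.
  by apply/(measurable_restrictT _ _).1 => //; apply: measurable_funTS; exact: measurable_funX.
have mHf : Cmeas Hf.
  apply: CmeasM.
    by apply: Cmeas_real; exact: (measurableT_comp mF (@measurable_fst _ _ MR MR)).
  apply: CmeasM.
    have [m1 m2] := st.1.
    by split; [exact: (measurableT_comp m1 (@measurable_snd _ _ MR MR))|
               exact: (measurableT_comp m2 (@measurable_snd _ _ MR MR))].
  apply: CmeasJ; have [m1 m2] := analytic_measurable (@analytic_kern R l w' w'0).
  have ms : measurable_fun setT (fun p : MR * MR => (2 * p.1, p.2) : MR * MR).
    apply: measurable_fun_pair; last exact: measurable_snd.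
    by apply: measurable_funM => //; exact: measurable_fst.
  by split; [exact: (measurableT_comp m1 ms)|exact: (measurableT_comp m2 ms)].
have ci (e : R) := integrableZl measurableT e (@integrable_cauchy_density R).
have Pi : mu.-integrable setT (EFin \o P) by exact: ci.
have Si : mu.-integrable setT (EFin \o S) by exact: (integrableD measurableT st.2 (ci C)).
have Hi : Cint area Hf by exact: (Cint_le mHf (integrable_prod P0 S0 Pi Si) HPS).
have [H1i H1] := CI_fubini1 Hi.
have [H2i H2] := CI_fubini2 Hi.
transitivity (CI mu (fun x => CI mu (fun y => Hf (x, y)))).
  apply: CI_ae => //.
  have := ae_square_int bk; apply: filterS => x sx.
  have [x0|x0] := lerP x 0.
    rewrite /gT; have -> : g x = 0.
      by rewrite /g; under eq_CI do rewrite pairing_out //; rewrite /CI Rintegral_cst // mul0r.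
    rewrite if_same; apply/esym.
    by under eq_CI do rewrite Hout //; rewrite /CI Rintegral_cst // mul0r.
  rewrite /gT; have -> : - T <= x by lra.
  rewrite /=; case: (lerP x T) => xT; last first.
    apply/esym; under eq_CI do rewrite HfE // /F x0 leNgt xT /= mul0r.
    by rewrite /CI Rintegral_cst // mul0r.
  have zx : x < Re (w + (2 * x)%:C) by rewrite Re_add /=; lra.
  have zt : t < Re (w + (2 * x)%:C) by rewrite Re_add /=; lra.
  have e2 : (l + 2 = (l + 1).+1)%N by rewrite addnS.
  (* Both lines lie to the left of the pole w + 2 x, because x > 0 and t < Re w; either of them may
     be the left one. *)
  have EQ : CI mu (fun y => K (x +i* y) * ((w + (2 * x)%:C - (x +i* y)) ^+ (l + 2))^-1) =
      CI mu (fun y => K (t +i* y) * ((w + (2 * x)%:C - (t +i* y)) ^+ (l + 2))^-1).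
    rewrite e2; case: (lerP x t) => xt.
      by apply: line_shift => //; exact: sx.
    by apply/esym; apply: line_shift => //; [exact: ltW|exact: sx].
  transitivity ((x ^+ l)%:C * CI mu (fun y => K (x +i* y) * ((w + (2 * x)%:C - (x +i* y)) ^+ (l + 2))^-1)).
    rewrite -CI_scale; first by apply: eq_CI => y; exact: pairing_kernE.
    by rewrite e2; apply: square_intM; [exact: sx|exact: line_pole_square_int].
  apply: (eq_trans (congr1 (fun z => (x ^+ l)%:C * z) EQ)).
  have si : Cint mu (fun y => K (t +i* y) * ((w + (2 * x)%:C - (t +i* y)) ^+ (l + 2))^-1).
    by rewrite e2; apply: square_intM; [exact: st|exact: line_pole_square_int].
  apply: (eq_trans (esym (CI_scale _ si))).
  have Fx : F x = x ^+ l by rewrite /F x0 xT.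
  by apply: eq_CI => y; rewrite (HfE x y x0) Fx.
rewrite -H1 H2; apply: eq_CI => y.
pose A := w - (t +i* y).
have A0 : 0 < Re A by rewrite /A Re_add Re_opp /=; lra.
pose f (x : R) := (x ^+ l)%:C / (A + 2 * x%:C) ^+ (l + 2).
pose f0 (x : R) := if 0 < x <= T then f x else 0.
have fc (part : R[i] -> R) : (forall z w, part (z - w) = part z - part w) ->
    (forall z, `|part z| <= normc z) -> segint 0 T (fun x => part (f x)).
  move=> pB pn; apply: segint_continuous => x /andP[x0 _].
  have [d hd] := moebius_power_deriv l A0 x0.
  exact: (Cderiv_part_continuous pB pn hd).
have f0P (part : R[i] -> R) : part 0 = 0 -> (forall z w, part (z - w) = part z - part w) ->
    (forall z, `|part z| <= normc z) ->
    mu.-integrable setT (EFin \o (fun x => part (f0 x))) /\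
    \int[mu]_x part (f0 x) = seg 0 T (fun x => part (f x)).
  move=> p0 pB pn; have fi := fc part pB pn.
  have fi' : mu.-integrable `]0, T] (EFin \o (fun x => part (f x))).
    by apply: integrableS fi => //; apply: subset_itv; rewrite bnd_simp.
  have E x : part (f0 x) = ((fun x => part (f x)) \_ `]0, T]) x.
    rewrite patchE /f0; case: ifPn => h.
      by rewrite mem_set //= in_itv.
    by rewrite memNset //= in_itv /=; apply/negP.
  split.
    have := fi'; rewrite integrable_mkcond //; apply: eq_integrable => // x _.
    by rewrite /= E !patchE; case: ifP.
  rewrite /seg -Rintegral_itv_obnd_cbnd // [RHS]Rintegral_mkcond.
  by apply: eq_Rintegral => x _; exact: E.
have [r1 r2] := f0P (@complex.Re R) erefl
  (fun z w => etrans (Re_add z (- w)) (congr1 (+%R (Re z)) (Re_opp w))) (@Re_le_normc R).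
have [i1 i2] := f0P (@complex.Im R) erefl
  (fun z w => etrans (Im_add z (- w)) (congr1 (+%R (Im z)) (Im_opp w))) (@Im_le_normc R).
have -> : CI mu (fun x => Hf (x, y)) = CI mu (fun x => K (t +i* y) * f0 x).
  apply: eq_CI => x; have [x0|x0] := lerP x 0.
    by rewrite Hout // /f0 ltNge x0 /= mulr0.
  rewrite HfE // /F /f0 x0 /=; case: (lerP x T) => xT; last by rewrite mul0r mulr0.
  rewrite /f mulrCA; congr (_ * (_ * (_ ^+ _)^-1)).
  rewrite /A; case: (w) => a b; apply/eqP; rewrite eq_complex /=.
  by apply/andP; split; apply/eqP; ring.
rewrite CI_scale //; congr (_ * _).
by rewrite /CI r2 i2; exact: (seg_moebius_power l A0 T0).
Qed.
End shift.
End KernelPairing.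

Lemma weighted_sum_le (R : realType) (lam I li C P : R) : 0 <= li * C ->
  2 * (2^-1 * lam * I + 2^-1 * li * C * P) <= lam * I + li * (C * (P + 1)).
Proof. by move=> h; lra. Qed.

(** * A function vanishing at w is orthogonal to the kernel at w *)

Section Vanishing.
Context {R : realType} (l : nat).
Local Notation H := (rhp R -> R[i]).
Local Notation mu := (@lebesgue_measure R).
Local Notation area := (mu \x mu)%E.
Local Notation MR := (measurableTypeR R).
Local Notation "'cauchy' y" := ((1 + y ^+ 2)^-1) (at level 10, y at level 8).
Lemma Re_far (T : R) (w z : R[i]) : Re (w - z + 2 * T%:C) = Re w - Re z + 2 * T.
Proof. by rewrite !Re_add Re_opp mulr_natl -rmorphMn /= mulr_natl. Qed.

(** The real part of the denominator is Re w - Re z + 2 T, at least T. *)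
Lemma far_ratio_le1 (T : R) (w z : R[i]) : 0 < Re w -> 0 < T -> Re z <= T -> normc (T%:C / (w - z + 2 * T%:C)) <= 1.
Proof.
move=> w0 T0 zT; have h : T <= normc (w - z + 2 * T%:C).
  apply: le_trans (Re_le_normc _); apply: le_trans (ler_norm _).
  by rewrite Re_far; lra.
rewrite Normc.normcM Normc.normcV normc_real ger0_norm ?(ltW T0) //.
by rewrite ler_pdivrMr ?mul1r // (lt_le_trans T0).
Qed.

Variables (k : H) (bk : bergman l k).
Let K := extend k.
Let aK : forall z, 0 < Re z -> Cdiff K z.
Proof. by apply/analyticP; exact: bergman_analytic bk. Qed.
Variables (w : R[i]) (w0 : 0 < Re w) (kw : K w = 0).

(** As K(w) = 0, K(z) / (w - z) extends continuously to w and the line may cross it; the other pole,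
    w + 2 T, stays to the right of Re z = T. *)
Lemma difference_shift t T : 0 < t -> t < Re w -> Re w < T ->
  square_int (fun y => K (t +i* y)) -> square_int (fun y => K (T +i* y)) ->
  CI mu (fun y => K (t +i* y) * ((T%:C / ((w - (t +i* y)) + 2 * T%:C)) ^+ l.+1 /
     (l.+1%:R * (w - (t +i* y))))) =
  CI mu (fun y => K (T +i* y) * ((T%:C / ((w - (T +i* y)) + 2 * T%:C)) ^+ l.+1 /
     (l.+1%:R * (w - (T +i* y))))).
Proof.
move=> t0 tw wT st sT; have T0 : 0 < T by exact: lt_trans w0 wT.
have [Q [QE cQ dQ]] := divided_difference bk w0 kw.
have [C C0 B] := divided_difference_bound l t0 QE cQ.
(* The sign converts w - z into the z - w of the divided difference. *)
pose c : R[i] := - l.+1%:R^-1.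
pose E z := c * (T%:C / (w - z + 2 * T%:C)) ^+ l.+1.
pose F z := Q z * E z.
have FE z : z != w -> F z = K z * ((T%:C / (w - z + 2 * T%:C)) ^+ l.+1 / (l.+1%:R * (w - z))).
  move=> zw; rewrite /F /E QE // /c -(opprB z w) [in RHS]invfM [in RHS]invrN.
  move: (z - w)^-1 (l.+1%:R^-1) (_ ^+ _) => b n a; rewrite /K; ring.
have nd z : Re z <= T -> w - z + 2 * T%:C != 0.
  move=> zT; by apply: complex_neq0; rewrite Re_far; have := w0; lra.
have dE z : Re z <= T -> Cdiff E z.
  move=> zT; apply: CdiffM; first exact: Cdiff_cst.
  apply: CdiffX; apply: CdiffM; first exact: Cdiff_cst.
  apply: CdiffV; first exact: nd.
  apply: CdiffD; last exact: Cdiff_cst.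
  apply: CdiffD; first exact: Cdiff_cst.
  have := CdiffM (Cdiff_cst (-1) z) (Cdiff_id z).
  by apply: (Cdiff_local ltr01) => u _; rewrite mulN1r.
have nc : normc c <= 1.
  rewrite /c normcN Normc.normcV.
  have -> : (l.+1%:R : R[i]) = (l.+1%:R : R)%:C by rewrite rmorph_nat.
  by rewrite normc_real ger0_norm // invf_le1 ?ltr0n // ler1n.
have nE z : Re z <= T -> normc (F z) <= normc (Q z).
  move=> zT; rewrite /F Normc.normcM -[leRHS]mulr1 ler_wpM2l ?normc_ge0 //.
  rewrite /E Normc.normcM normcX.
  apply: mulr_ile1; rewrite ?exprn_ge0 ?normc_ge0 //.
  by apply: exprn_ile1; rewrite ?normc_ge0 //; exact: far_ratio_le1.
have cF z : t <= Re z <= T -> Ccont F z.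
  move=> /andP[z1 z2]; apply: CcontM; last by apply: Cdiff_cont; exact: dE.
  have [->//|zw] := eqVneq z w.
  by apply: Cdiff_cont; apply: dQ => //; lra.
have ci (e : R) := integrableZl measurableT e (@integrable_cauchy_density R).
have iF x : t <= x <= T -> square_int (fun y => K (x +i* y)) -> Cint mu (fun y => F (x +i* y)).
  move=> /andP[x1 x2] sx.
  apply: (@Cint_le _ _ _ mu _ (fun y => (t ^- l * x ^+ l) * normc (K (x +i* y)) ^+ 2 + C * cauchy y)).
  - by apply: line_cont_meas => y; apply: cF; rewrite /= x1 x2.
  - exact: (integrableD measurableT (integrableZl measurableT _ sx.2) (ci C)).
  - move=> y; apply: le_trans (nE (x +i* y) x2) _; apply: le_trans (B x y x1) _.
    by rewrite /density /= mulrA.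
have pos (e x : R) : 0 <= e -> 0 <= e * cauchy x by move=> e0; rewrite mulr_ge0 ?cauchy_ge0.
have C'0 : 0 <= C * (1 + T ^+ 2) by rewrite mulr_ge0 ?addr_ge0 ?sqr_ge0.
transitivity (CI mu (fun y => F (t +i* y))).
  by apply: eq_CI => y; rewrite FE //; exact: Re_lt_neq.
transitivity (CI mu (fun y => F (T +i* y))); last first.
  by apply: eq_CI => y; rewrite FE // eq_sym; exact: Re_lt_neq.
apply: (@CI_strip_shift R F t T w (fun p => t ^- l * density l k p +
   (C * (1 + T ^+ 2)) * cauchy (p.1) * (1 * cauchy (p.2)))).
- by apply/andP; split; exact: ltW.
- exact: cF.
- move=> z /andP[z1 z2] zw; apply: CdiffM; last exact: dE.
  by apply: dQ => //; lra.
- by apply: iF => //; rewrite lexx (ltW (lt_trans tw wT)).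
- by apply: iF => //; rewrite lexx (ltW (lt_trans tw wT)).
- exact: (integrableD measurableT (integrableZl measurableT _ (density_integrable bk))
    (integrable_prod (fun x => pos _ x C'0) (fun x => pos _ x ler01) (ci _) (ci _))).
- move=> p; apply: addr_ge0.
    by rewrite mulr_ge0 ?density_ge0 // invr_ge0 exprn_ge0 // ltW.
  by apply: mulr_ge0; exact: pos.
- move=> x y /andP[x1 x2]; apply: le_trans (nE (x +i* y) x2) _; apply: le_trans (B x y x1) _.
  rewrite lerD2l mul1r /=.
  have h3 : 1 <= (1 + T ^+ 2) * cauchy x by apply: cauchy_ge; rewrite ger0_norm; lra.
  rewrite -mulrA [X in _ <= X](_ : _ = (C * cauchy y) * ((1 + T ^+ 2) * cauchy x)); last ring.
  by rewrite -[leLHS]mulr1 ler_wpM2l // pos.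
Qed.

(** The power of the ratio is at most 1 in modulus, and 1 / (w - z) is square integrable on lines at
    distance at least 1 from w; a mean inequality weighted by [lam] then separates K from it. [C]
    depends neither on T nor on [lam]. *)
Lemma far_line_bound : exists2 C : R, 0 < C & forall (T lam : R), Re w + 1 <= T -> 0 < lam ->
  square_int (fun y => K (T +i* y)) ->
  normc (CI mu (fun y => K (T +i* y) * ((T%:C / ((w - (T +i* y)) + 2 * T%:C)) ^+ l.+1 /
     (l.+1%:R * (w - (T +i* y)))))) <=
  lam * (\int[mu]_y normc (K (T +i* y)) ^+ 2) + lam^-1 * C.
Proof.
have [C C0 B] := @pole_bound R 1 (Im w) 0 ltr01.
pose P := \int[mu]_y (cauchy y).
have P0 : 0 <= P by apply: Rintegral_ge0 => y _; exact: cauchy_ge0.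
exists (C * (P + 1)) => [|T lam wT lam0 sT]; first by rewrite mulr_gt0 // ltr_wpDl.
have T0 : 0 < T by have := w0; lra.
pose N y := normc (K (T +i* y)) ^+ 2.
pose G y := 2^-1 * lam * N y + 2^-1 * lam^-1 * C * cauchy y.
have ci (e : R) := integrableZl measurableT e (@integrable_cauchy_density R).
have iG : mu.-integrable setT (EFin \o G).
  exact: (integrableD measurableT (integrableZl measurableT _ sT.2) (ci _)).
set F := fun y => _.
have FG y : normc (F y) <= G y.
  have h : normc (w - (T +i* y))^-1 ^+ 2 <= C * cauchy y.
    have := B (w - (T +i* y)); rewrite expr1 Im_add Im_opp /= subKr; apply.
    by rewrite Re_add Re_opp /= ler0_norm; have := wT; lra.
  have h2 : normc (F y) <= normc (K (T +i* y)) * normc (w - (T +i* y))^-1.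
    rewrite /F Normc.normcM ler_wpM2l ?normc_ge0 // invfM !Normc.normcM mulrA.
    rewrite -[leRHS]mul1r ler_wpM2r ?normc_ge0 // normcX.
    apply: mulr_ile1; rewrite ?exprn_ge0 ?normc_ge0 //.
      by apply: exprn_ile1; rewrite ?normc_ge0 //; exact: (far_ratio_le1 w0).
    rewrite Normc.normcV.
    have -> : (l.+1%:R : R[i]) = (l.+1%:R : R)%:C by rewrite rmorph_nat.
    by rewrite normc_real ger0_norm // invf_le1 ?ltr0n // ler1n.
  apply: le_trans h2 _; rewrite /G /N.
  move: (normc_ge0 (K (T +i* y))) (normc_ge0 (w - (T +i* y))^-1) h.
  set p := normc (K _); set q := normc _^-1 => p0 q0 h.
  have h3 : 2^-1 * lam^-1 * q ^+ 2 <= 2^-1 * lam^-1 * C * cauchy y.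
    by rewrite -[leRHS]mulrA ler_wpM2l // mulr_ge0 ?invr_ge0 ?(ltW lam0).
  apply: (@le_trans _ _ (2^-1 * lam * p ^+ 2 + 2^-1 * lam^-1 * q ^+ 2)); last by rewrite lerD2l.
  have lam1 : lam * lam^-1 = 1 by rewrite mulfV // lt0r_neq0.
  have h4 : 0 <= lam^-1 by rewrite invr_ge0 ltW.
  have : 0 <= lam^-1 * (lam * p - q) ^+ 2 by rewrite mulr_ge0 ?sqr_ge0.
  have -> : lam^-1 * (lam * p - q) ^+ 2 = lam * p ^+ 2 * (lam * lam^-1) - 2 * p * q * (lam * lam^-1) + lam^-1 * q ^+ 2 by ring.
  by rewrite lam1; lra.
have iF : Cint mu F.
  apply: (@Cint_le _ _ _ mu _ G) => //; apply: CmeasM; first exact: sT.1.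
  apply: (@line_cont_meas R (fun z => (T%:C / (w - z + 2 * T%:C)) ^+ l.+1 / (l.+1%:R * (w - z)))) => y.
  have dw z : Cdiff (fun z => w - z) z.
    apply: CdiffD; first exact: Cdiff_cst.
    have := CdiffM (Cdiff_cst (-1) z) (Cdiff_id z).
    by apply: (Cdiff_local ltr01) => u _; rewrite mulN1r.
  apply: Cdiff_cont; apply: CdiffM.
    apply: CdiffX; apply: CdiffM; first exact: Cdiff_cst.
    apply: CdiffV; last by apply: CdiffD; [exact: dw|exact: Cdiff_cst].
    by apply: complex_neq0; rewrite Re_far /=; have := w0; lra.
  apply: CdiffV; last by apply: CdiffM; [exact: Cdiff_cst|exact: dw].
  rewrite mulf_neq0 ?pnatr_eq0 // subr_eq0; apply: Re_lt_neq => /=.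
  by have := wT; lra.
apply: le_trans (CI_le iF iG FG) _.
have -> : \int[mu]_x G x = 2^-1 * lam * (\int[mu]_y N y) + 2^-1 * lam^-1 * C * P.
  rewrite /G RintegralD //; last first.
  - exact: ci.
  - exact: (integrableZl measurableT _ sT.2).
  congr (_ + _); first by rewrite RintegralZl //; exact: sT.2.
  by rewrite RintegralZl //; exact: integrable_cauchy_density.
have h : 0 <= lam^-1 * C by rewrite mulr_ge0 ?invr_ge0 ?ltW.
exact: weighted_sum_le.
Qed.

(** The pairing truncated to x <= T equals an integral along Re z = T. T is taken so large that
    truncation costs at most e / 2 and such that K has small energy on that line, which bounds the
    line integral by e / 2. *)
Lemma inner_kern_eq0 : bergman_inner l k (kern l w) = 0.
Proof.
have bkern := bergman_kern l w0.
have [t /andP[t0 tw] st] := ae_exists_itv w0 (ae_square_int bk).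
have {}st : square_int (fun y => K (t +i* y)) by apply: st.
rewrite bergman_innerE; have [gi ->] := CI_fubini1 (pairing_int bk bkern).
set g := fun x => CI _ _ in gi *.
suff h e : 0 < e -> `|Re (CI mu g)| <= e /\ `|Im (CI mu g)| <= e.
  have z (x : R) : (forall e, 0 < e -> `|x| <= e) -> x = 0.
    by move=> hx; apply/eqP; rewrite -normr_le0; apply/ler_addgt0Pr => e /hx; rewrite add0r.
  move: (CI mu g) h => [x y] /= h.
  have -> : x = 0 by apply: z => e /h [].
  by have -> : y = 0 by [apply: z => e /h []]; rewrite mulr0.
move=> e0; have e2 : 0 < e / 2 by rewrite divr_gt0.
have [N1 T1] := integral_tails gi.1 e2.
have [N2 T2] := integral_tails gi.2 e2.
have [C C0 B] := far_line_bound.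
(* With energy at most e / (4 lam) on the line, [far_line_bound] gives e / 4 + e / 4. *)
pose lam := 4 * C / e.
have lam0 : 0 < lam by rewrite /lam divr_gt0 // mulr_gt0.
have d0 : 0 < e / (4 * lam) by rewrite divr_gt0 // mulr_gt0.
have Di := density_integrable bk.
have De0 p : (0 <= (density l k p)%:E)%E by rewrite lee_fin density_ge0.
have mD := measurable_int _ Di.
pose E x := (\int[mu]_y (density l k (x, y))%:E)%E.
have mE : measurable_fun [set: R] E.
  exact: (measurable_fun_fubini_tonelli_F (m2 := mu) (EFin \o density l k) mD De0).
have E0 x : (0 <= E x)%E by apply: integral_ge0 => y _; exact: De0.
have Efin : (\int[mu]_x E x < +oo)%E.
  rewrite -(fubini_tonelli1 (m1 := mu) (m2 := mu) (EFin \o density l k) mD De0).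
  have [_] := integrableP _ _ _ Di; apply: le_lt_trans.
  by rewrite le_eqVlt; apply/orP; left; apply/eqP; apply: eq_integral => p _ /=; rewrite ger0_norm ?density_ge0.
(* T >= 1 makes the weight T^l at least 1, so that E(T) also bounds the unweighted integral on the
   line. *)
have [T NT ET] := ge0_small_value (Num.max (Num.max N1 N2) (Num.max 1 (Re w + 1))) mE E0 Efin d0.
move: NT; rewrite !ge_max => /andP[/andP[N1T N2T] /andP[T1' wT]].
have T0 : 0 < T by apply: lt_le_trans T1'.
have aT : T ^+ l >= 1 by rewrite exprn_ege1.
have mT : Cmeas (fun y : MR => K (T +i* y)).
  by apply: line_cont_meas => y; apply: Cdiff_cont; exact: aK.
have mN : measurable_fun [set: MR] (fun y => normc (K (T +i* y)) ^+ 2).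
  under eq_fun do rewrite sqr_normcE.
  by case: mT => m1 m2; apply: measurable_funD; exact: measurable_funX.
have NE : (\int[mu]_y (normc (K (T +i* y)) ^+ 2)%:E <= E T)%E.
  apply: ge0_le_integral => //.
  - by move=> y _; rewrite lee_fin sqr_ge0.
  - exact/measurable_EFinP.
  - apply/measurable_EFinP; rewrite /density /=.
    by apply: measurable_funM; [exact: measurable_cst|exact: mN].
  - by move=> y _; rewrite lee_fin /density /= -[leLHS]mul1r ler_wpM2r ?sqr_ge0.
have sT : square_int (fun y => K (T +i* y)).
  split => //; apply/integrableP; split; first exact/measurable_EFinP.
  under eq_integral do rewrite /= ger0_norm ?sqr_ge0 //.
  by apply: le_lt_trans NE _; apply: lt_trans ET _; exact: ltry.
have NT : \int[mu]_y normc (K (T +i* y)) ^+ 2 <= e / (4 * lam).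
  rewrite -lee_fin /Rintegral fineK; first by apply: le_trans NE (ltW ET).
  exact: (integrable_fin_num measurableT sT.2).
have wT' : Re w < T by have := wT; lra.
have S := slice_integral bk w0 t0 tw T0 st.
rewrite (difference_shift t0 tw wT' st sT) -/g in S.
have {B} := B T lam wT lam0 sT; rewrite -S => nS.
have {nS} nS : normc (seg (- T) T (fun x => Re (g x)) +i* seg (- T) T (fun x => Im (g x))) <= e / 2.
  apply: le_trans nS _.
  apply: (@le_trans _ _ (lam * (e / (4 * lam)) + lam^-1 * C)).
    by rewrite lerD2r ler_wpM2l // ltW.
  apply: eq_ler; rewrite /lam; field.
  by rewrite !lt0r_neq0.
have hR := le_trans (Re_le_normc _) nS.
have hI := le_trans (Im_le_normc _) nS.
have := T1 T N1T; have := T2 T N2T; rewrite /= in hR hI *.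
move: (seg _ _ _) (seg _ _ _) hR hI => r i.
move: (\int[mu]_x _) (\int[mu]_x _) => I1 I2 hR hI h1 h2.
have tri (x y : R) : `|x - y| <= e / 2 -> `|y| <= e / 2 -> `|x| <= e.
  move=> xy y2; rewrite [e in X in _ <= X]splitr -[x](subrK y).
  exact: le_trans (ler_normD _ _) (lerD xy y2).
split; apply: tri; eassumption.
Qed.

End Vanishing.

(** * The reproducing property *)

Section Reproducing.
Context {R : realType} (l : nat).
Local Notation H := (rhp R -> R[i]).

(** Subtracting from h the multiple of k_w with the same value at w leaves a function orthogonal to
    k_w, so the pairing is kap(w) h(w) for some kap(w). Hermitian symmetry, applied to k_w and k_1,
    shows that kap is constant. *)
Lemma reproducing : exists2 kappa : R, 0 < kappa & forall w, 0 < Re w ->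
  forall h : H, bergman l h -> bergman_inner l h (kern l w) = kappa%:C * extend h w.
Proof.
pose d (w : R[i]) := extend (kern l w) w.
have dE w : 0 < Re w -> d w = (((2 * Re w) ^+ (l + 2))^-1)%:C.
  move=> w0; rewrite /d extend_kern //.
  have -> : w + conjc w = (2 * Re w)%:C.
    by case: (w) => x y; apply/eqP; rewrite eq_complex /=; apply/andP; split; apply/eqP; ring.
  by rewrite rmorphV ?rmorphXn //= unitfE expf_neq0 // mulf_neq0 // lt0r_neq0.
have dneq w : 0 < Re w -> d w != 0.
  by move=> w0; rewrite dE // fmorph_eq0 invr_eq0 expf_neq0 // mulf_neq0 // lt0r_neq0.
pose kap (w : R[i]) := sqn l (kern l w) * (2 * Re w) ^+ (l + 2).
have E (w : R[i]) (h : H) : 0 < Re w -> bergman l h -> bergman_inner l h (kern l w) = (kap w)%:C * extend h w.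
  move=> w0 bh; have bk := bergman_kern l w0.
  pose c := extend h w / d w.
  pose h' : H := fun z => - c * kern l w z + h z.
  have bh' : bergman l h' by exact: bergman_lin.
  have h'w : extend h' w = 0.
    by rewrite /h' extend_lin mulNr -[extend (kern l w) w]/(d w) divfK ?dneq // addNr.
  have := inner_kern_eq0 bh' w0 h'w.
  rewrite inner_lin // inner_self // mulNr => /eqP; rewrite addrC subr_eq0 => /eqP ->.
  rewrite /c /kap dE // rmorphV; last by rewrite unitfE expf_neq0 // mulf_neq0 // lt0r_neq0.
  rewrite invrK [in RHS]rmorphM /= -[RHS]mulrA [LHS]mulrC; congr (_ * _); exact: mulrC.
have p1 : 0 < Re (1 : R[i]) by exact: ltr01.
have kapC w : 0 < Re w -> kap w = kap 1.
  move=> w0; have bw := bergman_kern l w0; have b1 := bergman_kern l p1.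
  have := innerJ bw b1; rewrite !E // conj_mul conj_real !extend_kern //.
  rewrite conj_inv conj_exp conj_add conjK [conjc w + 1]addrC.
  have nz : ((1 + conjc w) ^+ (l + 2))^-1 != 0.
    by rewrite invr_neq0 // expf_neq0 //; exact: (kern_neq0 p1 w0).
  by move=> /(mulIf nz) /complexI.
exists (kap 1); first by rewrite /kap mulr_gt0 ?sqn_kern_gt0 // exprn_gt0 // mulr_gt0.
by move=> w w0 h bh; rewrite E // kapC.
Qed.
End Reproducing.

(** * Adjoints and everywhere defined bounded operators *)

Section Adjoint.
Context {R : realType} (l : nat) (a : R).
Local Notation H := (rhp R -> R[i]).
Local Notation C := (conj_a a).
Local Notation inner := (bergman_inner l).

Lemma sqnZ (c : R[i]) u : bergman l u -> sqn l (fun z => c * u z) = normc c ^+ 2 * sqn l u.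
Proof.
move=> bu; have bcu := bergmanZ c bu; apply: complexI.
rewrite -inner_self // innerZ // innerJ // innerZ // inner_self //.
rewrite conj_mul conj_real mulrA [in RHS]rmorphM; congr (_ * _).
by rewrite rmorphXn -[RHS]/(((normc c)%:C) ^+ 2) -normcE_Re sqr_normc.
Qed.

Lemma innerZr (c : R[i]) u w : bergman l u -> bergman l w ->
  inner u (fun z => c * w z) = conjc c * inner u w.
Proof.
move=> bu bw; have bcw := bergmanZ c bw.
by rewrite innerJ // innerZ // conj_mul -innerJ.
Qed.

Lemma extend_conj_a h z : 0 < Re z -> extend (C h) z = conjc (extend h (conjc z + (0 +i* a))).
Proof. by move=> z0; rewrite (extend_in _ z0) /conj_a -(extend_val h). Qed.

Lemma conj_aK h : C (C h) = h.
Proof.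
apply/funext => z; rewrite /conj_a conjK; congr h; apply: val_inj => /=.
by case: (val z) => x y; apply/eqP; rewrite eq_complex /=; apply/andP; split; apply/eqP; ring.
Qed.

Lemma conj_aZ (c : R[i]) h : C (fun z => c * h z) = (fun z => conjc c * C h z).
Proof. by apply/funext => z; rewrite /conj_a conj_mul. Qed.

Lemma conj_a_kern w : C (kern l w) = kern l (conjc w + (0 +i* a)).
Proof.
apply/funext => z; rewrite /conj_a /kern conj_inv conj_exp; congr (_ ^+ _)^-1.
rewrite /= conj_add conjK.
by case: (val z) (w) => x y [u v]; apply/eqP; rewrite eq_complex /=; apply/andP; split; apply/eqP; ring.
Qed.

(** Pairing u with the kernels recovers its values. *)
Lemma inner_kern_ext (u : H) : bergman l u -> (forall h, bergman l h -> inner h u = 0) -> u = (fun=> 0).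
Proof.
move=> bu hu; have [kap k0 rep] := reproducing (R := R) l.
apply/funext => z; have z0 := valP z; have bk := bergman_kern l z0.
have := hu _ bk; rewrite innerJ // rep // conj_mul conj_real extend_val => /eqP.
by rewrite mulf_eq0 fmorph_eq0 (gt_eqF k0) /= conjc_eq0 => /eqP.
Qed.

(** By [inner_bound] the pairing with u is continuous, so its vanishing spreads from the dense
    domain to the whole space. *)
Lemma dense_inner_eq0 (A : operator R) (u : H) : op_dom A `<=` bergman l -> densely_defined l A ->
  bergman l u -> (forall h, op_dom A h -> inner h u = 0) -> u = (fun=> 0).
Proof.
move=> domA dA bu hu; apply: inner_kern_ext => // h bh; apply/eqP.
rewrite -normc_eq0 eq_le normc_ge0 andbT; apply/ler_addgt0Pr => e e0; rewrite add0r.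
have s0 : 0 < 1 + sqn l u by rewrite ltr_pwDl ?sqn_ge0.
have [v dv hv] := dA h bh (e / (1 + sqn l u)) (divr_gt0 e0 s0).
have bv := domA _ dv.
have -> : inner h u = inner (fun z => h z - v z) u.
  have -> : (fun z => h z - v z) = (fun z => -1 * v z + h z).
    by apply/funext => z; rewrite mulN1r addrC.
  by rewrite (inner_lin (-1) bv bh bu) (hu v dv) mulr0 add0r.
apply: le_trans (inner_bound (bergmanB bh bv) bu) _.
by rewrite mulrC -ler_pdivlMr // ltW.
Qed.

(** Density of the domain makes the adjoint relation single-valued, so [xget] can only pick the
    given element. *)
Lemma adjoint_relP (A : operator R) (v u : H) : op_dom A `<=` bergman l -> densely_defined l A ->
  adjoint_rel l A v u -> op_app (adjoint l A) v = u.
Proof.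
move=> domA dA [bu hu]; rewrite /=; case: xgetP => [u' _ [bu' hu']|]; last by move=> /(_ u); case.
have E : (fun z => u' z - u z) = (fun=> 0).
  apply: (dense_inner_eq0 domA dA); first exact: bergmanB.
  move=> h dh; have bh := domA _ dh.
  have -> : (fun z => u' z - u z) = (fun z => -1 * u z + u' z).
    by apply/funext => z; rewrite mulN1r addrC.
  rewrite inner_linr // -hu // -hu' // (_ : conjc (-1) = -1); last exact: (rmorphN1 (@conjc R)).
  by rewrite mulN1r addNr.
by apply/funext => z; apply/eqP; rewrite -subr_eq0; apply/eqP; exact: (congr1 (@^~ z) E).
Qed.

(** The last clause says that the adjoint of V is C V C. The bound is on squared norms, so [L] is
    the square of an operator bound. *)
Definition symmetric_bounded (V : H -> H) :=
  [/\ forall h, bergman l h -> bergman l (V h),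
      exists2 L : R, 0 <= L & forall h, bergman l h -> sqn l (V h) <= L * sqn l h &
      forall h v, bergman l h -> bergman l v -> inner (V h) v = inner h (C (V (C v)))].

(** If W is C-selfadjoint, its domain is that of C W^* C; as W is a restriction of V, whose adjoint
    is C V C, this domain is the whole space. Conversely, if W is maximal it is V itself, and W^* =
    C V C. *)
Lemma symmetric_bounded_C_selfadjoint (f : H) (g : rhp R -> rhp R) (W : operator R) :
  op_le W (wcomp_max l f g) -> symmetric_bounded (op_app (wcomp_max l f g)) ->
  (C_selfadjoint l C W <-> op_eq W (wcomp_max l f g)) /\
  (C_selfadjoint l C W -> bounded_operator l W).
Proof.
set M := wcomp_max l f g; set V := op_app M => WM [BV [L L0 VL] sV].
have BC h : bergman l h -> bergman l (C h) by exact: reflect_bergman.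
have domM h : bergman l h -> op_dom M h by move=> bh; split=> //; exact: BV.
have domW : op_dom W `<=` bergman l by move=> h /(WM.1) [].
(* For every h, C h lies in the domain of W^* with image C V h, because W agrees with V on its
   domain. *)
have full : C_selfadjoint l C W -> bergman l `<=` op_dom W.
  move=> [_ [_ [sub _]]] h bh; apply: sub; split=> //; split; first exact: BC.
  exists (C (V h)); split; first by apply: BC; exact: BV.
  move=> u du; rewrite WM.2 // -{2}(conj_aK h); apply: sV; last exact: BC.
  exact: domW.
have eqM : bergman l `<=` op_dom W -> op_eq W M.
  move=> fullW; split=> //; split=> [h [bh _]|h [bh _]]; first exact: fullW.
  by rewrite WM.2 //; exact: fullW.
split; first split.
- by move=> /full /eqM.
- move=> [_ MW]; have fullW h : bergman l h -> op_dom W h by move=> /domM /(MW.1).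
  have WV h : bergman l h -> op_app W h = V h by move=> bh; rewrite WM.2 //; exact: fullW.
  have dW : densely_defined l W.
    move=> h bh e e0; exists h; first exact: fullW.
    have -> : (fun z => h z - h z) = (fun z => 0 * h z).
      by apply/funext => z; rewrite subrr mul0r.
    by rewrite bergman_normE sqnZ // Normc.normc0 expr0n mul0r sqrtr0.
  have adj h : bergman l h -> adjoint_rel l W (C h) (C (V h)).
    move=> bh; split; first by apply: BC; exact: BV.
    move=> u du; have bu := domW _ du.
    by rewrite WV // sV ?conj_aK //; exact: BC.
  split=> //; split; split=> [h dh|h dh].
  - have bh := domW _ dh; split=> //; split; first exact: BC.
    by exists (C (V h)); exact: adj.
  - have bh := domW _ dh; rewrite WV //.
    by apply/esym; rewrite -[RHS]conj_aK; congr (C _); apply: adjoint_relP => //; exact: adj.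
  - by case: dh => bh _; exact: fullW.
  - case: dh => bh _; rewrite WV //.
    by rewrite -[RHS]conj_aK; congr (C _); apply: adjoint_relP => //; exact: adj.
move=> sa; have fullW := full sa; split; first by apply/seteqP; split.
exists (Num.sqrt L + 1) => [|h bh]; first by rewrite ltr_wpDl // sqrtr_ge0.
rewrite WM.2; last exact: fullW.
rewrite !bergman_normE mulrDl mul1r -sqrtrM //.
by apply: ler_wpDr; [exact: sqrtr_ge0|apply: ler_wsqrtr; exact: VL].
Qed.

(** Conjugating the translation by c with C gives the translation by conj c, which is its adjoint.
    The case lam = 0 is the zero operator. *)
Lemma symmetric_bounded_transl (V : H -> H) (c lam : R[i]) : 0 <= Re c ->
  (forall h, V h = (fun z => lam * transl c h z)) -> symmetric_bounded V.
Proof.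
move=> c0 VE; have cc0 : 0 <= Re (conjc c) by rewrite Re_conjc.
split.
- by move=> h bh; rewrite VE; apply: bergmanZ; case: (transl_bergman c0 bh).
- exists (normc lam ^+ 2) => [|h bh]; first exact: sqr_ge0.
  have [bT sT _] := transl_bergman c0 bh.
  by rewrite VE sqnZ // ler_wpM2l // sqr_ge0.
- move=> h v bh bv; have [bT _ _] := transl_bergman c0 bh.
  have [bTv _ _] := transl_bergman cc0 bv.
  rewrite !VE innerZ // transl_inner // conj_aZ.
  suff -> : C (transl c (C v)) = transl (conjc c) v by rewrite innerZr // conjK.
  apply/funext => z; rewrite {1}/conj_a /transl extend_conj_a; last first.
    by rewrite Re_add ltr_pwDl //; exact: (valP (reflect_rhp a z)).
  rewrite conjK !conj_add conjK; congr (extend v _).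
  by case: (val z) (c) => x y [s t]; apply/eqP; rewrite eq_complex /=; apply/andP; split; apply/eqP; ring.
Qed.

(** V is the rank-one operator h |-> delta h(mu) k_w with w = conj mu + ia, and C exchanges k_w and
    k_mu. *)
Lemma symmetric_bounded_kern (V : H -> H) (mu delta : R[i]) : 0 < Re mu ->
  (forall h z, V h z = delta / (val z + mu - (0 +i* a)) ^+ (l + 2) * extend h mu) ->
  symmetric_bounded V.
Proof.
move=> mu0 VE; pose w := conjc mu + (0 +i* a).
have w0 : 0 < Re w by rewrite /w Re_add Re_conjc /= addr0.
have bk := bergman_kern l w0; have bm := bergman_kern l mu0.
have [kap k0 rep] := reproducing (R := R) l.
have {}VE h : V h = (fun z => (delta * extend h mu) * kern l w z).
  apply/funext => z; rewrite VE /kern mulrAC; congr (_ / _ ^+ _).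
  rewrite /w conj_add conjK -addrA; congr (_ + (_ + _)).
  by apply/eqP; rewrite eq_complex /= oppr0 !eqxx.
split.
- by move=> h bh; rewrite VE; exact: bergmanZ.
- exists (normc delta ^+ 2 * (((1 + sqn l (kern l mu)) / kap) ^+ 2) * sqn l (kern l w)).
    by apply: mulr_ge0; [apply: mulr_ge0; exact: sqr_ge0|exact: sqn_ge0].
  move=> h bh; rewrite VE sqnZ //.
  rewrite Normc.normcM exprMn [leRHS]mulrAC ler_wpM2r ?sqn_ge0 //.
  rewrite -[leRHS]mulrA ler_wpM2l ?sqr_ge0 // -(bergman_norm_sqr l h) -exprMn.
  have := inner_bound bh bm; rewrite rep // Normc.normcM normc_real gtr0_norm // => hb.
  apply: lerXn2r; rewrite ?nnegrE ?normc_ge0 //.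
    by rewrite !mulr_ge0 ?invr_ge0 ?(ltW k0) ?addr_ge0 ?sqn_ge0 // bergman_normE sqrtr_ge0.
  by rewrite mulrAC ler_pdivlMr // mulrC.
- move=> h v bh bv; rewrite !VE innerZ // innerJ // rep // conj_mul conj_real.
  rewrite conj_aZ conj_a_kern.
  have -> : conjc w + (0 +i* a) = mu.
    by rewrite /w; case: (mu) => x y; apply/eqP; rewrite eq_complex /=; apply/andP; split; apply/eqP; ring.
  rewrite innerZr // rep // conjK -mulrA -mulrA; congr (_ * _).
  by rewrite extend_conj_a // mulrCA [RHS]mulrCA; congr (_ * _); exact: mulrC.
Qed.

Lemma Re_moebius_gt0 (c u : R[i]) : 0 <= Re c -> 0 < Re u -> 0 < Re (u / (1 + c * u)).
Proof.
move=> c0 u0; have un : u != 0 by exact: complex_neq0.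
have -> : u / (1 + c * u) = (u^-1 + c)^-1 by rewrite -invf_div mulrDl mul1r mulfK.
by apply: ReV_gt0; rewrite Re_add ltr_pwDl // ReV_gt0.
Qed.

Section Moebius.
Variables c1 c2 c3 : R[i].
Hypotheses (c10 : 0 <= Re c1) (c20 : 0 <= Re c2) (c30 : 0 <= Re c3).

(** A product of contractions and isometries which, by [moebiusE], is composition with a Moebius map
    times the matching weight. *)
Definition moebius (h : H) : H :=
  transl c3 (inversion l (transl c2 (inversion l (transl c1 h)))).

Lemma moebiusE h z : moebius h z = ((1 + c2 * (val z + c3)) ^+ (l + 2))^-1 *
  extend h ((val z + c3) / (1 + c2 * (val z + c3)) + c1).
Proof.
set u := val z + c3.
have u0 : 0 < Re u by rewrite /u Re_add ltr_pwDl //; exact: valP z.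
have v0 := ReV_gt0 u0.
have w0 : 0 < Re (u^-1 + c2) by rewrite Re_add ltr_pwDl.
have un : u != 0 by exact: complex_neq0.
rewrite /moebius {1}/transl extend_inversion // extend_transl // extend_inversion //.
rewrite extend_transl ?ReV_gt0 // mulrA -invfM -exprMn mulrDr mulfV // [u * c2]mulrC.
congr (_ * extend h (_ + _)).
have -> : u^-1 + c2 = (1 + c2 * u) / u by rewrite mulrDl mul1r mulfK.
by rewrite invf_div.
Qed.

Lemma moebius_bergman h : bergman l h -> bergman l (moebius h) /\ sqn l (moebius h) <= sqn l h.
Proof.
move=> bh; have [b1 s1 _] := transl_bergman c10 bh.
have [b2 s2] := inversion_bergman b1; have [b3 s3 _] := transl_bergman c20 b2.
have [b4 s4] := inversion_bergman b3; have [b5 s5 _] := transl_bergman c30 b4.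
by split=> //; apply: le_trans s5 _; rewrite s4; apply: le_trans s3 _; rewrite s2.
Qed.
End Moebius.

Lemma moebius_inner c1 c2 c3 u v : 0 <= Re c1 -> 0 <= Re c2 -> 0 <= Re c3 ->
  bergman l u -> bergman l v ->
  inner (moebius c1 c2 c3 u) v = inner u (moebius (conjc c3) (conjc c2) (conjc c1) v).
Proof.
move=> c10 c20 c30 bu bv.
have [b1 _ _] := transl_bergman c10 bu.
have [b2 _] := inversion_bergman b1; have [b3 _ _] := transl_bergman c20 b2.
have [b4 _] := inversion_bergman b3.
rewrite -(Re_conjc c1) in c10 *; rewrite -(Re_conjc c2) in c20 *; rewrite -(Re_conjc c3) in c30 *.
have [d1 _ _] := transl_bergman c30 bv.
have [d2 _] := inversion_bergman d1; have [d3 _ _] := transl_bergman c20 d2.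
have [d4 _] := inversion_bergman d3.
rewrite !Re_conjc in c10 c20 c30 *.
by rewrite /moebius transl_inner // inversion_inner // transl_inner // inversion_inner // transl_inner.
Qed.

(** Taking the adjoint conjugates the three shifts and reverses their order; C conjugates them and
    moves ia from one end to the other. The two agree when c1 = c3 + ia. *)
Lemma symmetric_bounded_moebius (V : H -> H) (c1 c2 c3 d : R[i]) :
  0 <= Re c1 -> 0 <= Re c2 -> 0 <= Re c3 -> c1 = c3 + (0 +i* a) ->
  (forall h, V h = (fun z => d * moebius c1 c2 c3 h z)) -> symmetric_bounded V.
Proof.
move=> c10 c20 c30 c13 VE; split.
- by move=> h bh; rewrite VE; apply: bergmanZ; case: (moebius_bergman c10 c20 c30 bh).
- exists (normc d ^+ 2) => [|h bh]; first exact: sqr_ge0.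
  have [bT sT] := moebius_bergman c10 c20 c30 bh.
  by rewrite VE sqnZ // ler_wpM2l // sqr_ge0.
- move=> h v bh bv; have [bT _] := moebius_bergman c10 c20 c30 bh.
  have [c10' c20' c30'] : [/\ 0 <= Re (conjc c1), 0 <= Re (conjc c2) & 0 <= Re (conjc c3)].
    by rewrite !Re_conjc.
  have [bTv _] := moebius_bergman c30' c20' c10' bv.
  rewrite !VE innerZ // moebius_inner // conj_aZ.
  suff -> : C (moebius c1 c2 c3 (C v)) = moebius (conjc c3) (conjc c2) (conjc c1) v.
    by rewrite innerZr // conjK.
  apply/funext => z; rewrite {1}/conj_a !moebiusE //= conj_mul conj_inv conj_exp.
  set Z := conjc (val z) + (0 +i* a) + c3.
  have ZE : conjc Z = val z + conjc c1.
    by rewrite /Z c13 !conj_add conjK -addrA [conjc c3 + _]addrC.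
  have Z0 : 0 < Re Z by rewrite Re_add ltr_pwDl //; exact: (valP (reflect_rhp a z)).
  rewrite extend_conj_a ?Re_add ?ltr_pwDl ?Re_moebius_gt0 //.
  have DE : conjc (1 + c2 * Z) = 1 + conjc c2 * (val z + conjc c1).
    by rewrite conj_add conj_mul ZE (rmorph1 (@conjc R)).
  rewrite conjK [conjc (_ + c1)]conj_add conj_mul conj_inv DE ZE.
  congr (_ * extend v _); rewrite -addrA; congr (_ + _).
  rewrite c13; case: (c3) => x y; apply/eqP; rewrite eq_complex /=.
  by apply/andP; split; apply/eqP; ring.
Qed.

End Adjoint.

(** * Continuous roots of unity, and inversion of a half-plane *)

Lemma avoid_seq (R : realFieldType) (s : seq R) (x y : R) : x < y ->
  exists2 z, x < z < y & z \notin s.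
Proof.
elim: s x y => [|v s IH] x y xy.
  by exists ((x + y) / 2) => //; rewrite !midf_lt.
have [z /andP[xz zy] zs] := IH _ _ xy.
have [zv|zv] := eqVneq z v; last by exists z; rewrite ?xz ?zy // inE negb_or zv.
have [t /andP[xt tz] ts] := IH _ _ xz.
exists t; first by rewrite xt (lt_trans tz zy).
by rewrite inE negb_or ts andbT -zv lt_eqF.
Qed.

Section Algebra.
Context {R : realType}.

(** Along the segment from w to z the distance from F to F(w) is continuous and takes finitely many
    values, so by the intermediate value theorem it stays 0. *)
Lemma root_of_unity_constant (F : R[i] -> R[i]) n (z w : R[i]) : (0 < n)%N ->
  (forall z, 0 < Re z -> Ccont F z) -> (forall z, 0 < Re z -> F z ^+ n = 1) ->
  0 < Re z -> 0 < Re w -> F z = F w.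
Proof.
move=> n0 cF F1 z0 w0.
pose Z (t : R) := w + t%:C * (z - w).
have Z0 t : 0 <= t <= 1 -> 0 < Re (Z t).
  move=> /andP[t0 t1]; rewrite /Z Re_add Re_mul Re_add Re_opp /= mul0r subr0.
  have -> : Re w + t * (Re z - Re w) = (1 - t) * Re w + t * Re z by ring.
  have [->|tn] := eqVneq t 0; first by rewrite subr0 mul1r mul0r addr0.
  by apply: ltr_wpDl; [apply: mulr_ge0; [rewrite subr_ge0|exact: ltW]|rewrite mulr_gt0 // lt_neqAle eq_sym tn].
pose phi t := normc (F (Z t) - F w).
have cphi : {within `[0, 1], continuous phi}.
  apply: continuous_in_subspaceT => t; rewrite inE /= in_itv /= => /Z0 Zt.
  apply/cvgrPdist_le => /= e e0.
  have [r r0 Hr] := cF _ Zt e e0.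
  have M0 : 0 < normc (z - w) + 1 by rewrite ltr_wpDl ?normc_ge0.
  exists (r / (normc (z - w) + 1)) => /=; first by rewrite divr_gt0.
  move=> s /=; rewrite distrC ltr_pdivlMr // => st.
  have h : normc (Z s - Z t) < r.
    have -> : Z s - Z t = (s - t)%:C * (z - w) by rewrite /Z rmorphB /=; ring.
    rewrite Normc.normcM normc_real; apply: le_lt_trans st.
    by rewrite ler_wpM2l // lerDl.
  apply: le_trans (Hr _ h); rewrite /phi.
  have tri x y : normc x - normc y <= normc (x - y :> R[i]).
    by rewrite lerBlDr -{1}(subrK y x); exact: le_normcD.
  have -> : F (Z s) - F (Z t) = (F (Z s) - F w) - (F (Z t) - F w) by ring.
  rewrite ler_norml lerNl opprB; apply/andP; split; first exact: tri.
  by rewrite -[X in _ <= X]normcN opprB; exact: tri.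
have [r rE] := closed_field_poly_normal ('X^n - 1 : {poly R[i]}).
pose s := [seq normc (x - F w) | x <- r].
have phis t : 0 <= t <= 1 -> phi t \in s.
  move=> /Z0 Zt; apply/mapP; exists (F (Z t)) => //.
  rewrite -root_prod_XsubC -(rootZ _ _ (a := lead_coef ('X^n - 1 : {poly R[i]}))) -?rE.
    by rewrite rootE !hornerE F1 // subrr.
  by rewrite lead_coef_eq0 -size_poly_eq0 size_XnsubC.
have phi0 : phi 0 = 0 by rewrite /phi /Z mul0r addr0 subrr Normc.normc0.
have [p0|p0] := eqVneq (phi 1) 0.
  apply/eqP; rewrite -subr_eq0 -normc_eq0; apply/eqP; rewrite -[RHS]p0 /phi /Z.
  by rewrite [1%:C]rmorph1 mul1r [w + _]addrC subrK.
have {}p0 : 0 < phi 1 by rewrite lt_neqAle eq_sym p0 normc_ge0.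
(* A number between phi 0 = 0 and phi 1 that is not among the possible values of phi. *)
have [v /andP[v0 v1] vs] := avoid_seq s p0.
have [|c c01 cv] := IVT ler01 cphi (v := v).
  by rewrite phi0 min_l ?(ltW p0) // max_r ?(ltW p0) // !ltW.
by case/negP: vs; rewrite -cv; apply: phis; move: c01; rewrite in_itv.
Qed.

(* The image of the half-plane [Re X > r] under [X |-> k / X] is a disc, which
   lies in [Re < r] exactly under this condition. *)
Lemma halfplane_inversion_bound (r : R) (k : R[i]) : 0 <= r ->
  (forall X : R[i], r < Re X -> Re (k / X) < r) ->
  (r = 0 -> Im k = 0 /\ Re k < 0) /\ normc k + Re k <= 2 * r ^+ 2.
Proof.
case: k => k1 k2 /= r0 H.
(* The hypothesis at X = t + i s, multiplied by |X|^2. *)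
have {}H t s : r < t -> k1 * t + k2 * s < r * (t ^+ 2 + s ^+ 2).
  move=> rt; have t0 : 0 < t by apply: le_lt_trans rt.
  have := H (t +i* s) rt; rewrite /= => h.
  have d0 : 0 < t ^+ 2 + s ^+ 2 by rewrite ltr_pwDl ?sqr_ge0 // exprn_gt0.
  move: h; rewrite -(ltr_pM2r d0); congr (_ < _); field.
  by rewrite lt0r_neq0.
(* The limit case t = r: a failure by e > 0 would persist at t = r + eta for the eta below. *)
have {}Hc s : k1 * r + k2 * s <= r * (r ^+ 2 + s ^+ 2).
  rewrite leNgt; apply/negP; rewrite -subr_gt0.
  set e := _ - _ => e0.
  pose M := `|k1| + 2 * r ^+ 2 + r + 1.
  have M0 : 0 < M by rewrite /M ltr_wpDl // !addr_ge0 // mulr_ge0 // sqr_ge0.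
  pose eta := Num.min 1 (e / M).
  have eta0 : 0 < eta by rewrite lt_min ltr01 divr_gt0.
  have eta1 : eta <= 1 by rewrite ge_min lexx.
  have etaM : eta * M <= e by rewrite -ler_pdivlMr // ge_min lexx orbT.
  have := H (r + eta) s; rewrite ltrDl => /(_ eta0).
  have h1 : - (`|k1| * eta) <= k1 * eta by rewrite -mulNr ler_wpM2r ?(ltW eta0) // lerNnormlW.
  have h2 : r * eta ^+ 2 <= r * eta by rewrite ler_wpM2l // expr2 ger_pMl.
  have h3 : e = k1 * r + k2 * s - r * (r ^+ 2 + s ^+ 2) by [].
  move: etaM h1 h2 h3 eta0; rewrite /M; clear; nra.
have H0 : r = 0 -> k2 = 0 /\ k1 < 0.
  move=> r00; subst r; have k20 : k2 = 0.
    apply/eqP; apply: contraT => k2n; have := H 1 ((`|k1| + 1) / k2) ltr01.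
    rewrite mul0r mulr1 [k2 * _]mulrC divfK // => h; exfalso; move: h (ler_norm (- k1)); rewrite normrN.
    by clear; lra.
  by split=> //; have := H 1 0 ltr01; rewrite k20 !mul0r mulr1 addr0.
split=> //; have [r00|rn] := eqVneq r 0.
  have [-> k10] := H0 r00; rewrite r00 !expr0n addr0 mulr0 sqrtr_sqr ltr0_norm //.
  by rewrite addNr.
have {rn}r0' : 0 < r by rewrite lt_neqAle eq_sym rn.
have hk : k1 * r ^+ 2 + k2 ^+ 2 / 4 <= r ^+ 4.
  (* This value of s maximizes k2 s - r s^2. *)
  have := Hc (k2 / (2 * r)); rewrite -(ler_pM2r r0').
  have -> : (k1 * r + k2 * (k2 / (2 * r))) * r = k1 * r ^+ 2 + k2 ^+ 2 / 2.
    by field; rewrite lt0r_neq0.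
  have -> : r * (r ^+ 2 + (k2 / (2 * r)) ^+ 2) * r = r ^+ 4 + k2 ^+ 2 / 4.
    by field; rewrite lt0r_neq0.
  by clear; lra.
have k1r : 0 <= 2 * r ^+ 2 - k1.
  have : k1 * r ^+ 2 <= r ^+ 2 * r ^+ 2.
    by rewrite -exprD; move: hk (sqr_ge0 k2); clear; lra.
  rewrite ler_pM2r ?exprn_gt0 //; move: (sqr_ge0 r); clear; lra.
rewrite -lerBrDr -[leRHS]ger0_norm // -sqrtr_sqr; apply: ler_wsqrtr.
by move: hk; rewrite -[4%N]/(2 * 2)%N exprM; move: (r ^+ 2) => q; clear; rewrite !expr2; lra.
Qed.
End Algebra.

(** Here y = g(z) and x = z - ia: the three-point equation makes g a Moebius map in x. The
    coefficient u c - u0 c0 occurs on both sides, so the matrix has equal diagonal entries. *)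
Lemma three_point_identity (F : fieldType) (u u0 c c0 x y : F) :
  (u0 + y) * (x + c) * (u + c0) = (x + c0) * (u0 + c) * (u + y) ->
  y * ((u + c0 - u0 - c) * x + (u * c - u0 * c0)) =
  (u * c - u0 * c0) * x + (u * u0 * (c0 - c) + c * c0 * (u - u0)).
Proof.
move=> E; apply/eqP; rewrite -subr_eq0; apply/eqP.
transitivity ((u0 + y) * (x + c) * (u + c0) - (x + c0) * (u0 + c) * (u + y)); first by ring.
by rewrite E subrr.
Qed.

Lemma cyclic_product (F : comPzRingType) (p q r x y z x' y' z' : F) :
  q * y = r * z' -> r * z = p * y' -> p * x = q * x' ->
  p * q * r * (x * y * z) = p * q * r * (x' * y' * z').
Proof.
move=> h1 h2 h3; transitivity ((q * y) * (r * z) * (p * x)); first by ring.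
by rewrite h1 h2 h3; ring.
Qed.

(** * Symbols of a C_a-selfadjoint operator *)

Section Symbols.
Context {R : realType} (l : nat) (a : R).
Local Notation H := (rhp R -> R[i]).
Local Notation C := (conj_a a).
Local Notation inner := (bergman_inner l).
Variables (f : H) (g : rhp R -> rhp R).
Local Notation shift z := (val z - (0 +i* a)).

Lemma Re_pair_gt0 (z w : rhp R) : 0 < Re (shift z + val w).
Proof.
rewrite !Re_add Re_opp /= subr0; by apply: addr_gt0; [exact: (valP z)|exact: (valP w)].
Qed.

Lemma pair_neq0 (z w : rhp R) : shift z + val w != 0.
Proof. by apply: complex_neq0; exact: Re_pair_gt0. Qed.

(** By the reproducing property k_w lies in the domain of W^*, with W^* k_w = conj(f(w)) k_{g(w)}.
    The equation is W = C W^* C applied to C k_w = k_{conj w + ia} and evaluated at z. *)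
Lemma symbol_equation (W : operator R) : op_le W (wcomp_max l f g) ->
  C_selfadjoint l C W -> forall z w,
  f z * (shift z + val (g w)) ^+ (l + 2) = f w * (shift w + val (g z)) ^+ (l + 2).
Proof.
move=> WM [dW [sub1 sub2]] z w.
have domW : op_dom W `<=` bergman l by move=> h /(WM.1) [].
have [kap k0 rep] := reproducing (R := R) l.
have bw := bergman_kern l (valP w); have bg := bergman_kern l (valP (g w)).
have adj : adjoint_rel l W (kern l (val w)) (fun z => conjc (f w) * kern l (val (g w)) z).
  split; first exact: bergmanZ.
  move=> h dh; have bh := domW _ dh; rewrite innerZr // conjK WM.2 //.
  have [_ bWh] := WM.1 _ dh; rewrite (rep _ (valP w) _ bWh) (rep _ (valP (g w)) _ bh) /=.
  by rewrite !extend_val; exact: mulrCA.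
have dh : op_dom (sandwich l C (adjoint l W)) (C (kern l (val w))).
  split; first exact: reflect_bergman.
  by rewrite conj_aK; split => //; exists (fun z => conjc (f w) * kern l (val (g w)) z).
have := sub2.2 _ dh; rewrite WM.2; last exact: sub2.1.
rewrite -[op_app (sandwich _ _ _) _]/(C (op_app (adjoint l W) (C (C (kern l (val w)))))).
rewrite conj_aK (adjoint_relP domW dW adj) conj_aZ conjK !conj_a_kern.
move=> /(congr1 (@^~ z)); rewrite /kern /= !conj_add !conjK.
have -> : conjc (0 +i* a) = - (0 +i* a) by apply/eqP; rewrite eq_complex /= oppr0 !eqxx.
move=> E0; have E : f w / (val z + (val (g w) - (0 +i* a))) ^+ (l + 2) =
  f z / (val (g z) + (val w - (0 +i* a))) ^+ (l + 2) := E0.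
move/eqP: E; rewrite addrCA addrC [val (g z) + _]addrC eqr_div ?expf_neq0 ?pair_neq0 //.
by move=> /eqP/esym; exact.
Qed.

Hypothesis g_analytic : analytic_map g.
Hypothesis sym : forall z w,
  f z * (shift z + val (g w)) ^+ (l + 2) = f w * (shift w + val (g z)) ^+ (l + 2).
Variable w1 : rhp R.
Hypothesis fw1 : f w1 != 0.

Lemma weight_neq0 z : f z != 0.
Proof.
have := mulf_neq0 fw1 (expf_neq0 (l + 2) (pair_neq0 w1 (g z))).
by rewrite -(sym z w1) mulf_eq0 negb_or => /andP[].
Qed.

(** f is determined by g and a single value; this produces the formula for f in all three cases. *)
Lemma weightE z w : f z = f w * ((shift w + val (g z)) / (shift z + val (g w))) ^+ (l + 2).
Proof.
by rewrite expr_div_n mulrA -sym mulfK // expf_neq0 // pair_neq0.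
Qed.

(** Multiplying [sym] over the pairs (z, w), (w, w0), (w0, z) removes f and leaves equal (l+2)-th
    powers. As a function of z, the quotient N / D is a continuous root of unity, hence constant,
    and it is 1 at z = w. *)
Lemma three_point (z w w0 : rhp R) :
  (shift w0 + val (g z)) * (shift z + val (g w)) * (shift w + val (g w0)) =
  (shift z + val (g w0)) * (shift w0 + val (g w)) * (shift w + val (g z)).
Proof.
pose G := extend (fun z => val (g z)).
have GE t : G (val t) = val (g t) by rewrite /G extend_val.
have G0 x : 0 < Re x -> 0 < Re (G x).
  by move=> x0; rewrite /G (extend_in _ x0); exact: (valP (g _)).
have dG : forall x, 0 < Re x -> Cdiff G x by apply/analyticP.
have p0 x (u v : R[i]) : 0 < Re x -> 0 < Re u -> x - (0 +i* a) + u != 0.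
  move=> x0 u0; apply: complex_neq0; rewrite !Re_add Re_opp /= subr0; exact: addr_gt0.
pose N x := (shift w0 + G x) * (x - (0 +i* a) + val (g w)) * (shift w + val (g w0)).
pose D x := (x - (0 +i* a) + val (g w0)) * (shift w0 + val (g w)) * (shift w + G x).
have D0 x : 0 < Re x -> D x != 0.
  have pv (t : rhp R) : 0 < Re (val t) by exact: (valP t).
  by move=> x0; rewrite /D; apply: mulf_neq0; [apply: mulf_neq0|]; apply: p0; rewrite ?pv ?G0.
have m0 : (0 < l + 2)%N by rewrite addn2.
have ND x : 0 < Re x -> (N x / D x) ^+ (l + 2) = 1.
  move=> x0; pose t : rhp R := exist _ x x0.
  have -> : N x = (shift w0 + val (g t)) * (shift t + val (g w)) * (shift w + val (g w0)).
    by rewrite /N -(GE t).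
  have -> : D x = (shift t + val (g w0)) * (shift w0 + val (g w)) * (shift w + val (g t)).
    by rewrite /D -(GE t).
  have nf := mulf_neq0 (mulf_neq0 (weight_neq0 w0) (weight_neq0 t)) (weight_neq0 w).
  have dn : ((shift t + val (g w0)) * (shift w0 + val (g w)) * (shift w + val (g t))) ^+ (l + 2) != 0.
    by rewrite expf_neq0 // !mulf_neq0 // pair_neq0.
  rewrite expr_div_n; apply: (mulIf dn); rewrite divfK // mul1r.
  apply: (mulfI nf); rewrite !exprMn.
  have h1 := sym t w; have h2 := sym w w0; have h3 := sym w0 t.
  exact: cyclic_product h1 h2 h3.
have -> : (shift w0 + val (g z)) * (shift z + val (g w)) * (shift w + val (g w0)) = N (val z).
  by rewrite /N GE.
have -> : (shift z + val (g w0)) * (shift w0 + val (g w)) * (shift w + val (g z)) = D (val z).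
  by rewrite /D GE.
have cND x : 0 < Re x -> Ccont (fun x => N x / D x) x.
  move=> x0; apply: Cdiff_cont; apply: CdiffM.
    apply: CdiffM; last exact: Cdiff_cst.
    apply: CdiffM; first by apply: CdiffD; [exact: Cdiff_cst|exact: dG].
    apply: CdiffD; last exact: Cdiff_cst.
    by apply: CdiffD; [exact: Cdiff_id|exact: Cdiff_cst].
  apply: CdiffV; first exact: D0.
  apply: CdiffM; last by apply: CdiffD; [exact: Cdiff_cst|exact: dG].
  apply: CdiffM; last exact: Cdiff_cst.
  apply: CdiffD; last exact: Cdiff_cst.
  by apply: CdiffD; [exact: Cdiff_id|exact: Cdiff_cst].
have E := root_of_unity_constant m0 cND ND (valP z) (valP w).
have E1 : N (val w) / D (val w) = 1.
  have -> : N (val w) = D (val w) by rewrite /N /D GE; ring.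
  by rewrite divff // D0 //; exact: (valP w).
by rewrite -[LHS](divfK (D0 _ (valP z))) E E1 mul1r.
Qed.

Lemma translation_symbols (gam : R[i]) : (forall z, val (g z) = val z + gam) ->
  case_translation f g.
Proof.
move=> gE; exists gam, (f w1); split.
  rewrite leNgt; apply/negP => g0.
  (* At the point - Re gam the value of g would have real part 0. *)
  have z0 : 0 < Re ((- Re gam)%:C) by rewrite /= oppr_gt0.
  pose z : rhp R := exist (fun z : R[i] => 0 < Re z) _ z0.
  by have := valP (g z); rewrite gE Re_add /= addNr ltxx.
move=> w; split; first exact: gE.
rewrite (weightE w w1) !gE; have -> : shift w1 + (val w + gam) = shift w + (val w1 + gam) by ring.
by rewrite divff ?expr1n ?mulr1 // -gE pair_neq0.
Qed.

Lemma constant_symbols (mu : R[i]) : (forall z, val (g z) = mu) -> case_constant l a f g.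
Proof.
move=> gE; exists mu, (f w1 * (shift w1 + mu) ^+ (l + 2)); split; first by rewrite -(gE w1); exact: (valP (g w1)).
move=> w; split; first exact: gE.
have -> : val w + mu - (0 +i* a) = shift w + mu by exact: addrAC.
by rewrite (weightE w w1) !gE expr_div_n [LHS]mulrA.
Qed.

(** Division gives g = q / p - (D / p) / (p x + q) with x = z - ia, from which alpha and beta are
    read off by matching beta / alpha with - q / p. The inequalities come from g having neither a
    pole in the half-plane nor a value outside it. *)
Lemma fractional_symbols (p q s : R[i]) : p != 0 -> q ^+ 2 - s * p != 0 ->
  (forall z, val (g z) * (p * shift z + q) = q * shift z + s) ->
  case_fractional l a f g.
Proof.
move=> p0 D0 gE; set D := q ^+ 2 - s * p in D0.
have pq0 (z : rhp R) : p * shift z + q != 0.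
  apply: contra_neq D0 => pz; have := gE z; rewrite pz mulr0 => /esym qz.
  have -> : D = q * (p * shift z + q) - p * (q * shift z + s) by rewrite /D; ring.
  by rewrite pz qz !mulr0 subrr.
have two0 : (2 : R[i]) != 0 by rewrite pnatr_eq0.
pose al := 2 * p ^+ 2 / D; pose be := - (2 * p * q) / D.
have al0 : al != 0 by rewrite /al !mulf_neq0 ?invr_neq0 ?expf_neq0.
have ba : be / al = - (q / p) by rewrite /be /al; field; rewrite p0 D0.
have abE x : al * x - be = (al / p) * (p * x + q).
  by rewrite /be /al; field; rewrite p0 D0.
have gE' (z : rhp R) : val (g z) = - (be / al) - 2 / (al * shift z - be).
  apply: (mulIf (pq0 z)); rewrite gE abE ba.
  have -> : 2 / (al / p * (p * shift z + q)) = D / p / (p * shift z + q).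
    rewrite /al; have := pq0 z; set y := _ + q => y0; field; by rewrite p0 D0 y0.
  rewrite opprK mulrBl divfK //; rewrite /D; field.
  by rewrite p0.
exists al, be, (f w1 * ((p * shift w1 + q) * (al / p)) ^+ (l + 2)); split=> //; last first.
  move=> w; split; first exact: gE'.
  rewrite (weightE w w1) -mulrA -expr_div_n; congr (_ * _ ^+ _).
  have ap0 : al / p != 0 by rewrite mulf_neq0 ?invr_neq0.
  rewrite abE [al / p * _]mulrC -mulf_div divff // mulr1.
  apply/eqP; rewrite eqr_div ?pair_neq0 //; apply/eqP.
  transitivity (shift w1 * (p * shift w + q) + val (g w) * (p * shift w + q)); first by ring.
  rewrite gE; transitivity (val (g w1) * (p * shift w1 + q) + (p * shift w1 + q) * shift w); last by ring.
  by rewrite gE; ring.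
set P := be / al in gE' *; pose k := 2 / al.
have k2 : 1 / al = k * (2^-1)%:C.
  by rewrite /k fmorphV rmorph_nat mulrAC divff.
(* Otherwise the zero P + ia of the denominator would lie in the half-plane. *)
have r0 : 0 <= - Re P.
  rewrite oppr_ge0 leNgt; apply/negP => P0.
  have z0 : 0 < Re (P + (0 +i* a)) by rewrite Re_add /= addr0.
  pose z : rhp R := exist (fun z : R[i] => 0 < Re z) _ z0.
  have := pq0 z; rewrite /= addrK /P ba mulrN mulrCA divff // mulr1 addNr eqxx //.
(* For z = X + P + ia the value of g is - P - k / X, which has positive real part. *)
have HX X : - Re P < Re X -> Re (k / X) < - Re P.
  move=> rX; have z0 : 0 < Re (X + P + (0 +i* a)) by rewrite !Re_add /= addr0 -ltrBlDr sub0r.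
  pose z : rhp R := exist (fun z : R[i] => 0 < Re z) _ z0.
  have := valP (g z); rewrite gE' /= addrK mulrDr [al * P]mulrC divfK // addrK.
  by rewrite invfM mulrA -/k Re_add !Re_opp subr_gt0.
have [h1 h2] := halfplane_inversion_bound r0 HX.
have Rk : Re (1 / al) = Re k / 2 by rewrite k2 Re_mul /= mulr0 subr0.
have [P0|P0] := eqVneq (Re P) 0.
  left; have [i0 n0] := h1 ltac:(by rewrite P0 oppr0); split=> //.
    by rewrite k2 Im_mul /= mulr0 add0r i0 mul0r.
  by rewrite Rk pmulr_llt0 // invr_gt0.
right; split; first by rewrite lt_neqAle P0 -oppr_ge0.
have -> : 1 / normc al = normc k / 2.
  have -> : 1 / normc al = normc (1 / al) by rewrite !div1r Normc.normcV.
  by rewrite k2 Normc.normcM normc_real ger0_norm.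
by rewrite Rk -mulrDl ler_pdivrMr // addrC mulrC -sqrrN.
Qed.

(** With one base point w1 fixed, p vanishing for all w means that g is a translation. Otherwise fix
    w with p nonzero: the determinant q^2 - s p of the Moebius map separates the constant from the
    fractional case. *)
Lemma symbol_cases : [\/ case_constant l a f g, case_translation f g | case_fractional l a f g].
Proof.
pose p (w : rhp R) := shift w + val (g w1) - shift w1 - val (g w).
have [pw|/existsNP[w /eqP pw]] := pselect (forall w, p w = 0).
  apply: Or32; apply: (@translation_symbols (val (g w1) - val w1)) => z.
  by have := pw z; rewrite /p => /eqP; rewrite subr_eq0 => /eqP <-; ring.
pose q := shift w * val (g w) - shift w1 * val (g w1).
pose s := shift w * shift w1 * (val (g w1) - val (g w)) + val (g w) * val (g w1) * (shift w - shift w1).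
have gE (z : rhp R) : val (g z) * (p w * shift z + q) = q * shift z + s.
  exact: (three_point_identity (three_point z w w1)).
have [D0|D0] := eqVneq (q ^+ 2 - s * p w) 0; last exact/Or33/(fractional_symbols pw D0 gE).
apply: Or31; apply: (@constant_symbols (q / p w)).
have sE : s = q ^+ 2 / p w by rewrite -[s](mulfK pw); congr (_ / _); apply/esym/eqP; rewrite -subr_eq0 D0.
have base (z : rhp R) : p w * shift z + q != 0 -> val (g z) = q / p w.
  move=> z0; apply: (mulIf z0); rewrite gE sE; field; exact: pw.
(* If the denominator vanishes at z, it does not at z + 1 and z + 2, where g has the constant value;
   the three-point equation for these three points then gives g(z). *)
move=> z; have [z0|] := eqVneq (p w * shift z + q) 0; last exact: base.
have zn n : 0 < Re (val z + n.+1%:R).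
  by rewrite Re_add addr_gt0 //; [exact: (valP z)|rewrite -(rmorph_nat (real_complex R)) /= ltr0n].
pose t n : rhp R := exist (fun z : R[i] => 0 < Re z) _ (zn n).
have tE n : val (t n) = val z + n.+1%:R by [].
have gt n : val (g (t n)) = q / p w.
  apply: base; rewrite tE addrAC mulrDr addrAC z0 add0r mulf_neq0 // pnatr_eq0.
have := three_point_identity (three_point z (t 0) (t 1)).
rewrite !gt !tE; set mu := q / p w; set x := shift z => E.
have pn := pair_neq0 z (g (t 0)); rewrite gt -/x -/mu in pn.
apply: (mulIf pn); apply: oppr_inj; transitivity (val (g z) * ((val z + 1%:R - (0 +i* a) + mu - (val z + 2%:R - (0 +i* a)) - mu) *
  x + ((val z + 1%:R - (0 +i* a)) * mu - (val z + 2%:R - (0 +i* a)) * mu))); first by ring.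
by rewrite E /x; ring.
Qed.

End Symbols.

(** * The three families of symbols yield symmetric bounded operators *)

Section Sufficiency.
Context {R : realType} (l : nat) (a : R).
Local Notation H := (rhp R -> R[i]).
Variables (f : H) (g : rhp R -> rhp R).
Local Notation V := (op_app (wcomp_max l f g)).

Lemma symmetric_bounded_constant : case_constant l a f g -> symmetric_bounded l a V.
Proof.
move=> [mu [delta [mu0 E]]]; apply: (@symmetric_bounded_kern R l a V mu delta mu0) => h z /=.
by have [<- ->] := E z; rewrite extend_val.
Qed.

Lemma symmetric_bounded_translation : case_translation f g -> symmetric_bounded l a V.
Proof.
move=> [c [lam [c0 E]]]; apply: (@symmetric_bounded_transl R l a V c lam c0) => h.
by apply/funext => z /=; have [gE ->] := E z; rewrite /transl -gE extend_val.
Qed.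

(** Let k = 2 / alpha, p = beta / alpha, x = w - ia, and let q be a square root of k with Re q >= 0.
    Then g(w) = - p - q^2 / (x - p), which is the map of [moebius] with shifts - p - q, 1 / q and -
    p - q - ia. The conditions on alpha and beta give Re q <= - Re p, because 2 (Re q)^2 = |k| + Re
    k. *)
Lemma symmetric_bounded_fractional : case_fractional l a f g -> symmetric_bounded l a V.
Proof.
move=> [al [be [delta [al0 par E]]]]; set p := be / al in par E.
pose k := 2 / al.
have two0 : (2 : R[i]) != 0 by rewrite pnatr_eq0.
have k0 : k != 0 by rewrite mulf_neq0 ?invr_neq0.
have [q q2 q0] : exists2 q : R[i], q ^+ 2 = k & 0 <= Re q.
  have [h|h] := lerP 0 (Re (sqrtC k)); first by exists (sqrtC k) => //; exact: sqrtCK.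
  by exists (- sqrtC k); [rewrite sqrrN sqrtCK|rewrite Re_opp oppr_ge0 ltW].
have qn : q != 0 by apply: contra_neq k0 => q00; rewrite -q2 q00 expr0n.
have qq : 2 * Re q ^+ 2 = normc k + Re k.
  rewrite -q2 normcX sqr_normcE expr2 Re_mul; ring.
have k2 : 1 / al = k * (2^-1)%:C.
  by rewrite /k fmorphV rmorph_nat mulrAC divff.
have Rk : Re (1 / al) = Re k / 2 by rewrite k2 Re_mul /= mulr0 subr0.
have Nk : 1 / normc al = normc k / 2.
  have -> : 1 / normc al = normc (1 / al) by rewrite !div1r Normc.normcV.
  by rewrite k2 Normc.normcM normc_real ger0_norm.
have c0 : 0 <= Re (- p - q).
  rewrite Re_add !Re_opp subr_ge0.
  (* In the first alternative k is a negative real number, so q is purely imaginary and Re p = 0; in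
     the second the squares of Re q and - Re p are compared. *)
  case: par => [[p0 i0 r0]|[p0 r0]].
    have ik : Im k = 0.
      by move: i0; rewrite k2 Im_mul /= mulr0 add0r => /eqP; rewrite mulf_eq0 invr_eq0 pnatr_eq0 orbF => /eqP.
    have rk : Re k < 0 by move: r0; rewrite Rk pmulr_llt0 // invr_gt0.
    have nk : normc k = - Re k.
      by move: ik rk; case: (k) => x y /= -> x0; rewrite expr0n addr0 sqrtr_sqr ltr0_norm.
    move/eqP: qq; rewrite nk addNr mulf_eq0 pnatr_eq0 /= expf_eq0 /= => /eqP ->.
    by rewrite p0 oppr0.
  have : Re q ^+ 2 <= (- Re p) ^+ 2.
    rewrite sqrrN; apply: le_trans r0; rewrite Rk Nk; move: qq; clear; lra.
  by rewrite ler_sqr ?nnegrE // oppr_ge0 ltW.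
have qV0 : 0 <= Re q^-1.
  move: q0; rewrite le_eqVlt => /orP[/eqP q0|q0]; last exact/ltW/ReV_gt0.
  by move: q0; case: (q) => x y /= <-; rewrite mul0r.
have c3 : 0 <= Re (- (0 +i* a) - p - q).
  by rewrite -addrA Re_add Re_opp /= oppr0 add0r.
apply: (@symmetric_bounded_moebius R l a V (- p - q) q^-1 (- (0 +i* a) - p - q)
  (delta * (q^-1 / al) ^+ (l + 2))) => //; first ring.
move=> h; apply/funext => z; have [gE fE] := E z.
rewrite moebiusE //= -[sval z]/(val z).
set x := val z - (0 +i* a).
have den : 1 + q^-1 * (val z + (- (0 +i* a) - p - q)) = (q^-1 / al) * (al * x - be).
  rewrite /x /p; field; by rewrite al0 qn.
have DE : al * x - be = al * (x - p) by rewrite /p [RHS]mulrBr [al * (be / al)]mulrC divfK.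
have den0 : al * x - be != 0.
  rewrite DE mulf_neq0 //; apply: complex_neq0; rewrite !Re_add !Re_opp /= subr0.
  have p0 : Re p <= 0 by case: par => [[-> _ _] //|[/ltW]].
  by rewrite ltr_wpDr ?oppr_ge0 //; exact: (valP z).
have -> : (val z + (- (0 +i* a) - p - q)) / (1 + q^-1 * (val z + (- (0 +i* a) - p - q))) + (- p - q) =
    val (g z).
  rewrite den gE -/x.
  have -> : val z + (- (0 +i* a) - p - q) = (al * x - be) / al - q.
    by rewrite DE [al * _]mulrC mulfK // /x; ring.
  have -> : 2 / (al * x - be) = q ^+ 2 * al / (al * x - be) by rewrite q2 divfK.
  move: (al * x - be) den0 => D den0; field.
  by rewrite al0 qn den0.
rewrite extend_val fE den -/x [(_ * (al * x - be)) ^+ _]exprMn.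
have e0 : (q^-1 / al) ^+ (l + 2) != 0 by rewrite expf_neq0 // mulf_neq0 ?invr_neq0.
by rewrite invfM !mulrA mulfK.
Qed.
End Sufficiency.

End Background.

(* If f vanishes identically then every maximal weighted composition operator
   is 0, hence C_a-selfadjoint, whatever g is; so the form of g can only be
   determined when f is not identically zero. *)
Theorem theorem5p4 (R : realType) (l : nat) (a : R)
    (f : rhp R -> R[i]) (g : rhp R -> rhp R) (W : operator R)
    (f_analytic : analytic f) (g_analytic : analytic_map g)
    (W_linear : linear_operator l W)
    (W_le_max : op_le W (wcomp_max l f g)) :
  (C_selfadjoint l (conj_a a) W <->
     op_eq W (wcomp_max l f g) /\
     ((exists w : rhp R, f w != 0) ->
        [\/ case_constant l a f g,
            case_translation f g |
            case_fractional l a f g]))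
  /\ (C_selfadjoint l (conj_a a) W -> bounded_operator l W).
Proof.
pose cases := [\/ case_constant l a f g, case_translation f g | case_fractional l a f g].
have good : ((exists w : rhp R, f w != 0) -> cases) ->
    symmetric_bounded l a (op_app (wcomp_max l f g)).
  have [ne /(_ ne)[]|zero _] := pselect (exists w, f w != 0).
  - exact: symmetric_bounded_constant.
  - exact: symmetric_bounded_translation.
  - exact: symmetric_bounded_fractional.
  (* For f identically 0 the operator is 0 times the translation by 0. *)
  apply: (@symmetric_bounded_transl R l a _ 0 0) => // h; apply/funext => z /=.
  rewrite mul0r (_ : f z = 0) ?mul0r //; apply/eqP; apply: contrapT => /negP fz.
  by apply: zero; exists z.
have sa_cases : C_selfadjoint l (conj_a a) W -> (exists w : rhp R, f w != 0) -> cases.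
  move=> sa [w fw]; exact: (symbol_cases g_analytic (symbol_equation W_le_max sa) fw).
split; last by move=> sa; apply: (symmetric_bounded_C_selfadjoint W_le_max (good (sa_cases sa))).2.
split=> [sa|[Wmax cs]].
  split; last exact: sa_cases.
  exact: ((symmetric_bounded_C_selfadjoint W_le_max (good (sa_cases sa))).1.1 sa).
exact: ((symmetric_bounded_C_selfadjoint W_le_max (good cs)).1.2 Wmax).
Qed.
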